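(* There is a universal constant $C>0$, and for all $\beta>0$ and $M>0$ there is a constant $C_\beta>0$ depending only on $\beta$ and $M$, such that the following holds. Let $U\subset\mathbb{R}^2$ be open, let $\chi$ be a smooth, non-negative function compactly supported in $U$, and let $\widehat U=\{x\in\mathbb{R}^2 \mid d(x,U)<1\}$. Let $\Lambda\subset\widehat U$ be a finite set, $\nu=\sum_{p\in\Lambda}\delta_p$, let $m$ be a positive Radon measure on $\widehat U$ satisfying $$m(B(x,r))\le \pi M r\qquad \text{for all } 0<r<1 \text{ and all } x\in\widehat U,$$ and let $j:\widehat U\to\mathbb{R}^2$ be a vector field with $$\operatorname{curl} j=2\pi\nu-m,\qquad \operatorname{div} j=0\qquad\text{in } \widehat U .$$ Then there exists a vector field $G:\widehat U\to\mathbb{R}^2$ (the same for all $\beta$) such that: 1. $\|G\|_{L^{2,\infty}(\widehat U)}^2\le C n$; 2. for every $\beta>0$, $$\frac12\int_U \chi\,|j-G|^2\,dx\le (1+\beta)\,W(j,\chi)+C_\beta\, n\left(\|\chi\|_{L^\infty}+\|\nabla\chi\|_{L^\infty}\right)+C_\beta\, n'\log n',$$ where $n=\nu(\widehat U)=\#\Lambda$ and $$n'=\#\left\{p\in\Lambda \;\middle|\; B(p,\tfrac12)\cap\{0<\chi\le\tfrac12\|\chi\|_{L^\infty}\}\neq\varnothing\right\}.$$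
   Context: $B(x,r)$ and $\bar B(x,r)$ are the open and closed balls in $\mathbb{R}^2$; $m$ is regarded as a measure on $\widehat U$, so $m(B(x,r))$ means $m(B(x,r)\cap\widehat U)$. The equations for $j$ hold in the sense of distributions, with $\operatorname{curl} j=\partial_1 j_2-\partial_2 j_1$. The renormalized energy is $$W(j,\chi)=\lim_{\eta\to0}\left(\frac12\int_{\mathbb{R}^2\setminus\bigcup_{p\in\Lambda}\bar B(p,\eta)}\chi|j|^2\,dx+\pi\log\eta\sum_{p\in\Lambda}\chi(p)\right),$$ where $\chi|j|^2$ is extended by $0$ outside the support of $\chi$; the limit exists under the stated assumptions. The Lorentz norm on a measurable set $\Omega\subseteq\mathbb{R}^2$ is $$\|f\|_{L^{2,\infty}(\Omega)}=\sup_{E\subset\Omega,\ 0<|E|<\infty}|E|^{-1/2}\int_E|f(x)|\,dx,$$ where $|E|$ is Lebesgue measure. Convention: $0\log 0=0$. *)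

(* Defs.v *)
From HB Require Import structures.
From mathcomp Require Import all_boot all_order all_algebra finmap.
From mathcomp Require Import all_classical all_reals all_analysis.

Set Implicit Arguments.
Unset Strict Implicit.
Unset Printing Implicit Defensive.
Import Order.TTheory GRing.Theory Num.Theory.
Import numFieldNormedType.Exports.
Local Open Scope classical_set_scope.
Local Open Scope ring_scope.

(* [measurableTypeR R] is [R] with its Borel sigma-algebra; using it here makes
   the product sigma-algebra on the plane the one of [lebesgue_measure \x
   lebesgue_measure]. Topology and vector structure are those of [R * R]. *)
Notation plane R := (measurableTypeR R * measurableTypeR R)%type.

Notation leb2 R := (@lebesgue_measure R \x @lebesgue_measure R)%E.

Section Plane.
Context {R : realType}.
Implicit Types (x y p : plane R) (r : R) (A K Omega : set (plane R)).
Implicit Types (f chi phi : plane R -> R) (j G : plane R -> plane R).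
Implicit Types (Lambda : {fset plane R}).

(* The library norm and [ball] on a product are those of the sup norm, hence
   the Euclidean versions below; the topologies agree. *)
Definition enorm x : R := Num.sqrt (x.1 ^+ 2 + x.2 ^+ 2).
Definition eball x r : set (plane R) := [set y | enorm (y - x) < r].
Definition ecball x r : set (plane R) := [set y | enorm (y - x) <= r].

(* Equal to +oo when [A] is empty. *)
Definition edist_to A x : \bar R :=
  ereal_inf [set (enorm (x - y))%:E | y in A].
Definition enlarge A : set (plane R) := [set x | (edist_to A x < 1%:E)%E].

(* [false] and [true] stand for the first and second coordinate. *)
Definition dir (i : bool) : plane R := if i then (0, 1) else (1, 0).
Definition partial (i : bool) f : plane R -> R := fun x => 'D_(dir i) f x.
Definition partials (s : seq bool) f : plane R -> R := foldr partial f s.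
Definition grad f x : plane R := (partial false f x, partial true f x).

Definition smooth f : Prop := forall s : seq bool,
  continuous (partials s f) /\
  forall i x, derivable (partials s f) x (dir i).

Definition supp f : set (plane R) := closure [set x | f x != 0].
Definition compactly_supported_in Omega f : Prop :=
  compact (supp f) /\ supp f `<=` Omega.

Definition test_function Omega phi : Prop :=
  smooth phi /\ compactly_supported_in Omega phi.

Definition distribution : Type := (plane R -> R) -> R.
Implicit Types (S T : distribution).

Definition distr_eq Omega S T : Prop :=
  forall phi, test_function Omega phi -> S phi = T phi.
Definition distr_partial (i : bool) T : distribution :=
  fun phi => - T (partial i phi).
Definition distr_of_fun Omega f : distribution :=
  fun phi => \int[leb2 R]_(x in Omega) (f x * phi x).
Definition distr_of_measure Omega (m : {measure set (plane R) -> \bar R}) :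
  distribution := fun phi => \int[m]_(x in Omega) phi x.
Definition distr_of_points Lambda : distribution :=
  fun phi => \sum_(p <- Lambda) phi p.

Definition curl Omega j : distribution := fun phi =>
  distr_partial false (distr_of_fun Omega (fun x => (j x).2)) phi -
  distr_partial true (distr_of_fun Omega (fun x => (j x).1)) phi.
Definition div Omega j : distribution := fun phi =>
  distr_partial false (distr_of_fun Omega (fun x => (j x).1)) phi +
  distr_partial true (distr_of_fun Omega (fun x => (j x).2)) phi.

(* What is needed for [curl] and [div] to be distributions on [Omega]. *)
Definition loc_integrable Omega j : Prop :=
  measurable_fun Omega j /\
  forall K, compact K -> K `<=` Omega ->
    (\int[leb2 R]_(x in K) (enorm (j x))%:E < +oo)%E.

(* On an open subset of the plane, a Borel measure that is finite on compact
   sets is automatically inner and outer regular. *)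
Definition radon_on Omega (m : {measure set (plane R) -> \bar R}) : Prop :=
  forall K, compact K -> K `<=` Omega -> (m K < +oo)%E.

(* [0] is adjoined to the set so that the norm is [0], and not [-oo], when
   [Omega] is a null set. *)
Definition lorentz_norm Omega G : \bar R :=
  ereal_sup (0%E |` [set v | exists E : set (plane R),
    [/\ measurable E, E `<=` Omega, (0 < leb2 R E)%E, (leb2 R E < +oo)%E &
      v = ((Num.sqrt (fine (leb2 R E)))^-1%:E *
           \int[leb2 R]_(x in E) (enorm (G x))%:E)%E]]).

Definition truncated_energy Lambda j chi (eta : R) : \bar R :=
  ((2^-1)%:E *
     \int[leb2 R]_(x in ~` \bigcup_(p in [set` Lambda]) ecball p eta)
        (chi x * enorm (j x) ^+ 2)%:E +
   (pi * ln eta * \sum_(p <- Lambda) chi p)%:E)%E.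
Definition renormalized_energy Lambda j chi : \bar R :=
  lim (truncated_energy Lambda j chi eta @[eta --> 0^'+]).

Definition sup_norm f : \bar R := 'N[leb2 R]_+oo[EFin \o f]%E.

Definition low_set chi : set (plane R) :=
  [set x | 0 < chi x /\ ((chi x)%:E <= (2^-1)%:E * sup_norm chi)%E].
Definition low_count Lambda chi : nat :=
  #|` [fset p in Lambda | `[< eball p 2^-1 `&` low_set chi !=set0 >]]%fset|.

End Plane.

(* Main.v *)
Require Import Defs.
From HB Require Import structures.
From mathcomp Require Import all_boot all_order all_algebra finmap.
From mathcomp Require Import all_classical all_reals all_analysis.
From mathcomp Require Import measurable_realfun ess_sup_inf.
From mathcomp Require Import ring lra.
Import Order.TTheory GRing.Theory Num.Theory.
Import numFieldNormedType.Exports.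
Local Open Scope classical_set_scope.
Local Open Scope ring_scope.
Set Implicit Arguments.
Unset Strict Implicit.
Unset Printing Implicit Defensive.

(** Why the estimate holds. Let tau be a Lipschitz function supported where chi is
   positive, and let G be the field with chi G = perp(grad tau), the gradient of tau
   rotated by a right angle. Completing the square gives, without any error term,
<<
   chi |j|^2 / 2 = chi |j - G|^2 / 2 + j . perp(grad tau) - |grad tau|^2 / (2 chi),
>>
   and the equation for the curl, tested on tau, evaluates the integral of the middle
   term as 2 pi (sum of tau over Lambda) minus the integral of tau against m. The
   energy of j - G is therefore bounded as soon as tau satisfies, with
   lam = sup chi + sup |grad chi| and for every p in Lambda with chi(p) > 0,
   - tau(p) >= chi(p) ln(1/eta) - O(lam), and the integral of tau against m is O(n lam),
     M being fixed;
   - the integral of |grad tau|^2 / (2 chi) is at most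
     pi ln(1/eta) (sum of chi over Lambda) + O(n lam).
   The logarithms then combine into the counterterm of the truncated energy.

   For one point, the truncated logarithm chi(p) ln(rho / max(r, eta)), stopped at 0
   at the distance rho = chi(p) / (8 lam), has these properties, because chi is nearly
   constant on that scale ([capped_log], [integral_capped_log]). For several points
   the discs of radius rho may overlap in any manner, and a sum of such functions
   would have too large a gradient. A maximum does not: almost everywhere, its gradient
   is one of the gradients. The soft maximum [softmax] with a stiffness of order
   (1 + ln N) / lam, N being the number of points, loses only O(lam) in the values,
   and its gradient is a convex combination of the gradients, so that by Jensen's
   inequality the energies add up ([integral_grad_density]). These two facts make up
   [shield_truncated_energy].

   Three points remain. The function tau is no test function; it is a limit of smooth
   ones under which the tested equation survives ([vortex_pairing]). The limit that
   defines the renormalized energy has to be compared with the truncated energies: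
   the same square, completed on an annulus about one point, shows that these are
   monotone up to an error tending to 0, so their limit exists in the extended reals
   and bounds each of them up to that error ([truncated_energy_le]). Lastly, |G| is at
   most an average of the functions 2/|x - p|, and a level set argument bounds its
   integral over E by a multiple of the square root of n |E| ([lorentz_vortices_le]). *)

(** * The Euclidean norm and the area of discs *)

Section EuclideanNorm.
Context {R : realType}.
Implicit Types (x y p : plane R) (r s : R).

Lemma enorm_ge0 x : 0 <= enorm x.
Proof. exact: sqrtr_ge0. Qed.

Lemma sqr_enorm x : enorm x ^+ 2 = x.1 ^+ 2 + x.2 ^+ 2.
Proof. by rewrite /enorm sqr_sqrtr// addr_ge0// sqr_ge0. Qed.

Lemma enorm_le x r : 0 <= r -> (enorm x <= r) = (x.1 ^+ 2 + x.2 ^+ 2 <= r ^+ 2).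
Proof.
by move=> r0; rewrite -sqr_enorm ler_sqr ?nnegrE// enorm_ge0.
Qed.

Lemma enorm0 : enorm (0 : plane R) = 0.
Proof. by rewrite /enorm /= !expr0n/= addr0 sqrtr0. Qed.

Lemma enorm_eq0 x : (enorm x == 0) = (x == 0).
Proof.
apply/eqP/eqP => [x0|->]; last exact: enorm0.
have := sqr_enorm x; rewrite x0 expr0n/= => /esym/eqP.
rewrite paddr_eq0 ?sqr_ge0// !sqrf_eq0 => /andP[/eqP a /eqP b].
by case: x {x0} a b => ? ? /= -> ->.
Qed.

Lemma enormN x : enorm (- x) = enorm x.
Proof. by rewrite /enorm /= !sqrrN. Qed.

Lemma enorm_distC x y : enorm (x - y) = enorm (y - x).
Proof. by rewrite -enormN opprB. Qed.

Lemma normr_fst_le x : `|x.1| <= enorm x.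
Proof. by rewrite -sqrtr_sqr ler_wsqrtr// lerDl sqr_ge0. Qed.

Lemma normr_snd_le x : `|x.2| <= enorm x.
Proof. by rewrite -sqrtr_sqr ler_wsqrtr// lerDr sqr_ge0. Qed.

Lemma dot_le x y : x.1 * y.1 + x.2 * y.2 <= enorm x * enorm y.
Proof.
rewrite (le_trans (ler_norm _))// -[leLHS]ger0_norm// -sqrtr_sqr.
rewrite real_normK ?num_real//.
rewrite -[leRHS]ger0_norm ?mulr_ge0 ?enorm_ge0// -[leRHS]sqrtr_sqr ler_wsqrtr//.
rewrite exprMn !sqr_enorm.
have := sqr_ge0 (x.1 * y.2 - x.2 * y.1); nra.
Qed.

Lemma ler_enormD x y : enorm (x + y) <= enorm x + enorm y.
Proof.
rewrite enorm_le ?addr_ge0 ?enorm_ge0//=.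
have := dot_le x y; have := sqr_enorm x; have := sqr_enorm y; nra.
Qed.

Lemma measurable_enorm : measurable_fun setT (@enorm R).
Proof.
apply: (@measurableT_comp _ _ _ _ _ _ (@Num.sqrt R) _
   (fun x : plane R => x.1 ^+ 2 + x.2 ^+ 2)).
  exact: continuous_measurable_fun (@sqrt_continuous R).
by apply: measurable_funD; apply: measurable_funX.
Qed.

Lemma measurable_enorm_sub p : measurable_fun setT (fun x : plane R => enorm (x - p)).
Proof.
apply: (@measurableT_comp _ _ _ _ _ _ (@Num.sqrt R) _
   (fun x : plane R => (x.1 - p.1) ^+ 2 + (x.2 - p.2) ^+ 2)).
  exact: continuous_measurable_fun (@sqrt_continuous R).
by apply: measurable_funD; apply: measurable_funX; apply: measurable_funB.
Qed.

Lemma measurable_ecball p r : measurable (ecball p r).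
Proof.
have := measurable_enorm_sub p measurableT (measurable_itv `]-oo, r]).
rewrite setTI; congr measurable; apply/seteqP; split => x /=;
 by rewrite in_itv/=.
Qed.

Lemma measurable_eball p r : measurable (eball p r).
Proof.
have := measurable_enorm_sub p measurableT (measurable_itv `]-oo, r[).
rewrite setTI; congr measurable; apply/seteqP; split => x /=;
 by rewrite in_itv/=.
Qed.

End EuclideanNorm.

Section DiscArea.
Context {R : realType}.
Implicit Types (x y p : plane R) (r s : R).
Local Notation leb := (@lebesgue_measure R).

(* the area under a half circle, by the substitution x = a + r sin t *)
Lemma integral_half_disc a r : 0 < r ->
  (\int[leb]_(x in `[(a - r)%R, (a + r)%R]) (2 * Num.sqrt (r ^+ 2 - (x - a) ^+ 2))%:E
   = (pi * r ^+ 2)%:E)%E.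
Proof.
move=> r0; have p2 : 0 < (pi : R) / 2 by rewrite divr_gt0 ?pi_gt0.
pose F t : R := a + r * sin t.
have dF (t : R) : is_derive t (1 : R) F (r * cos t).
  rewrite /F; apply: is_derive_eq. by rewrite add0r mul1r.
have F_der : F^`()%classic = (fun t => r * cos t).
  by apply/funext => t; rewrite derive1E; exact: derive_val.
have cF : continuous F.
  by move=> t; apply: differentiable_continuous; apply/derivable1_diffP.
have cF' : continuous (fun t : R => r * cos t).
  by move=> t; apply: cvgM; [exact: cvg_cst|exact: continuous_cos].
have -> : a - r = F (- (pi / 2)) by rewrite /F sinN sin_pihalf mulrN1.
have -> : a + r = F (pi / 2) by rewrite /F sin_pihalf mulr1.
rewrite integration_by_substitution_increasing//.
- rewrite F_der.
  pose H t : R := r ^+ 2 * (t + sin t * cos t).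
  have dH (t : R) : is_derive t (1 : R) H (2 * r ^+ 2 * cos t ^+ 2).
    rewrite /H; apply: is_derive_eq; rewrite /= /GRing.scale/=.
    have := cos2Dsin2 t; nra.
  transitivity (\int[leb]_(t in `[(- (pi / 2))%R, (pi / 2)%R])
     (2 * r ^+ 2 * cos t ^+ 2)%:E)%E.
    apply: eq_integral => t; rewrite inE /= in_itv/= => /andP[t1 t2].
    congr EFin.
    transitivity (2 * Num.sqrt (r ^+ 2 - (F t - a) ^+ 2) * F^`()%classic t).
      by rewrite fctE /= F_der.
    rewrite F_der /F /= addrAC subrr add0r.
    have -> : r ^+ 2 - (r * sin t) ^+ 2 = (r * cos t) ^+ 2.
      by rewrite !exprMn; have := cos2Dsin2 t; nra.
    rewrite sqrtr_sqr ger0_norm; first by ring.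
    by rewrite mulr_ge0 ?(ltW r0)// cos_ge0_pihalf// t1 t2.
  rewrite (@continuous_FTC2 _ _ H).
  + rewrite /H cosN cos_pihalf !mulr0 -EFinB; congr EFin; lra.
  + by move: p2; lra.
  + apply: continuous_subspaceT => t; apply: cvgM; first exact: cvg_cst.
    by rewrite expr2; apply: cvgM; exact: continuous_cos.
  + have cH : continuous H.
      by move=> t; apply: differentiable_continuous; apply/derivable1_diffP.
    split; first by move=> t _.
      by apply: cvg_at_right_filter; exact: cH.
    by apply: cvg_at_left_filter; exact: cH.
  + by move=> t _; rewrite derive1E; exact: derive_val.
- by rewrite ge0_cp// ltW.
- move=> x y xI yI xy; rewrite /F ltrD2l ltr_pM2l// ltr_sin//.
- by rewrite F_der => t _; exact: cF'.
- by rewrite F_der; apply/cvg_ex; eexists; apply: cvg_at_right_filter; exact: cF'.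
- by rewrite F_der; apply/cvg_ex; eexists; apply: cvg_at_left_filter; exact: cF'.
- split; first by move=> t _.
    by apply: cvg_at_right_filter; exact: cF.
  by apply: cvg_at_left_filter; exact: cF.
- have cG : continuous (fun x : R => 2 * Num.sqrt (r ^+ 2 - (x - a) ^+ 2)).
    move=> x; apply: (@cvgM _ _ (nbhs x)); first exact: cvg_cst.
    apply: (@cvg_comp _ _ _ (fun x : R => r ^+ 2 - (x - a) ^+ 2) (@Num.sqrt R)
      (nbhs x) (nbhs (r ^+ 2 - (x - a) ^+ 2))); last exact: sqrt_continuous.
    apply: (@cvgB _ _ _ (nbhs x)); first exact: cvg_cst.
    rewrite expr2; apply: (@cvgM _ _ (nbhs x));
      by apply: (@cvgB _ _ _ (nbhs x)); (exact: cvg_id || exact: cvg_cst).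
  exact: continuous_subspaceT.
Qed.

Lemma ler_sqr_bound (a s : R) : 0 <= s -> a ^+ 2 <= s ^+ 2 -> - s <= a <= s.
Proof.
by move=> s0; rewrite -(real_normK (num_real a)) ler_sqr ?nnegrE// ler_norml.
Qed.

(** The vertical sections of a disc are intervals, twice as long as the height of
   the half circle. *)
Lemma leb2_ecball p r : 0 < r -> leb2 R (ecball p r) = (pi * r ^+ 2)%:E.
Proof.
move=> r0; rewrite -(integral_half_disc p.1 r0) [RHS]integral_mkcond.
rewrite /product_measure1; apply: eq_integral => x _ /=.
rewrite patchE; case: ifPn.
  rewrite inE/= in_itv/= => /andP[x1 x2].
  have xr : 0 <= r ^+ 2 - (x - p.1) ^+ 2 by nra.
  set s := Num.sqrt _.
  have s2 : s ^+ 2 = r ^+ 2 - (x - p.1) ^+ 2 by rewrite sqr_sqrtr.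
  have s0 : 0 <= s by exact: sqrtr_ge0.
  rewrite (_ : xsection _ _ = `[p.2 - s, p.2 + s]%classic); last first.
    apply/seteqP; split => y; rewrite /xsection /= inE /ecball /= in_itv/=.
      rewrite enorm_le ?(ltW r0)//= => h.
      have : (y - p.2) ^+ 2 <= s ^+ 2 by rewrite s2; nra.
      by move=> /(ler_sqr_bound s0) /andP[]; lra.
    move=> /andP[y1 y2]; rewrite enorm_le ?(ltW r0)//=.
    have : (y - p.2) ^+ 2 <= s ^+ 2 by nra.
    rewrite s2; lra.
  rewrite lebesgue_measure_itv/= lte_fin.
  case: ltP => ss; first by rewrite -EFinD; congr EFin; ring.
  rewrite (_ : 2 * s = 0)//; lra.
move=> /negP xr; rewrite (_ : xsection _ _ = set0) ?measure0//.
apply/seteqP; split => y //; rewrite /xsection /= inE /ecball /=.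
rewrite enorm_le ?(ltW r0)//= => h; apply: xr; rewrite inE/= in_itv/=.
have : (x - p.1) ^+ 2 <= r ^+ 2 by have := sqr_ge0 (y - p.2); lra.
by move=> /(ler_sqr_bound (ltW r0)) /andP[]; lra.
Qed.

End DiscArea.

(** * Radial integrals over annuli *)

Lemma measurable_invr (R : realType) : measurable_fun setT (fun x : R => x^-1).
Proof.
rewrite (_ : (fun x => x^-1) = (fun x : R => x * powR (x ^+ 2) (- 1))).
  apply: measurable_funM => //.
  apply: (measurableT_comp (measurable_powR (- 1 : R))).
  exact: measurable_funX.
apply/funext => x; rewrite powR_inv1 ?sqr_ge0//.
have [->|x0] := eqVneq x 0; first by rewrite invr0 mul0r.
by field.
Qed.

Section RadialIntegrals.
Context {R : realType}.
Implicit Types (x y p : plane R) (r s a b : R).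
Local Notation leb := (@lebesgue_measure R).

Definition annulus p a b : set (plane R) := [set x | a < enorm (x - p) <= b].

Lemma annulusE p a b : annulus p a b = ecball p b `\` ecball p a.
Proof.
apply/seteqP; split => x; rewrite /annulus /ecball/=.
  by move=> /andP[ax xb]; split => //; apply/negP; rewrite -ltNge.
by move=> [xb /negP]; rewrite -ltNge => ->.
Qed.

Lemma measurable_annulus p a b : measurable (annulus p a b).
Proof. by rewrite annulusE; apply: measurableD; exact: measurable_ecball. Qed.

Lemma leb2_set1 p : leb2 R [set p] = 0%E.
Proof.
rewrite (_ : [set p] = [set p.1] `*` [set p.2]).
  transitivity (leb [set p.1] * leb [set p.2])%E.
    by apply: product_measure1E; exact: measurable_set1.
  by have /= -> := lebesgue_measure_set1 p.1; rewrite mul0e.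
by case: p => p1 p2; apply/seteqP; split => -[x1 x2] /= [-> ->].
Qed.

Lemma leb2_ecball_ge0 p r : 0 <= r -> leb2 R (ecball p r) = (pi * r ^+ 2)%:E.
Proof.
rewrite le_eqVlt => /predU1P[<-|]; last exact: leb2_ecball.
rewrite expr0n/= mulr0; rewrite -[RHS](leb2_set1 p); congr (leb2 R _).
apply/seteqP; split => x /=; rewrite /ecball /=; last first.
  by move=> ->; rewrite subrr enorm0.
by rewrite le_eqVlt ltNge enorm_ge0 orbF enorm_eq0 subr_eq0 => /eqP.
Qed.

Lemma leb2_annulus p a b : 0 <= a -> a <= b ->
  leb2 R (annulus p a b) = (pi * (b ^+ 2 - a ^+ 2))%:E.
Proof.
move=> a0 ab; have b0 := le_trans a0 ab.
rewrite annulusE.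
have areaE r : 0 <= r -> leb2 R (ecball p r) = (pi * r ^+ 2)%:E.
  exact: leb2_ecball_ge0.
rewrite measureD; [|exact: measurable_ecball|exact: measurable_ecball|].
  rewrite (_ : ecball p b `&` ecball p a = ecball p a).
    transitivity ((pi * b ^+ 2)%:E - (pi * a ^+ 2)%:E)%E.
      by congr (_ - _)%E; exact: areaE.
    by rewrite -EFinD; congr EFin; ring.
  by apply: setIidr => x /=; rewrite /ecball /= => /le_trans; exact.
by apply: (@le_lt_trans _ _ (pi * b ^+ 2)%:E); rewrite ?ltry// -areaE.
Qed.

(* A copy of the Lebesgue measure of the plane, made to carry the sigma-finite
   structure under which Tonelli's theorem is stated. *)
Definition plane_leb : set (plane R) -> \bar R := leb2 R.
HB.instance Definition _ := Measure.on plane_leb.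

Let sigma_finite_plane_leb : sigma_finite setT plane_leb.
Proof.
exists (fun k => ecball (0 : plane R) k%:R).
  apply/esym; rewrite -subTset => x _; exists (Num.bound (enorm x)) => //=.
  by rewrite /ecball/= subr0 ltW// archi_boundP// enorm_ge0.
move=> k; split; first exact: measurable_ecball.
have /= h := leb2_ecball_ge0 (0 : plane R) (ler0n R k).
by rewrite /plane_leb h ltry.
Qed.

HB.instance Definition _ :=
  Measure_isSigmaFinite.Build _ _ _ plane_leb sigma_finite_plane_leb.

Lemma tonelli_plane (g : plane R * measurableTypeR R -> \bar R) :
  measurable_fun setT g -> (forall z, 0 <= g z)%E ->
  (\int[leb2 R]_x \int[leb]_s g (x, s) = \int[leb]_s \int[leb2 R]_x g (x, s))%E.
Proof. exact: (@fubini_tonelli _ _ _ _ _ plane_leb leb). Qed.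

(** Layer-cake formula: F is F(rho) plus the integral of f, that is of minus its
   derivative, and exchanging this integral with the one over the annulus leaves
   the areas of smaller annuli. *)
Lemma integral_radial p a rho (F f : R -> R) : 0 <= a -> a < rho ->
  measurable_fun setT f -> (forall s, 0 <= f s) -> 0 <= F rho ->
  (forall r, (a < r)%R -> (r <= rho)%R ->
    (F r)%:E = (F rho)%:E + \int[leb]_(s in `[r, rho]) (f s)%:E)%E ->
  (\int[leb2 R]_(x in annulus p a rho) (F (enorm (x - p)))%:E =
   (F rho * (pi * (rho ^+ 2 - a ^+ 2)))%:E +
   \int[leb]_(s in `]a, rho]) (f s * (pi * (s ^+ 2 - a ^+ 2)))%:E)%E.
Proof.
move=> a0 arho mf f0 F0 FE.
pose c (z : plane R * measurableTypeR R) :=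
  [&& a < enorm (z.1 - p), enorm (z.1 - p) <= z.2 & z.2 <= rho].
pose g (z : plane R * measurableTypeR R) : \bar R :=
  (if c z then f z.2 else 0)%:E.
have mc : measurable_fun setT c.
  have m1 : measurable_fun setT
      (fun z : plane R * measurableTypeR R => enorm (z.1 - p)).
    apply: (measurableT_comp (measurable_enorm_sub p)); exact: measurable_fst.
  have m2 : measurable_fun setT
      (fun z : plane R * measurableTypeR R => z.2 : R).
    exact: measurable_snd.
  apply: measurable_and; first exact: measurable_fun_ltr.
  apply: measurable_and; exact: measurable_fun_ler.
have mg : measurable_fun setT g.
  apply/measurable_EFinP; apply: measurable_fun_ifT => //.
  apply: (measurableT_comp mf); exact: measurable_snd.
have g0 z : (0 <= g z)%E by rewrite /g lee_fin; case: ifP.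
have mF := measurable_fun_fubini_tonelli_F (m2 := leb) g mg g0.
rewrite (@eq_integral _ _ _ _ _
   (fun x => (F rho)%:E + fubini_F leb g x)%E); last first.
  move=> x; rewrite inE /annulus /= => /andP[ax xr]; rewrite FE//; congr (_ + _)%E.
  rewrite integral_mkcond; apply: eq_integral => s _.
  rewrite patchE /g /c /= ax/= mem_setE in_itv/=.
  by case: ifP.
rewrite ge0_integralD//; first last.
- exact: measurable_funTS.
- by move=> x _; exact: integral_ge0.
- exact: measurable_annulus.
rewrite integral_cst; last exact: measurable_annulus.
congr (_ + _)%E.
  rewrite [RHS]EFinM; congr (_ * _)%E; apply: leb2_annulus => //.
  exact: ltW.
transitivity (\int[leb2 R]_x \int[leb]_s g (x, s))%E.
  rewrite integral_mkcond; apply: eq_integral => x _.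
  rewrite patchE; case: ifPn => // /negP; rewrite inE /annulus /= => xA.
  rewrite [RHS]integral0_eq// => s _; rewrite /g /c /=; case: ifP => // /and3P[h1 h2 h3].
  by exfalso; apply: xA; rewrite h1/= (le_trans h2).
rewrite tonelli_plane//.
rewrite [RHS]integral_mkcond; apply: eq_integral => s _.
rewrite patchE mem_setE in_itv/=.
case: ifPn => [/andP[as_ sr]|ns].
  rewrite (@eq_integral _ _ _ _ _
     (fun x => (f s)%:E * (\1_(annulus p a s) x)%:E)%E); last first.
    move=> x _; rewrite /g /c /= sr andbT indicE.
    have -> : (x \in annulus p a s) = (a < enorm (x - p) <= s).
      by apply/idP/idP; rewrite inE.
    by case: ifP => _; rewrite ?mule1 ?mule0.
  rewrite ge0_integralZl_EFin//; last first.
    by apply/measurable_EFinP; apply: measurable_indic; exact: measurable_annulus.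
  rewrite integral_indic//; last exact: measurable_annulus.
  rewrite setIT [RHS]EFinM; congr (_ * _)%E.
  by apply: leb2_annulus => //; exact: ltW.
rewrite integral0_eq// => x _; rewrite /g /c /=; case: ifP => // /and3P[h1 h2 h3].
by move: ns; rewrite h3 andbT (lt_le_trans h1 h2).
Qed.

Lemma is_deriveX_id (k : nat) (s : R) :
  is_derive s (1 : R) (fun t : R => t ^+ k) (k%:R * s ^+ k.-1).
Proof.
have := is_deriveX k (@is_derive_id _ _ s 1).
rewrite /GRing.scale/= mulr1; congr is_derive.
by apply/funext => t; rewrite exprfctE.
Qed.

(** The exponents 1 and 2 are the powers of the distance that occur below. The
   test on the sign of s makes the integrand nonnegative on the whole line, as the
   layer-cake formula asks. *)
Lemma FTC_pow (k : nat) r rho : 0 < r -> r <= rho ->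
  ((r ^+ k)^-1)%:E = (((rho ^+ k)^-1)%:E +
    \int[leb]_(s in `[r, rho]) (if 0 < s then k%:R * (s ^+ k.+1)^-1 else 0)%:E)%E.
Proof.
move=> r0; rewrite le_eqVlt => /predU1P[<-|rr].
  by rewrite set_itv1 integral_set1 adde0.
have dX (s : R) : 0 < s ->
    is_derive s (1 : R) (fun t : R => - (t ^+ k)^-1) (k%:R * (s ^+ k.+1)^-1).
  move=> s0; have sk : s ^+ k != 0 by rewrite expf_neq0// gt_eqF.
  have dv : is_derive s (1 : R) (fun t : R => (t ^+ k)^-1) _ :=
    @is_deriveV _ (fun t : R => t ^+ k) s _ 1 sk (is_deriveX_id k s).
  have : is_derive s (1 : R) (fun t : R => - (t ^+ k)^-1) _ := is_deriveN dv.
  move=> /is_derive_eq; apply; rewrite /GRing.scale/=.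
  case: k sk {dv rr r0} => [|k] sk; first by rewrite !(mul0r, mulr0, oppr0, mulr0n).
  rewrite -mulr_natl !exprS; field.
  by rewrite expf_neq0 gt_eqF.
transitivity (((rho ^+ k)^-1)%:E +
    \int[leb]_(s in `[r, rho]) (k%:R * (s ^+ k.+1)^-1)%:E)%E; last first.
  congr (_ + _)%E; apply: eq_integral => s.
  rewrite inE/= in_itv/= => /andP[rs _].
  by rewrite (lt_le_trans r0 rs).
rewrite (@continuous_FTC2 _ _ (fun t : R => - (t ^+ k)^-1) r rho rr).
- by rewrite -EFinB -EFinD; congr EFin; ring.
- apply: continuous_in_subspaceT => s; rewrite inE/= in_itv/= => /andP[rs _].
  apply: cvgM; first exact: cvg_cst.
  apply: cvgV; last exact: exprn_continuous.
  by rewrite expf_neq0// gt_eqF// (lt_le_trans r0 rs).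
- have cF (s : R) : 0 < s -> {for s, continuous (fun t : R => - (t ^+ k)^-1)}.
    move=> s0; apply: differentiable_continuous; apply/derivable1_diffP.
    by have [] := dX _ s0.
  split; first by move=> t; rewrite in_itv/= => /andP[rt _];
      have [] := dX _ (lt_trans r0 rt).
    by apply: cvg_at_right_filter; exact: cF.
  by apply: cvg_at_left_filter; apply: cF; exact: lt_trans rr.
- move=> t; rewrite in_itv/= => /andP[rt _].
  by rewrite derive1E; have [_ ->] := dX _ (lt_trans r0 rt).
Qed.

Let measurable_dpow (k : nat) :
  measurable_fun setT (fun s : R => if 0 < s then k%:R * (s ^+ k.+1)^-1 else 0).
Proof.
apply: measurable_fun_ifT => //; first exact: measurable_fun_ltr.
apply: measurable_funM => //.
by apply: (measurableT_comp (@measurable_invr R)); exact: measurable_funX.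
Qed.

(** The energy of a unit vortex in an annulus; all the logarithms come from it. *)
Lemma integral_annulus_invsq p a b : 0 < a -> a <= b ->
  (\int[leb2 R]_(x in annulus p a b) ((enorm (x - p) ^+ 2)^-1)%:E =
   (2 * pi * ln (b / a))%:E)%E.
Proof.
move=> a0; rewrite le_eqVlt => /predU1P[<-|ab].
  rewrite divff ?gt_eqF// ln1 mulr0 (_ : annulus p a a = set0) ?integral_set0//.
  apply/seteqP; split => x //; rewrite /annulus /= => /andP[]; lra.
have b0 := lt_trans a0 ab.
rewrite (@integral_radial p a b (fun r => (r ^+ 2)^-1)
  (fun s => if 0 < s then 2%:R * (s ^+ 3)^-1 else 0)) ?(ltW a0)//; last 3 first.
- by move=> s; case: ifP => // s0; rewrite mulr_ge0// invr_ge0 exprn_ge0// ltW.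
- by rewrite invr_ge0 sqr_ge0.
- by move=> r ar rb; apply: FTC_pow => //; exact: lt_trans ar.
rewrite integral_itv_obnd_cbnd; last first.
  apply/measurable_EFinP/measurable_funTS; apply: measurable_funM.
    exact: measurable_dpow.
  by apply: measurable_funM => //; apply: measurable_funB => //; exact: measurable_funX.
pose H s : R := pi * (2 * ln s + a ^+ 2 * (s ^+ 2)^-1).
have dH (s : R) : 0 < s ->
    is_derive s (1 : R) H (2 * (s ^+ 3)^-1 * (pi * (s ^+ 2 - a ^+ 2))).
  move=> s0; have s2 : s ^+ 2 != 0 by rewrite expf_neq0// gt_eqF.
  have := is_derive1_ln s0 => dln.
  have dv : is_derive s (1 : R) (fun t : R => (t ^+ 2)^-1) _ :=
    @is_deriveV _ (fun t : R => t ^+ 2) s _ 1 s2 (is_deriveX_id 2 s).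
  have : is_derive s (1 : R) H _ := is_deriveZ pi (is_deriveD (is_deriveZ 2 dln)
    (is_deriveZ (a ^+ 2) dv)).
  move=> /is_derive_eq; apply; rewrite /GRing.scale/=; field.
  by rewrite gt_eqF.
transitivity (((b ^+ 2)^-1 * (pi * (b ^+ 2 - a ^+ 2)))%:E +
  \int[leb]_(s in `[a, b])
    (2 * (s ^+ 3)^-1 * (pi * (s ^+ 2 - a ^+ 2)))%:E)%E.
  congr (_ + _)%E; apply: eq_integral => s.
  rewrite inE/= in_itv/= => /andP[as_ _].
  by rewrite (lt_le_trans a0 as_).
rewrite (@continuous_FTC2 _ _ H a b ab).
- rewrite -EFinB -EFinD; congr EFin; rewrite /H lnM ?posrE ?invr_gt0//.
  by rewrite lnV ?posrE//; field; rewrite !gt_eqF.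
- apply: continuous_in_subspaceT => s; rewrite inE/= in_itv/= => /andP[as_ _].
  apply: cvgM; first apply: cvgM; first exact: cvg_cst.
    apply: cvgV; last exact: exprn_continuous.
    by rewrite expf_neq0// gt_eqF// (lt_le_trans a0 as_).
  apply: cvgM; first exact: cvg_cst.
  by apply: cvgB; [exact: exprn_continuous|exact: cvg_cst].
- have cF (s : R) : 0 < s -> {for s, continuous H}.
    move=> s0; apply: differentiable_continuous; apply/derivable1_diffP.
    by have [] := dH _ s0.
  split; first by move=> t; rewrite in_itv/= => /andP[rt _];
      have [] := dH _ (lt_trans a0 rt).
    by apply: cvg_at_right_filter; exact: cF.
  by apply: cvg_at_left_filter; apply: cF; exact: lt_trans ab.
- move=> t; rewrite in_itv/= => /andP[rt _].
  by rewrite derive1E; have [_ ->] := dH _ (lt_trans a0 rt).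
Qed.

Lemma integral_disc_inv p b : 0 < b ->
  (\int[leb2 R]_(x in annulus p 0 b) ((enorm (x - p))^-1)%:E =
   (2 * pi * b)%:E)%E.
Proof.
move=> b0.
rewrite (@eq_integral _ _ _ _ _ (fun x => ((enorm (x - p) ^+ 1)^-1)%:E))//.
rewrite (@integral_radial p 0 b (fun r => (r ^+ 1)^-1)
  (fun s => if 0 < s then 1%:R * (s ^+ 2)^-1 else 0))//; last 3 first.
- by move=> s; case: ifP => // s0; rewrite mulr_ge0// invr_ge0 exprn_ge0// ltW.
- by rewrite invr_ge0 expr1 ltW.
- by move=> r ar rb; apply: FTC_pow.
rewrite (@eq_integral _ _ _ _ _ (cst pi%:E)); last first.
  move=> s; rewrite inE/= in_itv/= => /andP[s0 _]; rewrite s0; congr EFin.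
  by field; rewrite gt_eqF.
rewrite integral_cst//= lebesgue_measure_itv/= lte_fin b0 -!EFinB -EFinM -EFinD.
by congr EFin; field; rewrite gt_eqF.
Qed.

End RadialIntegrals.

(** * Calculus of smooth functions *)

Section SmoothCalculus.
Context {R : realType}.
Implicit Types (f g : plane R -> R) (x v : plane R) (i : bool).

(** Directional derivatives reduce to derivatives in one variable, for which the
   chain rule is available. *)
Lemma is_derive_lineP f x v (s df : R) :
  is_derive (s *: v + x) v f df <->
  is_derive s (1 : R) (fun h : R => f (h *: v + x)) df.
Proof.
have E : (fun h : R => h^-1 *: ((f \o shift (s *: v + x)) (h *: v)
      - f (s *: v + x))) =
    (fun h : R => h^-1 *: (((fun h : R => f (h *: v + x)) \o shift s) (h *: 1)
      - f (s *: v + x))).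
  apply/funext => h /=; rewrite /shift /= [h *: 1]mulr1.
  by rewrite scalerDl addrA.
split=> -[h1 h2]; split.
- by rewrite /derivable -E.
- by rewrite -h2 /derive -E.
- by rewrite /derivable E.
- by rewrite -h2 /derive E.
Qed.

Lemma is_derive_chain f (g : R -> R) x v (df dg : R) :
  is_derive x v f df -> is_derive (f x) (1 : R) g dg ->
  is_derive x v (g \o f) (dg * df).
Proof.
have x0 : 0 *: v + x = x by rewrite scale0r add0r.
rewrite -{1 2 3}x0 => /is_derive_lineP hf hg; apply/is_derive_lineP.
exact: (@is_derive1_comp _ g (fun h : R => f (h *: v + x)) 0 _ _ hg hf).
Qed.

Lemma is_derive_affine (a b s : R) :
  is_derive s (1 : R) (fun h : R => h * a + b) a.
Proof.
have := is_deriveD (is_deriveZ a (@is_derive_id _ _ s 1)) (is_derive_cst b s 1).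
move=> /is_derive_eq h; rewrite (_ : (fun h => _) = (a *: id + cst b)).
  by apply: h; rewrite addr0 /GRing.scale/= mulr1.
by apply/funext => t; rewrite mulrC.
Qed.

Lemma is_derive_fst x v : is_derive x v (fun y => y.1 : R) v.1.
Proof.
have x0 : 0 *: v + x = x by rewrite scale0r add0r.
rewrite -[X in is_derive X _ _ _]x0; apply/is_derive_lineP => /=.
exact: is_derive_affine.
Qed.

Lemma is_derive_snd x v : is_derive x v (fun y => y.2 : R) v.2.
Proof.
have x0 : 0 *: v + x = x by rewrite scale0r add0r.
rewrite -[X in is_derive X _ _ _]x0; apply/is_derive_lineP => /=.
exact: is_derive_affine.
Qed.

(** Differentiability of order k in the sense of [smooth], which is the
   conjunction over k; the closure properties go by induction on k. *)
Fixpoint smooth_upto (k : nat) f : Prop :=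
  continuous f /\
  if k is k'.+1 then forall i, (forall x, derivable f x (dir i)) /\
                            smooth_upto k' (partial i f)
  else True.

Lemma smooth_upto_continuous k f : smooth_upto k f -> continuous f.
Proof. by case: k => [|k] []. Qed.

Lemma smooth_uptoW k f : smooth_upto k.+1 f -> smooth_upto k f.
Proof.
elim: k f => [|k IH] f [cf df]; first by split.
by split => // i; split; [exact: (df i).1|apply: IH; exact: (df i).2].
Qed.

Lemma smoothP f : smooth f <-> forall k, smooth_upto k f.
Proof.
split.
  move=> sf k; rewrite -[f]/(partials [::] f).
  elim: k [::] => [|k IH] s; first by split => //; exact: (sf s).1.
  split; first exact: (sf s).1.
  by move=> i; split; [exact: (sf s).2|exact: (IH (i :: s))].
move=> sf s; elim/last_ind: s f sf => [|s i IH] f sf.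
  by split; [exact: (smooth_upto_continuous (sf 0%N))|move=> i; exact: ((sf 1%N).2 i).1].
have -> : partials (rcons s i) f = partials s (partial i f).
  by rewrite /partials foldr_rcons.
by apply: IH => k; exact: ((sf k.+1).2 i).2.
Qed.

Lemma smooth_upto_S k f (f' : bool -> plane R -> R) : continuous f ->
  (forall i x, is_derive x (dir i) f (f' i x)) ->
  (forall i, smooth_upto k (f' i)) -> smooth_upto k.+1 f.
Proof.
move=> cf df sf'; split => // i; split; first by move=> x; have [] := df i x.
have -> : partial i f = f' i; last exact: sf'.
by apply/funext => x; rewrite /partial; have [_ ->] := df i x.
Qed.

Lemma smooth_upto_is_derive k f : smooth_upto k.+1 f ->
  forall i x, is_derive x (dir i) f (partial i f x).
Proof. by move=> [_ df] i x; split => //; exact: (df i).1. Qed.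

Lemma smooth_upto_cst k (c : R) : smooth_upto k (fun=> c).
Proof.
elim: k c => [|k IH] c; first by split => // x; exact: cvg_cst.
apply: (@smooth_upto_S _ _ (fun _ _ => 0)).
- by move=> x; exact: cvg_cst.
- by move=> i; exact: IH.
Qed.

Lemma smooth_uptoD k f g : smooth_upto k f -> smooth_upto k g ->
  smooth_upto k (fun x => f x + g x).
Proof.
elim: k f g => [|k IH] f g.
  by move=> [cf _] [cg _]; split => // x; apply: cvgD; [exact: cf|exact: cg].
move=> sf sg; apply: (@smooth_upto_S _ _
  (fun i x => partial i f x + partial i g x)).
- move=> x; apply: cvgD; first exact: (smooth_upto_continuous sf).
  exact: (smooth_upto_continuous sg).
- move=> i x; have df := smooth_upto_is_derive sf i x.
  have dg := smooth_upto_is_derive sg i x; exact: is_deriveD.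
- by move=> i; apply: IH; [exact: (sf.2 i).2|exact: (sg.2 i).2].
Qed.

Lemma smooth_uptoM k f g : smooth_upto k f -> smooth_upto k g ->
  smooth_upto k (fun x => f x * g x).
Proof.
elim: k f g => [|k IH] f g.
  by move=> [cf _] [cg _]; split => // x; apply: cvgM; [exact: cf|exact: cg].
move=> sf sg; apply: (@smooth_upto_S _ _
  (fun i x => f x * partial i g x + g x * partial i f x)).
- move=> x; apply: cvgM; first exact: (smooth_upto_continuous sf).
  exact: (smooth_upto_continuous sg).
- move=> i x; have df := smooth_upto_is_derive sf i x.
  have dg := smooth_upto_is_derive sg i x; exact: is_deriveM.
- move=> i; apply: smooth_uptoD; apply: IH.
  + exact: smooth_uptoW.
  + exact: (sg.2 i).2.
  + exact: smooth_uptoW.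
  + exact: (sf.2 i).2.
Qed.

Lemma smooth_uptoV k f : (forall x, f x != 0) -> smooth_upto k f ->
  smooth_upto k (fun x => (f x)^-1).
Proof.
move=> f0; elim: k => [|k IH].
  by move=> [cf _]; split => // x; apply: cvgV => //; exact: cf.
move=> sf; apply: (@smooth_upto_S _ _
  (fun i x => -1 * ((f x)^-1 * (f x)^-1) * partial i f x)).
- by move=> x; apply: cvgV => //; exact: (smooth_upto_continuous sf).
- move=> i x; have df := smooth_upto_is_derive sf i x.
  apply: (@is_derive_chain f (fun t => t^-1)) => //.
  have := @is_deriveV _ id (f x) _ 1 (f0 x) (is_derive_id _ _).
  by move=> /is_derive_eq; apply; rewrite /GRing.scale/= mulr1 expr2 invfM mulN1r.
- move=> i; apply: smooth_uptoM; last exact: (sf.2 i).2.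
  apply: smooth_uptoM; first exact: smooth_upto_cst.
  by apply: smooth_uptoM; apply: IH; exact: smooth_uptoW.
Qed.

Lemma smooth_upto_ln k f : (forall x, 0 < f x) -> smooth_upto k f ->
  smooth_upto k (fun x => ln (f x)).
Proof.
move=> f0; have cln : continuous f -> continuous (fun x => ln (f x)).
  move=> cf x; apply: (@cvg_comp _ _ _ f (@ln R) (nbhs x) (nbhs (f x))).
    exact: cf.
  exact: continuous_ln.
case: k => [|k]; first by move=> [cf _]; split => //; exact: cln.
move=> sf; apply: (@smooth_upto_S _ _ (fun i x => (f x)^-1 * partial i f x)).
- by apply: cln; exact: (smooth_upto_continuous sf).
- move=> i x; have df := smooth_upto_is_derive sf i x.
  by apply: (@is_derive_chain f (@ln R)) => //; exact: is_derive1_ln.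
- move=> i; apply: smooth_uptoM; last exact: (sf.2 i).2.
  by apply: smooth_uptoV; [move=> x; rewrite gt_eqF|exact: smooth_uptoW].
Qed.

Lemma smooth_upto_expR k f : smooth_upto k f ->
  smooth_upto k (fun x => expR (f x)).
Proof.
have cexp : continuous f -> continuous (fun x => expR (f x)).
  move=> cf x; apply: (@cvg_comp _ _ _ f (@expR R) (nbhs x) (nbhs (f x))).
    exact: cf.
  exact: continuous_expR.
elim: k => [|k IH]; first by move=> [cf _]; split => //; exact: cexp.
move=> sf; apply: (@smooth_upto_S _ _ (fun i x => expR (f x) * partial i f x)).
- by apply: cexp; exact: (smooth_upto_continuous sf).
- move=> i x; have df := smooth_upto_is_derive sf i x.
  by apply: (@is_derive_chain f (@expR R)) => //; exact: is_derive_expR.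
- move=> i; apply: smooth_uptoM; last exact: (sf.2 i).2.
  by apply: IH; exact: smooth_uptoW.
Qed.

Lemma smooth_cst (c : R) : smooth (fun=> c : R).
Proof. by apply/smoothP => k; exact: smooth_upto_cst. Qed.

Lemma smoothD f g : smooth f -> smooth g -> smooth (fun x => f x + g x).
Proof.
by move=> /smoothP sf /smoothP sg; apply/smoothP => k; exact: smooth_uptoD.
Qed.

Lemma smoothM f g : smooth f -> smooth g -> smooth (fun x => f x * g x).
Proof.
by move=> /smoothP sf /smoothP sg; apply/smoothP => k; exact: smooth_uptoM.
Qed.

Lemma smoothV f : (forall x, f x != 0) -> smooth f -> smooth (fun x => (f x)^-1).
Proof. by move=> f0 /smoothP sf; apply/smoothP => k; exact: smooth_uptoV. Qed.

Lemma smooth_ln f : (forall x, 0 < f x) -> smooth f -> smooth (fun x => ln (f x)).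
Proof. by move=> f0 /smoothP sf; apply/smoothP => k; exact: smooth_upto_ln. Qed.

Lemma smooth_expR f : smooth f -> smooth (fun x => expR (f x)).
Proof. by move=> /smoothP sf; apply/smoothP => k; exact: smooth_upto_expR. Qed.

Lemma smoothX f n : smooth f -> smooth (fun x => f x ^+ n).
Proof.
move=> sf; elim: n => [|n IH]; first exact: smooth_cst.
rewrite (_ : (fun x => _) = (fun x => f x * f x ^+ n)); first exact: smoothM.
by apply/funext => x; rewrite exprS.
Qed.

Lemma smooth_sum (I : Type) (s : seq I) (P : pred I) (F : I -> plane R -> R) :
  (forall j, smooth (F j)) -> smooth (fun x => \sum_(j <- s | P j) F j x).
Proof.
move=> sF; elim: s => [|j s IH].
  rewrite (_ : (fun x => _) = (fun=> 0)); first exact: smooth_cst.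
  by apply/funext => x; rewrite big_nil.
rewrite (_ : (fun x => _) = (fun x => (if P j then F j x else 0) +
    \sum_(j <- s | P j) F j x)).
  apply: (smoothD _ IH).
  by case: (P j); [exact: sF|exact: smooth_cst].
by apply/funext => x; rewrite big_cons; case: ifP; rewrite ?add0r.
Qed.

Lemma continuous_fst_plane : continuous (fun x : plane R => x.1 : R).
Proof. move=> [x1 x2]; exact: cvg_fst. Qed.

Lemma continuous_snd_plane : continuous (fun x : plane R => x.2 : R).
Proof. move=> [x1 x2]; exact: cvg_snd. Qed.

Lemma smooth_fst : smooth (fun x => x.1 : R).
Proof.
apply/smoothP => -[|k]; first by split => //; exact: continuous_fst_plane.
apply: (@smooth_upto_S _ _ (fun i _ => (dir i).1)).
- exact: continuous_fst_plane.
- by move=> i x; exact: is_derive_fst.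
- by move=> i; exact: smooth_upto_cst.
Qed.

Lemma smooth_snd : smooth (fun x => x.2 : R).
Proof.
apply/smoothP => -[|k]; first by split => //; exact: continuous_snd_plane.
apply: (@smooth_upto_S _ _ (fun i _ => (dir i).2)).
- exact: continuous_snd_plane.
- by move=> i x; exact: is_derive_snd.
- by move=> i; exact: smooth_upto_cst.
Qed.

Lemma smooth_is_derive f : smooth f ->
  forall i x, is_derive x (dir i) f (partial i f x).
Proof. by move=> /smoothP /(_ 1%N) sf i x; exact: (smooth_upto_is_derive sf). Qed.

Lemma smooth_continuous f : smooth f -> continuous f.
Proof. by move=> sf; exact: (sf [::]).1. Qed.

Lemma smooth_continuous_partial f i : smooth f -> continuous (partial i f).
Proof. by move=> sf; exact: (sf [:: i]).1. Qed.

End SmoothCalculus.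

(** * Borel sets and sup norms in the plane *)

Section PlaneTopology.
Context {R : realType}.
Implicit Types (x y p : plane R) (A U K : set (plane R)) (f : plane R -> R).

Lemma nbhs_eball x A : nbhs x A -> exists2 e : R, 0 < e & eball x e `<=` A.
Proof.
move=> /nbhs_ballP[e e0 eA]; exists e => // y xy; apply: eA; split => /=.
  rewrite /ball/= distrC; apply: le_lt_trans xy; exact: (normr_fst_le (y - x)).
rewrite /ball/= distrC; apply: le_lt_trans xy; exact: (normr_snd_le (y - x)).
Qed.

Lemma continuous_enorm_sub p : continuous (fun x => enorm (x - p)).
Proof.
move=> x; apply: (@cvg_comp _ _ _
  (fun y : plane R => (y.1 - p.1) ^+ 2 + (y.2 - p.2) ^+ 2) (@Num.sqrt R)
  (nbhs x) (nbhs ((x.1 - p.1) ^+ 2 + (x.2 - p.2) ^+ 2))); last first.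
  exact: sqrt_continuous.
have c1 : (y.1 : R) @[y --> x] --> (x.1 : R) := @continuous_fst_plane R x.
have c2 : (y.2 : R) @[y --> x] --> (x.2 : R) := @continuous_snd_plane R x.
apply: (@cvgD _ _ _ (nbhs x)); rewrite expr2; apply: (@cvgM _ _ (nbhs x));
  by apply: (@cvgB _ _ _ (nbhs x)); (exact: cvg_cst || exact: c1 || exact: c2).
Qed.

Lemma open_eball p (r : R) : open (eball p r).
Proof.
rewrite (_ : eball p r = (fun x => enorm (x - p)) @^-1` [set t | t < r])//.
by apply: open_comp => [x _|]; [exact: continuous_enorm_sub|exact: open_lt].
Qed.

(** Measurability refers to the product of the Borel sigma-algebras, so an open set
   is exhibited as a union of countably many discs with rational centres. *)
Lemma open_measurable_plane A : open A -> measurable A.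
Proof.
move=> oA.
pose F (i : rat * rat * nat) : set (plane R) :=
  let B := eball ((ratr i.1.1 : R), (ratr i.1.2 : R)) i.2.+1%:R^-1 in
  if `[< B `<=` A >] then B else set0.
have -> : A = \bigcup_i F i.
  apply/seteqP; split; last first.
    by move=> x [i _]; rewrite /F; case: asboolP => // h /h.
  move=> x Ax.
  have [e e0 eA] : exists2 e : R, 0 < e & eball x e `<=` A.
    by apply: nbhs_eball; exact: open_nbhs_nbhs.
  have [k ke] : exists k : nat, k.+1%:R^-1 < e / 2.
    exists (Num.bound (e / 2)^-1); rewrite invf_plt ?posrE ?divr_gt0//.
    rewrite (lt_le_trans (archi_boundP _))// ?invr_ge0 ?divr_ge0 ?(ltW e0)//.
    by rewrite ler_nat.
  set d := k.+1%:R^-1 in ke.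
  have d0 : 0 < d by rewrite invr_gt0.
  have [a ha] : exists q : rat, (ratr q : R) \in `]x.1 - d / 2, x.1 + d / 2[.
    by apply: rat_in_itvoo; lra.
  have [b hb] : exists q : rat, (ratr q : R) \in `]x.2 - d / 2, x.2 + d / 2[.
    by apply: rat_in_itvoo; lra.
  move: ha hb; rewrite !in_itv/= => /andP[a1 a2] /andP[b1 b2].
  have xq : enorm (x - (ratr a, ratr b)) < d.
    rewrite /enorm/= -[ltRHS]ger0_norm ?(ltW d0)// -sqrtr_sqr ltr_sqrt ?exprn_gt0//.
    nra.
  have Bd : eball ((ratr a : R), (ratr b : R)) d `<=` A.
    move=> y yq; apply: eA; rewrite /eball/=.
    have := ler_enormD (y - (ratr a, ratr b)) ((ratr a, ratr b) - x).
    rewrite addrA subrK (enorm_distC (ratr a, ratr b)).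
    by move: yq; rewrite /eball/=; lra.
  exists (a, b, k) => //; rewrite /F /=.
  by case: asboolP => //; rewrite -/d.
apply: countable_bigcupT_measurable; first exact: countableP.
move=> i; rewrite /F; case: asboolP => // _; exact: measurable_eball.
Qed.

Lemma closed_measurable_plane A : closed A -> measurable A.
Proof.
move=> cA; rewrite -(setCK A); apply: measurableC.
by apply: open_measurable_plane; rewrite openC.
Qed.

Lemma continuous_measurable_plane f : continuous f -> measurable_fun setT f.
Proof.
move=> /continuousP cf; apply: (measurability _ (RGenOpens.measurableE R)).
move=> _ [_ [a [b ->] <-]]; rewrite setTI; apply: open_measurable_plane.
exact/cf/interval_open.
Qed.

Lemma enlargeE U : enlarge U = \bigcup_(y in U) eball y 1.
Proof.
apply/seteqP; split => x; rewrite /enlarge /edist_to /=.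
  move=> /ereal_inf_lt[_ [y Uy <-]]; rewrite lte_fin => xy.
  by exists y.
move=> [y Uy xy]; apply: (@le_lt_trans _ _ (enorm (x - y))%:E).
  by apply: ereal_inf_lbound; exists y.
by rewrite lte_fin.
Qed.

Lemma open_enlarge U : open (enlarge U).
Proof. by rewrite enlargeE; apply: bigcup_open => y _; exact: open_eball. Qed.

Lemma measurable_enlarge U : measurable (enlarge U).
Proof. by apply: open_measurable_plane; exact: open_enlarge. Qed.

Lemma sub_enlarge U : U `<=` enlarge U.
Proof.
move=> x Ux; rewrite enlargeE; exists x => //.
by rewrite /eball/= subrr enorm0.
Qed.

Lemma leb2_gt0 x A : measurable A -> nbhs x A -> (0 < leb2 R A)%E.
Proof.
move=> mA /nbhs_eball[e e0 eA].
have : (leb2 R (ecball x (e / 2)) <= leb2 R A)%E.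
  apply: le_measure; rewrite ?inE//; first exact: measurable_ecball.
  by move=> y yx; apply: eA; rewrite /eball/=; move: yx; rewrite /ecball/=; lra.
apply: lt_le_trans; rewrite leb2_ecball ?divr_gt0// lte_fin.
by rewrite mulr_gt0 ?pi_gt0// exprn_gt0// divr_gt0.
Qed.

Lemma leb2_setT_gt0 : (0 < leb2 R [set: plane R])%E.
Proof. by apply: (@leb2_gt0 0) => //; exact: filterT. Qed.

Lemma sup_normE f : sup_norm f = ess_sup (leb2 R) (fun x => `|f x|%:E).
Proof.
rewrite /sup_norm unlock ifT//; exact: leb2_setT_gt0.
Qed.

(** A continuous function that exceeds a number at one point does so on a
   neighbourhood, which has positive measure. *)
Lemma normr_le_sup_norm f x : continuous f -> (`|f x|%:E <= sup_norm f)%E.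
Proof.
move=> cf; rewrite sup_normE leNgt; apply/negP => h.
set s := ess_sup _ _ in h.
have [N [mN N0 subN]] := @ess_sup_ge _ _ _ (leb2 R) (fun x => `|f x|%:E).
have cnf : continuous (fun y => `|f y|).
  by move=> y; apply: cvg_norm; exact: cf.
have s_fin : exists t : R, (s <= t%:E)%E /\ t < `|f x|.
  move: h; case: s {subN} => [t| |] //=; last by exists (`|f x| - 1); split; [rewrite leNye|lra].
  by rewrite lte_fin => tx; exists t.
have [t [st tx]] := s_fin.
have nN : nbhs x N.
  have : nbhs x [set y | t < `|f y|].
    exact: (cnf x _ (lt_nbhsr tx)).
  apply: filterS => y /= ty; apply: subN => /= h'.
  by have := le_trans h' st; rewrite lee_fin leNgt ty.
by have := leb2_gt0 mN nN; rewrite N0 ltxx.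
Qed.

Lemma sup_norm_ge0 f : continuous f -> (0 <= sup_norm f)%E.
Proof.
move=> cf; apply: le_trans (normr_le_sup_norm 0 cf).
by rewrite lee_fin.
Qed.

Lemma sup_norm_le f (c : R) : (forall x, `|f x| <= c) -> (sup_norm f <= c%:E)%E.
Proof.
move=> fc; rewrite sup_normE; apply: ess_sup_ler => x.
by rewrite lee_fin.
Qed.

Lemma compact_supp_bounded f K : continuous f -> compact K ->
  (forall x, ~ K x -> f x = 0) -> exists2 c : R, 0 <= c & forall x, `|f x| <= c.
Proof.
move=> cf cK f0.
have : compact (f @` K).
  by apply: continuous_compact => //; exact: continuous_subspaceT.
move=> /compact_bounded/pinfty_ex_gt0[c c0 fc].
exists c; first exact: ltW.
move=> x; have [Kx|nKx] := pselect (K x); first by apply: fc; exists x.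
by rewrite f0// normr0 ltW.
Qed.

Lemma not_supp f x : ~ supp f x -> \forall y \near x, f y = 0.
Proof.
move=> nx; have : nbhs x (~` supp f).
  by apply: open_nbhs_nbhs; split => //; rewrite openC; exact: closed_closure.
apply: filterS => y ny; apply/eqP/negPn/negP => fy; apply: ny.
exact: subset_closure.
Qed.

Lemma not_supp0 f x : ~ supp f x -> f x = 0.
Proof. by move=> /not_supp /nbhs_singleton. Qed.

Lemma not_supp_partial f x i : ~ supp f x -> partial i f x = 0.
Proof.
move=> /not_supp nx; rewrite /partial (near_eq_derive (dir i) (g := cst 0))//.
exact: derive_cst.
Qed.

End PlaneTopology.

(** * Truncated logarithmic potentials *)

Section SoftLog.
Context {R : realType}.
Implicit Types (v : R) (k : nat).

(** A smooth substitute for half the positive part of ln v, which is its limit as k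
   grows. The half is there because v will be a squared ratio of distances. *)
Definition softlog k v : R :=
  ln (1 + v ^+ k.+1.*2 / k.+1%:R) / (4 * k.+1%:R).

Definition dsoftlog k v : R :=
  v ^+ k.*2.+1 / (k.+1%:R + v ^+ k.+1.*2) / 2.

Let arg_gt0 k v : 0 < 1 + v ^+ k.+1.*2 / k.+1%:R.
Proof.
rewrite ltr_wpDr// mulr_ge0 ?invr_ge0//.
by rewrite -mul2n exprM exprn_ge0// sqr_ge0.
Qed.

Let den_gt0 k v : 0 < k.+1%:R + v ^+ k.+1.*2 :> R.
Proof.
by rewrite ltr_pwDl// -mul2n exprM exprn_ge0// sqr_ge0.
Qed.

Lemma is_derive_softlog k v : is_derive v (1 : R) (softlog k) (dsoftlog k v).
Proof.
set c : R := k.+1%:R; have c0 : c != 0 by rewrite pnatr_eq0.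
have d1 := @is_deriveX_id R k.+1.*2 v.
have d2 : is_derive v (1 : R) (fun t : R => c^-1 * t ^+ k.+1.*2 + 1)
    (c^-1 * (k.+1.*2%:R * v ^+ k.+1.*2.-1)).
  have := is_deriveD (is_deriveZ c^-1 d1) (is_derive_cst (1 : R) v 1).
  by move=> /is_derive_eq; apply; rewrite addr0.
have argE t : c^-1 * t ^+ k.+1.*2 + 1 = 1 + t ^+ k.+1.*2 / k.+1%:R.
  by rewrite addrC mulrC.
have a0 : 0 < c^-1 * v ^+ k.+1.*2 + 1 by rewrite argE.
have d3 := @is_derive1_comp _ (@ln R) (fun t : R => c^-1 * t ^+ k.+1.*2 + 1)
  v _ _ (is_derive1_ln a0) d2.
have : is_derive v (1 : R) (fun t => (4 * c)^-1 *
    (@ln R \o (fun t : R => c^-1 * t ^+ k.+1.*2 + 1)) t) _ := is_deriveZ (4 * c)^-1 d3.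
have -> : (fun t => (4 * c)^-1 *
    (@ln R \o (fun t : R => c^-1 * t ^+ k.+1.*2 + 1)) t) = softlog k.
  by apply/funext => t; rewrite /softlog /= argE mulrC.
move=> /is_derive_eq; apply; rewrite /GRing.scale/= /dsoftlog.
have cE : k.+1.*2%:R = 2 * c :> R by rewrite -mul2n natrM.
have /lt0r_neq0 dn := den_gt0 k v; rewrite -/c in dn *.
rewrite cE; move: dn; rewrite doubleS /=; set w := v ^+ k.*2.+2.
set z := v ^+ _ => dn; clearbody c w z; field.
by rewrite c0 dn.
Qed.

Lemma softlog_ge0 k v : 0 <= softlog k v.
Proof.
rewrite /softlog divr_ge0 ?mulr_ge0// ln_ge0// lerDl mulr_ge0 ?invr_ge0//.
by rewrite -mul2n exprM exprn_ge0// sqr_ge0.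
Qed.

Lemma softlog_le k v : 0 <= v -> softlog k v <= v.
Proof.
move=> v0; rewrite /softlog ler_pdivrMr ?mulr_gt0//.
have h1 : 1 + v ^+ k.+1.*2 / k.+1%:R <= (1 + v) ^+ k.+1.*2.
  apply: (@le_trans _ _ (1 + v ^+ k.+1.*2)).
    rewrite lerD2l ler_pdivrMr// ler_peMr ?exprn_ge0//.
    by rewrite ler1n.
  rewrite doubleS; elim: k.*2.+1 => [|n IH]; first by rewrite !expr1.
  rewrite exprS [leRHS]exprS; have : 0 <= v ^+ n.+1 by rewrite exprn_ge0.
  nra.
apply: (@le_trans _ _ (ln ((1 + v) ^+ k.+1.*2))).
  by rewrite ler_ln ?posrE// exprn_gt0// ltr_pwDl.
rewrite lnXn ?ltr_pwDl// -[ln _ *+ _]mulr_natl -mul2n natrM.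
have l1 : ln (1 + v) <= v by rewrite le_ln1Dx// (lt_le_trans _ v0)// ltrN10.
have N1 : 1 <= k.+1%:R :> R by rewrite ler1n.
nra.
Qed.

Lemma dsoftlog_ge0 k v : 0 <= v -> 0 <= dsoftlog k v.
Proof. by move=> v0; rewrite !divr_ge0 ?exprn_ge0// ltW. Qed.

Lemma dsoftlog_le k v : 0 <= v -> dsoftlog k v <= 1.
Proof.
move=> v0; rewrite /dsoftlog ler_pdivrMr// mul1r ler_pdivrMr// doubleS.
have [v1|v1] := leP v 1.
  have h1 : v ^+ k.*2.+1 <= 1 by rewrite exprn_ile1.
  have h2 : 0 <= v ^+ k.*2.+2 by rewrite exprn_ge0.
  have N1 : 1 <= k.+1%:R :> R by rewrite ler1n.
  nra.
have h1 : v ^+ k.*2.+1 <= v ^+ k.*2.+2 by rewrite ler_weXn2l// ltW.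
have h2 : 0 <= v ^+ k.*2.+1 by rewrite exprn_ge0.
have N1 : 1 <= k.+1%:R :> R by rewrite ler1n.
nra.
Qed.

Lemma cvg_bounded_by (u e : nat -> R) (l : R) : (forall k, `|u k - l| <= e k) ->
  e k @[k --> \oo] --> 0 -> u k @[k --> \oo] --> l.
Proof.
move=> ue e0; apply/cvgrPdist_le => d d0.
move/cvgrPdist_le : e0 => /(_ d d0); apply: filterS => k.
by rewrite sub0r normrN distrC => ek; rewrite (le_trans (ue k))// (le_trans (ler_norm _)).
Qed.

Lemma cvg_inv_nat (c : R) : c / k.+1%:R @[k --> \oo] --> 0.
Proof.
rewrite -[X in _ --> X](mulr0 c); apply: cvgM; first exact: cvg_cst.
exact: cvg_harmonic.
Qed.

Let cvg_sqrt_inv_nat : Num.sqrt (k.+1%:R^-1 : R) @[k --> \oo] --> 0.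
Proof.
rewrite -[X in _ --> X](@sqrtr0 R).
apply: (@cvg_comp _ _ _ (fun k => k.+1%:R^-1 : R) (@Num.sqrt R) \oo (nbhs 0)).
  exact: cvg_harmonic.
exact: sqrt_continuous.
Qed.

(* Bernoulli's inequality, squared: the power outgrows the index. *)
Let pow_ge k v : 1 < v -> k.+1%:R ^+ 2 * (v - 1) ^+ 2 <= v ^+ k.+1.*2.
Proof.
move=> v1; rewrite -muln2 exprM -exprMn ler_sqr ?nnegrE; last 2 first.
- by rewrite mulr_ge0// subr_ge0 ltW.
- by rewrite exprn_ge0// ltW// (lt_trans ltr01).
have : 1 + k.+1%:R * (v - 1) <= v ^+ k.+1.
  elim: k.+1 => [|n IH]; first by rewrite mul0r addr0 expr0.
  rewrite exprS -natr1; have n0 : 0 <= n%:R :> R by [].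
  have : 0 <= (v - 1) ^+ 2 * n%:R by rewrite mulr_ge0// sqr_ge0.
  nra.
lra.
Qed.

Lemma cvg_dsoftlog v : 0 <= v ->
  dsoftlog k v @[k --> \oo] --> (if 1 < v then (2 * v)^-1 else 0).
Proof.
move=> v0; case: ifPn => [v1|]; last first.
  rewrite -leNgt => v1; apply: (@cvg_bounded_by _ (fun k => 1 / k.+1%:R)); last first.
    exact: cvg_inv_nat.
  move=> k; rewrite subr0 ger0_norm ?dsoftlog_ge0//.
  have h1 : v ^+ k.*2.+1 <= 1 by rewrite exprn_ile1.
  have h0 : 0 <= v ^+ k.*2.+1 by rewrite exprn_ge0.
  have h2 : 0 <= v ^+ k.+1.*2 by rewrite exprn_ge0.
  have N1 : 1 <= k.+1%:R :> R by rewrite ler1n.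
  rewrite ler_pdivlMr ?ltr0n// /dsoftlog.
  rewrite -mulrA -invfM mulrAC ler_pdivrMr ?mulr_gt0//; nra.
apply: (@cvg_bounded_by _ (fun k => ((v - 1) ^+ 2)^-1 / k.+1%:R)); last first.
  exact: cvg_inv_nat.
move=> k; have := pow_ge k v1; have := den_gt0 k v; rewrite /dsoftlog.
set N : R := k.+1%:R; have N0 : 0 < N by rewrite ltr0n.
rewrite doubleS exprS; set w := v ^+ _ => wd wp.
have v10 : 0 < v - 1 by rewrite subr_gt0.
have d0 : 0 < (v - 1) ^+ 2 by rewrite exprn_gt0.
have v2 : 0 < v by rewrite (lt_trans ltr01).
have -> : w / (N + v * w) / 2 - (2 * v)^-1 = - (N / (2 * v * (N + v * w))).
  clearbody N w; field.
  by rewrite !gt_eqF.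
rewrite normrN ger0_norm; last by rewrite divr_ge0 ?(ltW N0)// !mulr_ge0 ?ltW.
rewrite -invfM ler_pdivrMr ?mulr_gt0// mulrC ler_pdivlMr ?mulr_gt0//.
set d := (v - 1) ^+ 2 in d0 wp *.
have : 0 <= N + v * w - N ^+ 2 * d by lra.
nra.
Qed.

(** Whether v is above 1 or not, the error is bounded by (1 + ln N) / N with
   N = k + 1, hence by a multiple of the square root of 1 / N. *)
Lemma cvg_softlog v : 0 <= v ->
  softlog k v @[k --> \oo] --> (if 1 < v then ln v / 2 else 0).
Proof.
move=> v0.
apply: (@cvg_bounded_by _ (fun k => Num.sqrt (k.+1%:R^-1))); last first.
  exact: cvg_sqrt_inv_nat.
move=> k; set N : R := k.+1%:R; set t := Num.sqrt _.
have N1 : 1 <= N by rewrite ler1n.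
have N0 : 0 < N by rewrite ltr0n.
have t0 : 0 < t by rewrite sqrtr_gt0 invr_gt0.
have t2 : t ^+ 2 = N^-1 by rewrite sqr_sqrtr// invr_ge0 ltW.
have t1 : t <= 1.
  have : N^-1 <= 1 by rewrite invf_le1.
  rewrite -t2; nra.
have Nt : N * t ^+ 2 = 1 by rewrite t2 divff// gt_eqF.
case: ifPn => [v1|].
  have w0 : 0 < v ^+ k.+1.*2 by rewrite exprn_gt0// (lt_trans ltr01).
  have -> : softlog k v - ln v / 2 =
      ln ((v ^+ k.+1.*2)^-1 + N^-1) / (4 * N).
    have -> : (v ^+ k.+1.*2)^-1 + N^-1 = (1 + v ^+ k.+1.*2 / N) / v ^+ k.+1.*2.
      by field; rewrite !gt_eqF.
    rewrite ln_div ?posrE// lnXn ?(lt_trans ltr01)// -[ln _ *+ _]mulr_natl.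
    rewrite /softlog -/N.
    have -> : k.+1.*2%:R = 2 * N by rewrite -mul2n natrM.
    clearbody t N; set w := v ^+ _; clearbody w; field.
    by rewrite gt_eqF.
  have w1 : (v ^+ k.+1.*2)^-1 <= 1 by rewrite invf_le1// exprn_ege1// ltW.
  have wi : 0 < (v ^+ k.+1.*2)^-1 by rewrite invr_gt0.
  have N1i : N^-1 <= 1 by rewrite invf_le1.
  have h4 : 0 <= (4 * N)^-1 by rewrite invr_ge0 mulr_ge0// ltW.
  rewrite normrM (ger0_norm h4).
  rewrite ler_pdivrMr ?mulr_gt0// ler_norml; apply/andP; split.
    have : - (t^-1 *+ 2) <= ln N^-1.
      rewrite -t2 lnXn// -mulNrn lerMn2r/= lerNl -lnV//.
      by rewrite ltW// ln_sublinear// invr_gt0.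
    have : ln N^-1 <= ln ((v ^+ k.+1.*2)^-1 + N^-1).
      by rewrite ler_ln ?posrE ?addr_gt0 ?invr_gt0// lerDr ltW.
    have -> : t^-1 = t * N by rewrite -[t * N]/(t * N); apply: (mulfI (lt0r_neq0 t0));
      rewrite divff ?gt_eqF// -Nt; ring.
    rewrite -[_ *+ _]mulr_natl; nra.
  have l1 : ln ((v ^+ k.+1.*2)^-1 + N^-1) <= (v ^+ k.+1.*2)^-1 + N^-1.
    rewrite ltW// ln_sublinear// addr_gt0// invr_gt0//.
  have tN : 1 <= t * N by nra.
  rewrite (le_trans l1)// (_ : t * (4 * N) = 4 * (t * N)); last by ring.
  apply: (@le_trans _ _ (1 + 1)); first exact: lerD.
  lra.
rewrite -leNgt => v1; rewrite subr0 ger0_norm ?softlog_ge0//.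
have w1 : v ^+ k.+1.*2 <= 1 by rewrite exprn_ile1.
have w0 : 0 <= v ^+ k.+1.*2 by rewrite exprn_ge0.
rewrite /softlog -/N ler_pdivrMr ?mulr_gt0//.
have : ln (1 + v ^+ k.+1.*2 / N) <= v ^+ k.+1.*2 / N.
  by rewrite le_ln1Dx// (lt_le_trans (ltrN10 _))// divr_ge0// ltW.
have : v ^+ k.+1.*2 / N <= 1.
  by rewrite ler_pdivrMr// mul1r (le_trans w1).
have tN : 1 <= t * N by nra.
move=> h1 h2; rewrite (le_trans h2)// (le_trans h1)//.
rewrite (_ : t * (4 * N) = 4 * (t * N)); last by ring.
lra.
Qed.

End SoftLog.

Section CappedLog.
Context {R : realType}.
Implicit Types (x p : plane R) (eta rho : R) (i : bool) (k : nat).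

Definition coord i x : R := if i then x.2 else x.1.

Definition sqdist p x : R := (x.1 - p.1) ^+ 2 + (x.2 - p.2) ^+ 2.

Lemma sqdistE p x : sqdist p x = enorm (x - p) ^+ 2.
Proof. by rewrite sqr_enorm. Qed.

Lemma sqdist_ge0 p x : 0 <= sqdist p x.
Proof. by rewrite sqdistE sqr_ge0. Qed.

(** Up to sign and a factor, the logarithmic potential of a unit charge
   spread on the circle of radius eta, stopped at 0 on the circle of
   radius rho. *)
Definition capped_log p eta rho x : R :=
  let r := enorm (x - p) in
  if r <= eta then ln (rho / eta) else if r <= rho then ln (rho / r) else 0.

Definition dcapped_log i p eta rho x : R :=
  if eta < enorm (x - p) <= rho then - (coord i (x - p) / enorm (x - p) ^+ 2)
  else 0.

(** A difference of two positive parts of logarithms, softened: on each of the three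
   ranges of the distance it tends to the formula for [capped_log]. *)
Definition soft_capped_log k p eta rho x : R :=
  softlog k (sqdist p x / rho ^+ 2) - softlog k (sqdist p x / eta ^+ 2) +
  ln (rho / eta).

Definition dsoft_capped_log k i p eta rho x : R :=
  2 * coord i (x - p) *
  (dsoftlog k (sqdist p x / rho ^+ 2) / rho ^+ 2 -
   dsoftlog k (sqdist p x / eta ^+ 2) / eta ^+ 2).

Lemma smooth_sqdist p : smooth (sqdist p).
Proof.
apply: smoothD; apply: smoothX; apply: smoothD;
  (exact: smooth_fst || exact: smooth_snd || exact: smooth_cst).
Qed.

Lemma smooth_softlog k f : smooth f -> smooth (fun x : plane R => softlog k (f x)).
Proof.
move=> sf; rewrite /softlog; apply: smoothM; last exact: smooth_cst.
apply: smooth_ln.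
  move=> x; rewrite ltr_wpDr// mulr_ge0 ?invr_ge0//.
  by rewrite -mul2n exprM exprn_ge0// sqr_ge0.
apply: smoothD; first exact: smooth_cst.
by apply: smoothM; [exact: smoothX|exact: smooth_cst].
Qed.

Lemma smooth_soft_capped_log k p eta rho : smooth (soft_capped_log k p eta rho).
Proof.
have sd c : smooth (fun x => softlog k (sqdist p x / c)).
  apply: smooth_softlog; apply: smoothM; last exact: smooth_cst.
  exact: smooth_sqdist.
apply: smoothD; last exact: smooth_cst.
apply: smoothD; first exact: sd.
rewrite (_ : (fun x => _) =
    (fun x => (-1) * softlog k (sqdist p x / eta ^+ 2))); last first.
  by apply/funext => x; rewrite mulN1r.
by apply: smoothM; [exact: smooth_cst|exact: sd].
Qed.

Lemma is_derive_sqdist i p x :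
  is_derive x (dir i) (sqdist p) (2 * coord i (x - p)).
Proof.
have d1 : is_derive x (dir i) (fun y : plane R => y.1 - p.1) ((dir i).1 : R).
  have := is_deriveD (is_derive_fst x (dir i)) (is_derive_cst (- p.1) x (dir i)).
  by move=> /is_derive_eq; apply; rewrite addr0.
have d2 : is_derive x (dir i) (fun y : plane R => y.2 - p.2) ((dir i).2 : R).
  have := is_deriveD (is_derive_snd x (dir i)) (is_derive_cst (- p.2) x (dir i)).
  by move=> /is_derive_eq; apply; rewrite addr0.
have := is_deriveD (is_deriveM d1 d1) (is_deriveM d2 d2).
rewrite (_ : _ + _ = sqdist p); last by apply/funext => y; rewrite /sqdist !expr2.
move=> /is_derive_eq; apply; rewrite /GRing.scale/= /coord.
by case: i {d1 d2} => /=; ring.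
Qed.

Lemma is_derive_soft_capped_log k i p eta rho x :
  is_derive x (dir i) (soft_capped_log k p eta rho)
    (dsoft_capped_log k i p eta rho x).
Proof.
have d1 (c : R) : is_derive x (dir i) (fun y => softlog k (sqdist p y / c))
    (dsoftlog k (sqdist p x / c) * (2 * coord i (x - p) / c)).
  apply: (@is_derive_chain _ (fun y => sqdist p y / c)); last first.
    exact: is_derive_softlog.
  have := is_deriveZ c^-1 (is_derive_sqdist i p x).
  rewrite (_ : _ \*: _ = (fun y => sqdist p y / c)); last first.
    by apply/funext => y; rewrite mulrC.
  by move=> /is_derive_eq; apply; rewrite /GRing.scale/= mulrC.
have := is_deriveD (is_deriveB (d1 (rho ^+ 2)) (d1 (eta ^+ 2)))
  (is_derive_cst (ln (rho / eta)) x (dir i)).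
by move=> /is_derive_eq; apply; rewrite /dsoft_capped_log; ring.
Qed.

Lemma cvg_soft_capped_log p eta rho x : 0 < eta -> eta < rho ->
  soft_capped_log k p eta rho x @[k --> \oo] --> capped_log p eta rho x.
Proof.
move=> e0 er; have r0 := lt_trans e0 er.
have d0 := enorm_ge0 (x - p); set d := enorm _ in d0.
have c c' : 0 < c' -> softlog k (sqdist p x / c' ^+ 2) @[k --> \oo] -->
    (if c' < d then ln (d / c') else 0).
  move=> c0; rewrite sqdistE -/d -expr_div_n.
  have -> : (if c' < d then ln (d / c') else 0) =
            (if 1 < (d / c') ^+ 2 then ln ((d / c') ^+ 2) / 2 else 0).
    rewrite -[X in X < _ ^+ 2](expr1n _ 2) ltr_sqr ?nnegrE ?divr_ge0 ?(ltW c0)//.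
    rewrite ltr_pdivlMr// mul1r; case: ifP => // cd.
    rewrite lnXn; last by rewrite divr_gt0// (lt_trans c0).
    by rewrite mulr2n; field.
  by apply: cvg_softlog; rewrite sqr_ge0.
have -> : capped_log p eta rho x = (if rho < d then ln (d / rho) else 0) -
    (if eta < d then ln (d / eta) else 0) + ln (rho / eta).
  rewrite /capped_log -/d; case: (leP d eta) => de.
    by rewrite ltNge (le_trans de (ltW er))/= subrr add0r.
  have dp := lt_trans e0 de.
  case: (leP d rho) => dr; last by rewrite !ln_div ?posrE//; ring.
  by rewrite !ln_div ?posrE//; ring.
apply: cvgD; last exact: cvg_cst.
by apply: cvgB; exact: c.
Qed.

Lemma cvg_dsoft_capped_log i p eta rho x : 0 < eta -> eta < rho ->
  dsoft_capped_log k i p eta rho x @[k --> \oo] --> dcapped_log i p eta rho x.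
Proof.
move=> e0 er; have r0 := lt_trans e0 er.
have d0 := enorm_ge0 (x - p); set d := enorm _ in d0.
have c c' : 0 < c' -> dsoftlog k (sqdist p x / c' ^+ 2) / c' ^+ 2 @[k --> \oo] -->
    (if c' < d then (2 * d ^+ 2)^-1 else 0).
  move=> c0; rewrite sqdistE -/d -expr_div_n.
  have -> : (if c' < d then (2 * d ^+ 2)^-1 else 0) =
            (if 1 < (d / c') ^+ 2 then (2 * (d / c') ^+ 2)^-1 else 0) / c' ^+ 2.
    rewrite -[X in X < _ ^+ 2](expr1n _ 2) ltr_sqr ?nnegrE ?divr_ge0 ?(ltW c0)//.
    rewrite ltr_pdivlMr// mul1r; case: ifP => cd; last by rewrite mul0r.
    by field; rewrite !gt_eqF// (lt_trans c0).
  apply: cvgM; last exact: cvg_cst.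
  by apply: cvg_dsoftlog; rewrite sqr_ge0.
have -> : dcapped_log i p eta rho x = 2 * coord i (x - p) *
    ((if rho < d then (2 * d ^+ 2)^-1 else 0) -
     (if eta < d then (2 * d ^+ 2)^-1 else 0)).
  rewrite /dcapped_log -/d; case: (ltP eta d) => de /=; last first.
    by rewrite ltNge (le_trans de (ltW er))/= subrr mulr0.
  have dp := lt_trans e0 de.
  case: (leP d rho) => dr; last by rewrite subrr mulr0.
  by field; rewrite gt_eqF.
apply: cvgM; first exact: cvg_cst.
by apply: cvgB; exact: c.
Qed.

Lemma normr_coord_le i x : `|coord i x| <= enorm x.
Proof. by case: i; [exact: normr_snd_le|exact: normr_fst_le]. Qed.

Lemma soft_capped_log_bound k p eta rho x : 0 < eta -> eta < rho ->
  `|soft_capped_log k p eta rho x| <=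
  sqdist p x / rho ^+ 2 + sqdist p x / eta ^+ 2 + `|ln (rho / eta)|.
Proof.
move=> e0 er; have r0 := lt_trans e0 er.
rewrite (le_trans (ler_normD _ _))// lerD2r (le_trans (ler_normB _ _))//.
by rewrite lerD// ger0_norm ?softlog_ge0// softlog_le// divr_ge0 ?sqdist_ge0// sqr_ge0.
Qed.

Lemma dsoft_capped_log_bound k i p eta rho x : 0 < eta -> eta < rho ->
  `|dsoft_capped_log k i p eta rho x| <=
  2 * enorm (x - p) * ((rho ^+ 2)^-1 + (eta ^+ 2)^-1).
Proof.
move=> e0 er; have r0 := lt_trans e0 er.
rewrite normrM normrM (ger0_norm (ler0n _ 2)); apply: ler_pM => //.
- by rewrite ler_pM2l// normr_coord_le.
- have h c : 0 < c -> `|dsoftlog k (sqdist p x / c ^+ 2) / c ^+ 2| <= (c ^+ 2)^-1.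
    move=> c0; have sp : 0 <= sqdist p x / c ^+ 2.
      by rewrite divr_ge0 ?sqdist_ge0 ?sqr_ge0.
    rewrite normrM !ger0_norm ?invr_ge0 ?sqr_ge0 ?dsoftlog_ge0//.
    by rewrite ler_piMl ?invr_ge0 ?sqr_ge0// dsoftlog_le.
  by rewrite (le_trans (ler_normB _ _))// lerD// h.
Qed.

Lemma capped_log_ge0 p eta rho x : 0 < eta -> eta < rho ->
  0 <= capped_log p eta rho x.
Proof.
move=> e0 er; rewrite /capped_log; case: (leP (enorm (x - p)) eta) => d1.
  by rewrite ln_ge0// ler_pdivlMr// mul1r ltW.
case: (leP (enorm (x - p)) rho) => // d2.
by rewrite ln_ge0// ler_pdivlMr ?mul1r// (lt_trans e0).
Qed.

Lemma capped_log_out p eta rho x : eta < rho -> rho < enorm (x - p) ->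
  capped_log p eta rho x = 0.
Proof.
move=> er rx; rewrite /capped_log !ifF//; apply/negbTE; rewrite -ltNge//.
exact: lt_trans rx.
Qed.

Lemma capped_log_center p eta rho : 0 < eta ->
  capped_log p eta rho p = ln (rho / eta).
Proof. by move=> e0; rewrite /capped_log subrr enorm0 (ltW e0). Qed.

Lemma capped_log_le p eta rho x : 0 < eta -> eta < rho ->
  capped_log p eta rho x <= ln (rho / eta).
Proof.
move=> e0 er; have r0 := lt_trans e0 er.
have l0 : 0 <= ln (rho / eta) by rewrite ln_ge0// ler_pdivlMr// mul1r ltW.
rewrite /capped_log; case: (leP (enorm (x - p)) eta) => d1 //.
case: (leP (enorm (x - p)) rho) => // d2.
have dp := lt_trans e0 d1.
rewrite ler_ln ?posrE ?divr_gt0// ler_pM2l// lef_pV2 ?posrE//; exact: ltW.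
Qed.

Lemma dcapped_log_bound i p eta rho x : 0 < eta ->
  `|dcapped_log i p eta rho x| <= eta^-1.
Proof.
move=> e0; rewrite /dcapped_log; case: ifP => [/andP[ed dr]|_]; last first.
  by rewrite normr0 invr_ge0 ltW.
have d0 := lt_trans e0 ed.
rewrite normrN normrM (ger0_norm (_ : 0 <= (enorm (x - p) ^+ 2)^-1)); last first.
  by rewrite invr_ge0 sqr_ge0.
apply: (@le_trans _ _ (enorm (x - p))^-1); last by rewrite lef_pV2 ?posrE// ltW.
rewrite ler_pdivrMr ?exprn_gt0// expr2 mulKf ?gt_eqF//; exact: normr_coord_le.
Qed.

End CappedLog.

(** * The soft maximum *)

Section RealDominated.
Context d (T : measurableType d) (R : realType).
Variables (mu : {measure set T -> \bar R}) (D : set T).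

Lemma cvg_Rintegral_dominated (f_ : nat -> T -> R) (f g : T -> R) :
  measurable D -> (forall n, measurable_fun D (f_ n)) ->
  (forall x, D x -> f_ n x @[n --> \oo] --> f x) ->
  mu.-integrable D (EFin \o g) -> (forall n x, D x -> `|f_ n x| <= g x) ->
  \int[mu]_(x in D) f_ n x @[n --> \oo] --> \int[mu]_(x in D) f x.
Proof.
move=> mD mf_ f_f ig f_g.
have mf : measurable_fun D f by exact: measurable_fun_cvg f_f.
have mf_' n : measurable_fun D (EFin \o f_ n) by exact/measurable_EFinP.
have mf' : measurable_fun D (EFin \o f) by exact/measurable_EFinP.
have f_f' : {ae mu, forall x, D x -> (EFin \o f_ n) x @[n --> \oo] --> (EFin \o f) x}.
  by apply: aeW => x Dx; apply: cvg_EFin; [exact: nearW|exact: f_f].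
have f_g' : {ae mu, forall x n, D x -> (`|(EFin \o f_ n) x| <= (EFin \o g) x)%E}.
  by apply: aeW => x n Dx; rewrite /= lee_fin; exact: f_g.
have [If _ cvgf] := dominated_convergence mD mf_' mf' f_f' ig f_g'.
apply: fine_cvg; rewrite /Rintegral fineK; last exact: integrable_fin_num.
exact: cvgf.
Qed.

End RealDominated.

Section SoftMax.
Context {R : realType} {T : eqType}.
Implicit Types (S : seq T) (u : T -> R) (kappa : R).

Definition expsum kappa S u : R := \sum_(p <- S) expR (kappa * u p).

(** The maximum up to an error ln (size S) / kappa, but smooth, and with a gradient
   that is the average of the gradients for the probability [weight]. *)
Definition softmax kappa S u : R :=
  ln (expsum kappa S u / (size S)%:R) / kappa.

Definition weight kappa S u p : R := expR (kappa * u p) / expsum kappa S u.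

Lemma expsum_gt0 kappa S u : S != [::] -> 0 < expsum kappa S u.
Proof.
case: S => // p S _; rewrite /expsum big_cons ltr_pwDl ?expR_gt0//.
by apply: sumr_ge0 => q _; exact: expR_ge0.
Qed.

Lemma sum_weight kappa S u : S != [::] -> \sum_(p <- S) weight kappa S u p = 1.
Proof.
by move=> S0; rewrite -mulr_suml divff// gt_eqF// expsum_gt0.
Qed.

Lemma weight_ge0 kappa S u p : 0 <= weight kappa S u p.
Proof.
rewrite divr_ge0 ?expR_ge0// /expsum; apply: sumr_ge0 => q _; exact: expR_ge0.
Qed.

Lemma weight_le1 kappa S u p : p \in S -> weight kappa S u p <= 1.
Proof.
move=> pS; have S0 : S != [::] by case: S pS.
rewrite ler_pdivrMr ?expsum_gt0// mul1r /expsum.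
rewrite (big_rem p)//= lerDl; apply: sumr_ge0 => q _; exact: expR_ge0.
Qed.

(** The loss comes from averaging in the definition, thanks to which the soft maximum
   of the zero function vanishes. *)
Lemma softmax_ge kappa S u p : 0 < kappa -> p \in S ->
  u p - ln (size S)%:R / kappa <= softmax kappa S u.
Proof.
move=> k0 pS; have S0 : S != [::] by case: S pS.
have n0 : 0 < (size S)%:R :> R by rewrite ltr0n; case: S pS {S0}.
rewrite /softmax ler_pdivlMr// mulrBl divfK ?gt_eqF//.
rewrite ln_div ?posrE ?expsum_gt0// lerD2r mulrC -[leLHS]expRK.
rewrite ler_ln ?posrE ?expR_gt0 ?expsum_gt0//.
rewrite /expsum (big_rem p)//= lerDl; apply: sumr_ge0 => q _; exact: expR_ge0.
Qed.

Lemma sum_size_const S (b : R) : \sum_(p <- S) b = b * (size S)%:R.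
Proof.
by elim: S => [|p S IH]; rewrite ?big_nil ?mulr0// big_cons IH /= -natr1; ring.
Qed.

Lemma softmax_ge_lb kappa S u (b : R) : 0 < kappa -> S != [::] ->
  (forall p, p \in S -> b <= u p) -> b <= softmax kappa S u.
Proof.
move=> k0 S0 bu; have n0 : 0 < (size S)%:R :> R by rewrite ltr0n; case: S S0 {bu}.
rewrite /softmax ler_pdivlMr// -[leLHS]expRK.
rewrite ler_ln ?posrE ?expR_gt0 ?divr_gt0 ?expsum_gt0// ler_pdivlMr//.
rewrite -sum_size_const /expsum big_seq [leRHS]big_seq; apply: ler_sum => p pS.
by rewrite ler_expR mulrC ler_pM2l// bu.
Qed.

Lemma softmax_le_ub kappa S u (b : R) : 0 < kappa -> S != [::] ->
  (forall p, p \in S -> u p <= b) -> softmax kappa S u <= b.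
Proof.
move=> k0 S0 bu; have n0 : 0 < (size S)%:R :> R by rewrite ltr0n; case: S S0 {bu}.
rewrite /softmax ler_pdivrMr// -[leRHS]expRK.
rewrite ler_ln ?posrE ?expR_gt0 ?divr_gt0 ?expsum_gt0// ler_pdivrMr//.
rewrite -sum_size_const /expsum big_seq [leRHS]big_seq; apply: ler_sum => p pS.
by rewrite ler_expR mulrC ler_pM2r// bu.
Qed.

Lemma softmax_eq0 kappa S u : 0 < kappa -> S != [::] ->
  (forall p, p \in S -> u p = 0) -> softmax kappa S u = 0.
Proof.
move=> k0 S0 u0; apply/eqP; rewrite eq_le; apply/andP; split.
  by apply: softmax_le_ub => // p /u0 ->.
by apply: softmax_ge_lb => // p /u0 ->.
Qed.

Lemma ler_sum_mem S u p : (forall q, q \in S -> 0 <= u q) -> p \in S ->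
  u p <= \sum_(q <- S) u q.
Proof.
move=> u0 pS; rewrite (big_rem p)//= lerDl big_seq; apply: sumr_ge0 => q qS.
by apply: u0; exact: mem_rem qS.
Qed.

Lemma softmax_le_sum kappa S u : 0 < kappa -> S != [::] ->
  (forall p, p \in S -> 0 <= u p) -> softmax kappa S u <= \sum_(p <- S) u p.
Proof.
by move=> k0 S0 u0; apply: softmax_le_ub => // p pS; exact: ler_sum_mem.
Qed.

Lemma normr_softmax_le kappa S u : 0 < kappa -> S != [::] ->
  `|softmax kappa S u| <= \sum_(p <- S) `|u p|.
Proof.
move=> k0 S0; rewrite ler_norml; apply/andP; split.
  apply: softmax_ge_lb => // p pS; rewrite lerNl.
  rewrite (le_trans (ler_norm _))// normrN.
  by apply: (@ler_sum_mem _ (fun q => `|u q|)).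
apply: softmax_le_ub => // p pS; rewrite (le_trans (ler_norm _))//.
by apply: (@ler_sum_mem _ (fun q => `|u q|)).
Qed.

Lemma eq_weight kappa S u v p : {in S, u =1 v} -> p \in S ->
  weight kappa S u p = weight kappa S v p.
Proof.
move=> uv pS; rewrite /weight uv//; congr (_ / _); rewrite /expsum big_seq.
by under eq_bigr => q qS do rewrite (uv _ qS); rewrite -big_seq.
Qed.

Lemma cvg_bigsum (F : nat -> T -> R) (l : T -> R) S :
  (forall p, p \in S -> F k p @[k --> \oo] --> l p) ->
  \sum_(p <- S) F k p @[k --> \oo] --> \sum_(p <- S) l p.
Proof.
elim: S => [|p S IH] h.
  rewrite big_nil (_ : (fun k => _) = (fun=> 0)); first exact: cvg_cst.
  by apply/funext => k; rewrite big_nil.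
rewrite big_cons (_ : (fun k => _) = (fun k => F k p + \sum_(q <- S) F k q)).
  apply: cvgD; first by apply: h; rewrite mem_head.
  by apply: IH => q qS; apply: h; rewrite inE qS orbT.
by apply/funext => k; rewrite big_cons.
Qed.

Lemma cvg_expsum kappa S (u_ : nat -> T -> R) u :
  (forall p, p \in S -> u_ k p @[k --> \oo] --> u p) ->
  expsum kappa S (u_ k) @[k --> \oo] --> expsum kappa S u.
Proof.
move=> h; apply: cvg_bigsum => p pS.
apply: (@cvg_comp _ _ _ (fun k => kappa * u_ k p) (@expR R) \oo (nbhs (kappa * u p))).
  by apply: cvgM; [exact: cvg_cst|exact: h].
exact: continuous_expR.
Qed.

Lemma cvg_softmax kappa S (u_ : nat -> T -> R) u : S != [::] ->
  (forall p, p \in S -> u_ k p @[k --> \oo] --> u p) ->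
  softmax kappa S (u_ k) @[k --> \oo] --> softmax kappa S u.
Proof.
move=> S0 h; have n0 : 0 < (size S)%:R :> R by rewrite ltr0n; case: S S0 {h}.
apply: cvgM; last exact: cvg_cst.
apply: (@cvg_comp _ _ _ (fun k => expsum kappa S (u_ k) / (size S)%:R) (@ln R)
  \oo (nbhs (expsum kappa S u / (size S)%:R))).
  by apply: cvgM; [exact: cvg_expsum|exact: cvg_cst].
by apply: continuous_ln; rewrite divr_gt0// expsum_gt0.
Qed.

Lemma cvg_weight kappa S (u_ : nat -> T -> R) u p : p \in S ->
  (forall p, p \in S -> u_ k p @[k --> \oo] --> u p) ->
  weight kappa S (u_ k) p @[k --> \oo] --> weight kappa S u p.
Proof.
move=> pS h; have S0 : S != [::] by case: S pS {h}.
apply: cvgM.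
  apply: (@cvg_comp _ _ _ (fun k => kappa * u_ k p) (@expR R) \oo (nbhs (kappa * u p))).
    by apply: cvgM; [exact: cvg_cst|exact: h].
  exact: continuous_expR.
apply: cvgV; first by rewrite gt_eqF// expsum_gt0.
exact: cvg_expsum.
Qed.

End SoftMax.

Section SoftMaxFields.
Context {R : realType}.
Implicit Types (S : seq (plane R)) (F : plane R -> plane R -> R).

Lemma is_derive_bigsum S F (dF : plane R -> R) (x v : plane R) :
  (forall p, is_derive x v (F p) (dF p)) ->
  is_derive x v (fun y => \sum_(p <- S) F p y) (\sum_(p <- S) dF p).
Proof.
move=> h; elim: S => [|p S IH].
  rewrite big_nil (_ : (fun y => _) = cst 0); first exact: is_derive_cst.
  by apply/funext => y; rewrite big_nil.
rewrite big_cons (_ : (fun y => _) = F p \+ (fun y => \sum_(q <- S) F q y)).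
  exact: is_deriveD.
by apply/funext => y; rewrite big_cons.
Qed.

Lemma is_derive_softmax kappa S F dF (x v : plane R) : 0 < kappa -> S != [::] ->
  (forall p, is_derive x v (F p) (dF p)) ->
  is_derive x v (fun y => softmax kappa S (fun p => F p y))
    (\sum_(p <- S) weight kappa S (fun p => F p x) p * dF p).
Proof.
move=> k0 S0 h; have n0 : 0 < (size S)%:R :> R by rewrite ltr0n; case: S S0.
have E0 := expsum_gt0 kappa (fun p => F p x) S0.
have d1 p : is_derive x v (fun y => expR (kappa * F p y))
    (expR (kappa * F p x) * (kappa * dF p)).
  have dz : is_derive x v (fun y => kappa * F p y) (kappa * dF p).
    exact: (is_deriveZ kappa (h p)).
  by apply: (@is_derive_chain _ (fun y => kappa * F p y) (@expR R)).
have d2 : is_derive x v (fun y => expsum kappa S (fun p => F p y))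
    (\sum_(p <- S) expR (kappa * F p x) * (kappa * dF p)).
  exact: is_derive_bigsum.
have d3 := is_deriveZ (size S)%:R^-1 d2.
have a0 : 0 < (size S)%:R^-1 * expsum kappa S (fun p => F p x).
  by rewrite mulr_gt0// invr_gt0.
have d4 := @is_derive_chain _ _ (@ln R) x v _ _ d3 (is_derive1_ln a0).
have := is_deriveZ kappa^-1 d4.
rewrite (_ : _ \*: _ = (fun y => softmax kappa S (fun p => F p y))); last first.
  by apply/funext => y; rewrite /= [LHS]mulrC; congr (ln _ / _); exact: mulrC.
move=> /is_derive_eq; apply; rewrite /GRing.scale/=.
rewrite invfM invrK.
rewrite (_ : kappa^-1 * _ = (kappa * expsum kappa S (fun p => F p x))^-1 *
  \sum_(p <- S) expR (kappa * F p x) * (kappa * dF p)); last first.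
  by field; rewrite !gt_eqF.
rewrite mulr_sumr; apply: eq_bigr => p _; rewrite /weight; field.
by rewrite !gt_eqF.
Qed.

Lemma smooth_softmax kappa S F : 0 < kappa -> S != [::] ->
  (forall p, smooth (F p)) ->
  smooth (fun y => softmax kappa S (fun p => F p y)).
Proof.
move=> k0 S0 sF; have n0 : 0 < (size S)%:R :> R by rewrite ltr0n; case: S S0.
apply: smoothM; last exact: smooth_cst.
apply: smooth_ln; first by move=> x; rewrite divr_gt0// expsum_gt0.
apply: smoothM; last exact: smooth_cst.
apply: smooth_sum => p; apply: smooth_expR; apply: smoothM; last exact: sF.
exact: smooth_cst.
Qed.

End SoftMaxFields.

(** * The curl equation tested on vortex potentials *)

Section CurlPairing.
Context {R : realType} (U : set (plane R)) (chi : plane R -> R)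
  (Lambda : {fset plane R}) (m : {measure set (plane R) -> \bar R})
  (j : plane R -> plane R).
Let Uh := enlarge U.
Let K := supp chi.
Context (smooth_chi : smooth chi) (chi_ge0 : forall x, 0 <= chi x)
  (supp_chi : compactly_supported_in U chi) (radon_m : radon_on Uh m)
  (int_j : loc_integrable Uh j)
  (curl_j : distr_eq Uh (curl Uh j)
      (fun phi => 2 * pi * distr_of_points Lambda phi
                  - distr_of_measure Uh m phi)).

(** What remains of the equation for the curl under bounded pointwise limits of test
   functions tau and of their gradients V: the limits are differentiable only
   almost everywhere, so V is kept as separate data. *)
Definition curl_pairing (tau : plane R -> R) (V : bool -> plane R -> R) : Prop :=
  [/\ measurable_fun setT tau, forall i, measurable_fun setT (V i) &
   - (\int[leb2 R]_(x in Uh) ((j x).2 * V false x))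
   - - (\int[leb2 R]_(x in Uh) ((j x).1 * V true x)) =
   2 * pi * \sum_(p <- Lambda) tau p - \int[m]_(x in Uh) tau x].

Let mUh : measurable Uh := measurable_enlarge U.
Let cK : compact K := supp_chi.1.
Let KUh : K `<=` Uh.
Proof. by apply: subset_trans supp_chi.2 _; exact: sub_enlarge. Qed.
Let mK : measurable K.
Proof. by apply: closed_measurable_plane; exact: closed_closure. Qed.

Lemma curl_pairing_test phi : test_function Uh phi ->
  curl_pairing phi (fun i => partial i phi).
Proof.
move=> tphi; have [sphi _] := tphi; split.
- by apply: continuous_measurable_plane; exact: smooth_continuous.
- by move=> i; apply: continuous_measurable_plane; exact: smooth_continuous_partial.
- exact: curl_j.
Qed.

Let measurable_enormj : measurable_fun Uh (fun x => enorm (j x)).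
Proof.
by apply: (measurableT_comp (@measurable_enorm R)); exact: int_j.1.
Qed.

Let integrable_bound (C : R) : 0 <= C ->
  (leb2 R).-integrable Uh (EFin \o ((fun x => C * enorm (j x)) \_ K)).
Proof.
move=> C0.
have : (leb2 R).-integrable K (EFin \o (fun x => C * enorm (j x))).
  rewrite (_ : EFin \o _ = (fun x => C%:E * (enorm (j x))%:E)%E)//.
  apply: integrableZl => //; apply/integrableP; split.
    by apply/measurable_EFinP; exact: measurable_funS measurable_enormj.
  apply: le_lt_trans (int_j.2 K cK KUh).
  apply: ge0_le_integral => //.
  - by apply: measurableT_comp => //; apply/measurable_EFinP;
      exact: measurable_funS measurable_enormj.
  - by apply/measurable_EFinP; exact: measurable_funS measurable_enormj.
  - by move=> x _; rewrite /= ger0_norm ?enorm_ge0.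
move=> /(integrable_mkcond _ mK); rewrite restrict_EFin.
by apply: integrableS.
Qed.

Let integrable_cst_m (C : R) : m.-integrable Uh (EFin \o ((fun=> C) \_ K)).
Proof.
have : m.-integrable K (EFin \o (fun=> C)).
  apply/integrableP; split; first by apply/measurable_EFinP.
  rewrite (_ : (fun x => _) = cst `|C|%:E)//.
  rewrite integral_cst// lte_mul_pinfty// ?lee_fin//.
  exact: radon_m.
move=> /(integrable_mkcond _ mK); rewrite restrict_EFin.
by apply: integrableS.
Qed.

(** By dominated convergence: everything vanishes off the support of chi, a compact
   set on which j is integrable and m finite. *)
Lemma curl_pairing_lim (tau_ : nat -> plane R -> R)
    (V_ : nat -> bool -> plane R -> R) tau V (C : R) :
  (forall k, curl_pairing (tau_ k) (V_ k)) ->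
  (forall k x, `|tau_ k x| <= C) -> (forall k i x, `|V_ k i x| <= C) ->
  (forall k x, ~ K x -> tau_ k x = 0) ->
  (forall k i x, ~ K x -> V_ k i x = 0) ->
  (forall x, tau_ k x @[k --> \oo] --> tau x) ->
  (forall i x, V_ k i x @[k --> \oo] --> V i x) ->
  curl_pairing tau V.
Proof.
move=> cp tC VC t0 V0 tcvg Vcvg.
have C0 : 0 <= C by apply: le_trans (tC 0%N 0).
have mV i k : measurable_fun setT (V_ k i) by have [_ h _] := cp k; exact: h.
have mt k : measurable_fun setT (tau_ k) by have [h _ _] := cp k.
have mj1 : measurable_fun Uh (fun x => (j x).1 : R).
  by apply: (measurableT_comp (@measurable_fst _ _ _ _)); exact: int_j.1.
have mj2 : measurable_fun Uh (fun x => (j x).2 : R).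
  by apply: (measurableT_comp (@measurable_snd _ _ _ _)); exact: int_j.1.
split.
- by apply: measurable_fun_cvg => // x _; exact: tcvg.
- by move=> i; apply: (@measurable_fun_cvg _ _ _ _ (fun k => V_ k i)) => // x _; exact: Vcvg.
have cvgj (f : plane R -> R) i : measurable_fun Uh f ->
    (forall x, `|f x| <= enorm (j x)) ->
    \int[leb2 R]_(x in Uh) (f x * V_ k i x) @[k --> \oo] -->
    \int[leb2 R]_(x in Uh) (f x * V i x).
  move=> mf fj; apply: (cvg_Rintegral_dominated (mu := leb2 R)
    (g := (fun x => C * enorm (j x)) \_ K)) => //.
  - by move=> n; apply: measurable_funM => //; exact: measurable_funTS.
  - by move=> x _; apply: cvgM; [exact: cvg_cst|exact: Vcvg].
  - exact: integrable_bound.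
  - move=> n x _; rewrite patchE; case: ifPn => [_|].
      by rewrite normrM mulrC ler_pM.
    by move=> /negP; rewrite inE => nK; rewrite V0// mulr0 normr0.
have cvgm : \int[m]_(x in Uh) tau_ k x @[k --> \oo] --> \int[m]_(x in Uh) tau x.
  apply: (cvg_Rintegral_dominated (g := (fun=> C) \_ K)) => //.
  - by move=> n; exact: measurable_funTS.
  - move=> n x _; rewrite patchE; case: ifPn => [_|] //.
    by move=> /negP; rewrite inE => nK; rewrite t0// normr0.
have cvgl : - (\int[leb2 R]_(x in Uh) ((j x).2 * V_ k false x))
   - - (\int[leb2 R]_(x in Uh) ((j x).1 * V_ k true x)) @[k --> \oo] -->
   - (\int[leb2 R]_(x in Uh) ((j x).2 * V false x))
   - - (\int[leb2 R]_(x in Uh) ((j x).1 * V true x)).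
  apply: cvgB; apply: cvgN; apply: cvgj => // x.
    exact: normr_snd_le.
  exact: normr_fst_le.
have cvgr : 2 * pi * \sum_(p <- Lambda) tau_ k p - \int[m]_(x in Uh) tau_ k x
    @[k --> \oo] --> 2 * pi * \sum_(p <- Lambda) tau p - \int[m]_(x in Uh) tau x.
  apply: cvgB => //; apply: cvgM; first exact: cvg_cst.
  by apply: (@cvg_bigsum _ _ tau_) => p _; exact: tcvg.
have E : (fun k => - (\int[leb2 R]_(x in Uh) ((j x).2 * V_ k false x))
   - - (\int[leb2 R]_(x in Uh) ((j x).1 * V_ k true x))) =
  (fun k => 2 * pi * \sum_(p <- Lambda) tau_ k p - \int[m]_(x in Uh) tau_ k x).
  by apply/funext => k; have [_ _ ->] := cp k.
rewrite E in cvgl; exact: (cvg_unique (@Rhausdorff R) cvgl cvgr).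
Qed.

(* Multiplying by chi / (chi + eps) gives potentials a compact support without
   any bump function, and tends to 1 where chi is positive. *)
Let cutoff (eps : R) x : R := chi x / (chi x + eps).
Let dcutoff (eps : R) i x : R := eps * partial i chi x / (chi x + eps) ^+ 2.

Let chi_eps_gt0 eps x : 0 < eps -> 0 < chi x + eps.
Proof. by move=> e0; rewrite ltr_wpDl. Qed.

Let cutoff01 eps x : 0 < eps -> 0 <= cutoff eps x <= 1.
Proof.
move=> e0; have h := chi_eps_gt0 x e0; rewrite divr_ge0 ?(ltW h)//=.
by rewrite ler_pdivrMr// mul1r lerDl ltW.
Qed.

Let smooth_cutoff eps : 0 < eps -> smooth (cutoff eps).
Proof.
move=> e0; apply: smoothM => //; apply: smoothV.
  by move=> x; rewrite gt_eqF// chi_eps_gt0.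
by apply: smoothD => //; exact: smooth_cst.
Qed.

Let is_derive_cutoff eps i x : 0 < eps ->
  is_derive x (dir i) (cutoff eps) (dcutoff eps i x).
Proof.
move=> e0; have h := chi_eps_gt0 x e0.
have d1 := smooth_is_derive smooth_chi i x.
have d2 : is_derive x (dir i) (fun y => chi y + eps) (partial i chi x).
  have := is_deriveD d1 (is_derive_cst eps x (dir i)).
  by move=> /is_derive_eq; apply; rewrite addr0.
have c0 : (fun y => chi y + eps) x != 0 by rewrite gt_eqF.
have dv := @is_deriveV _ id (chi x + eps) _ 1 c0 (is_derive_id _ _).
have d3 := @is_derive_chain _ (fun y => chi y + eps) (fun t => t^-1) x (dir i) _ _ d2 dv.
have := is_deriveM d1 d3.
move=> /is_derive_eq; apply; rewrite /GRing.scale/= /dcutoff; field.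
by rewrite gt_eqF.
Qed.

Let dchi_bound : exists2 L : R, 0 <= L & forall i x, `|partial i chi x| <= L.
Proof.
have b i : exists2 c : R, 0 <= c & forall x, `|partial i chi x| <= c.
  apply: (@compact_supp_bounded _ _ K) => //.
    exact: smooth_continuous_partial.
  by move=> x; exact: not_supp_partial.
have [c1 c10 h1] := b false; have [c2 c20 h2] := b true.
exists (c1 + c2); first exact: addr_ge0.
move=> [] x; [apply: le_trans (h2 x) _; rewrite lerDr//|].
by apply: le_trans (h1 x) _; rewrite lerDl.
Qed.

Context (S : seq (plane R)) (c rho : plane R -> R) (eta kappa c0 : R).
Context (S0 : S != [::]) (kappa_gt0 : 0 < kappa) (eta_gt0 : 0 < eta)
  (c_ge0 : forall p, 0 <= c p) (rho_gt : forall p, eta < rho p) (c0_gt0 : 0 < c0)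
  (chi_ball : forall p x, p \in S -> enorm (x - p) <= rho p -> c0 <= chi x).

Definition vortex_pot x : R :=
  softmax kappa S (fun p => c p * capped_log p eta (rho p) x).

Definition vortex_grad i x : R :=
  \sum_(p <- S) weight kappa S (fun p => c p * capped_log p eta (rho p) x) p *
    (c p * dcapped_log i p eta (rho p) x).

Let soft_pot k x : R :=
  softmax kappa S (fun p => c p * soft_capped_log k p eta (rho p) x).

Let soft_grad k i x : R :=
  \sum_(p <- S) weight kappa S (fun p => c p * soft_capped_log k p eta (rho p) x) p *
    (c p * dsoft_capped_log k i p eta (rho p) x).

Let smooth_soft_pot k : smooth (soft_pot k).
Proof.
apply: (smooth_softmax kappa_gt0 S0) => p; apply: smoothM; first exact: smooth_cst.
exact: smooth_soft_capped_log.
Qed.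

Let is_derive_soft_pot k i x :
  is_derive x (dir i) (soft_pot k) (soft_grad k i x).
Proof.
apply: (@is_derive_softmax _ kappa S
  (fun p x => c p * soft_capped_log k p eta (rho p) x)) => // p.
exact: (is_deriveZ (c p) (is_derive_soft_capped_log k i p eta (rho p) x)).
Qed.

Let soft_pairing k eps : 0 < eps ->
  curl_pairing (fun x => soft_pot k x * cutoff eps x)
    (fun i x => soft_pot k x * dcutoff eps i x + cutoff eps x * soft_grad k i x).
Proof.
move=> e0.
have sf : smooth (fun x => soft_pot k x * cutoff eps x).
  by apply: smoothM; [exact: smooth_soft_pot|exact: smooth_cutoff].
have -> : (fun i x => soft_pot k x * dcutoff eps i x + cutoff eps x * soft_grad k i x)
  = (fun i => partial i (fun x => soft_pot k x * cutoff eps x)).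
  apply/funext => i; apply/funext => x; rewrite /partial.
  have d1 := is_derive_soft_pot k i x.
  have d2 := is_derive_cutoff i x e0.
  by have [_ ->] := is_deriveM d1 d2.
apply: curl_pairing_test; split => //.
have sub : supp (fun x => soft_pot k x * cutoff eps x) `<=` K.
  apply: closure_subset => x /=; apply: contra_neq => chi0.
  by rewrite /cutoff chi0 mul0r mulr0.
split; last exact: subset_trans sub KUh.
by apply: subclosed_compact cK sub; exact: closed_closure.
Qed.

Let continuous_bound (f : plane R -> R) : continuous f ->
  exists2 B : R, 0 <= B & forall x, K x -> f x <= B.
Proof.
move=> cf; have : compact (f @` K).
  by apply: continuous_compact => //; exact: continuous_subspaceT.
move=> /compact_bounded/pinfty_ex_gt0[B B0 fB].
exists B; first exact: ltW.
by move=> x Kx; apply: le_trans (ler_norm _) _; apply: fB; exists x.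
Qed.

Let continuous_bigsum (F : plane R -> plane R -> R) :
  (forall p, continuous (F p)) -> continuous (fun x => \sum_(p <- S) F p x).
Proof.
move=> cF; elim: S => [|p s IH] x.
  rewrite (_ : (fun x => _) = (fun=> 0)); first exact: cvg_cst.
  by apply/funext => y; rewrite big_nil.
rewrite (_ : (fun x => _) = (fun x => F p x + \sum_(q <- s) F q x)).
  by apply: cvgD; [exact: cF|exact: IH].
by apply/funext => y; rewrite big_cons.
Qed.

Let soft_pot_bound : exists2 B : R, 0 <= B &
  forall k x, K x -> `|soft_pot k x| <= B.
Proof.
pose f x := \sum_(p <- S) (c p * (sqdist p x / rho p ^+ 2 + sqdist p x / eta ^+ 2 +
  `|ln (rho p / eta)|)).
have [|B B0 fB] := @continuous_bound f.
  apply: continuous_bigsum => p; apply: smooth_continuous.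
  apply: smoothM; first exact: smooth_cst.
  apply: smoothD; last exact: smooth_cst.
  by apply: smoothD; apply: smoothM;
    (exact: smooth_sqdist || exact: smooth_cst).
exists B => // k x Kx; apply: le_trans (fB x Kx).
apply: le_trans (normr_softmax_le _ kappa_gt0 S0) _.
apply: ler_sum => p _; rewrite normrM (ger0_norm (c_ge0 p)) ler_wpM2l//.
exact: soft_capped_log_bound.
Qed.

Let soft_grad_bound : exists2 B : R, 0 <= B &
  forall k i x, K x -> `|soft_grad k i x| <= B.
Proof.
pose f x := \sum_(p <- S) (c p * (2 * enorm (x - p) *
   ((rho p ^+ 2)^-1 + (eta ^+ 2)^-1))).
have [|B B0 fB] := @continuous_bound f.
  apply: continuous_bigsum => p x; apply: cvgM; first exact: cvg_cst.
  apply: cvgM; last exact: cvg_cst.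
  by apply: cvgM; [exact: cvg_cst|exact: continuous_enorm_sub].
exists B => // k i x Kx; apply: le_trans (fB x Kx).
apply: le_trans (ler_norm_sum _ _ _) _.
rewrite big_seq [leRHS]big_seq; apply: ler_sum => p pS.
rewrite normrM (ger0_norm (weight_ge0 _ _ _ _)) -[leRHS]mul1r.
apply: ler_pM => //; [exact: weight_ge0|exact: weight_le1|].
rewrite normrM (ger0_norm (c_ge0 p)) ler_wpM2l//.
exact: dsoft_capped_log_bound.
Qed.

Let cutoff_out eps x : ~ K x -> cutoff eps x = 0.
Proof. by move=> nK; rewrite /cutoff (not_supp0 nK) mul0r. Qed.

Let dcutoff_out eps i x : ~ K x -> dcutoff eps i x = 0.
Proof. by move=> nK; rewrite /dcutoff (not_supp_partial i nK) mulr0 mul0r. Qed.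

(* The limit of the soft potentials, with the cutoff fixed. *)
Let cut_pairing eps : 0 < eps ->
  curl_pairing (fun x => vortex_pot x * cutoff eps x)
    (fun i x => vortex_pot x * dcutoff eps i x + cutoff eps x * vortex_grad i x).
Proof.
move=> e0.
have [B1 B10 h1] := soft_pot_bound; have [B2 B20 h2] := soft_grad_bound.
have [L L0 hL] := dchi_bound.
have dcb i x : `|dcutoff eps i x| <= L / eps.
  have h := chi_eps_gt0 x e0.
  rewrite /dcutoff normrM normrM (gtr0_norm e0).
  rewrite (ger0_norm (_ : 0 <= ((chi x + eps) ^+ 2)^-1)) ?invr_ge0 ?sqr_ge0//.
  rewrite ler_pdivrMr ?exprn_gt0// mulrAC ler_pdivlMr//.
  have := hL i x; have := chi_ge0 x; have := normr_ge0 (partial i chi x).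
  set a := `| _ |; set b := chi x => a0 b0 aL.
  rewrite (_ : eps * a * eps = a * eps ^+ 2); last by ring.
  by apply: ler_pM => //; [exact: sqr_ge0|rewrite ler_sqr ?nnegrE ?addr_ge0 ?(ltW e0)// lerDr].
apply: (@curl_pairing_lim _ _ _ _ (B1 + (B1 * (L / eps) + B2)) (fun k => soft_pairing k e0)).
- move=> k x; have [Kx|nK] := pselect (K x); last first.
    by rewrite cutoff_out// mulr0 normr0 !addr_ge0// mulr_ge0// divr_ge0// ltW.
  have /andP[z0 z1] := cutoff01 x e0.
  rewrite normrM (ger0_norm z0) -[leLHS]addr0; apply: lerD.
    by rewrite -[leRHS]mulr1; apply: ler_pM => //; exact: h1.
  by rewrite addr_ge0// mulr_ge0// divr_ge0// ltW.
- move=> k i x; have [Kx|nK] := pselect (K x); last first.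
    rewrite cutoff_out// dcutoff_out// mulr0 mul0r addr0 normr0.
    by rewrite !addr_ge0// mulr_ge0// divr_ge0// ltW.
  have /andP[z0 z1] := cutoff01 x e0.
  apply: le_trans (ler_normD _ _) _; rewrite -[leLHS]add0r; apply: lerD => //.
  apply: lerD; first by rewrite normrM; apply: ler_pM => //; exact: h1.
  rewrite normrM (ger0_norm z0) -[leRHS]mul1r; apply: ler_pM => //; exact: h2.
- by move=> k x nK; rewrite cutoff_out// mulr0.
- by move=> k i x nK; rewrite cutoff_out// dcutoff_out// mulr0 mul0r addr0.
- move=> x; apply: cvgM; last exact: cvg_cst.
  apply: cvg_softmax => // p _; apply: cvgM; first exact: cvg_cst.
  exact: cvg_soft_capped_log.
- move=> i x; have cu p : p \in S ->
      c p * soft_capped_log k p eta (rho p) x @[k --> \oo] -->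
      c p * capped_log p eta (rho p) x.
    by move=> _; apply: cvgM; [exact: cvg_cst|exact: cvg_soft_capped_log].
  apply: cvgD; apply: cvgM; try exact: cvg_cst.
    exact: cvg_softmax.
  apply: (@cvg_bigsum _ _ (fun k p => weight kappa S
      (fun p => c p * soft_capped_log k p eta (rho p) x) p *
    (c p * dsoft_capped_log k i p eta (rho p) x))) => p pS.
  apply: cvgM; first exact: cvg_weight.
  by apply: cvgM; [exact: cvg_cst|exact: cvg_dsoft_capped_log].
Qed.

Lemma vortex_pot_ge0 x : 0 <= vortex_pot x.
Proof.
apply: softmax_ge_lb => // p _; rewrite mulr_ge0//.
exact: capped_log_ge0.
Qed.

Lemma vortex_pot_le x :
  vortex_pot x <= \sum_(p <- S) c p * capped_log p eta (rho p) x.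
Proof.
apply: softmax_le_sum => // p _; rewrite mulr_ge0//.
exact: capped_log_ge0.
Qed.

(* Outside the discs the vortex potential vanishes, so chi is bounded below on
   its support. *)
Lemma vortex_pot_out x : chi x < c0 -> vortex_pot x = 0.
Proof.
move=> xc; apply: softmax_eq0 => // p pS; rewrite capped_log_out ?mulr0//.
by rewrite ltNge; apply/negP => /(chi_ball pS); rewrite leNgt xc.
Qed.

Lemma vortex_grad_out i x : chi x < c0 -> vortex_grad i x = 0.
Proof.
move=> xc; rewrite /vortex_grad big_seq big1// => p pS.
rewrite /dcapped_log ifF ?mulr0//; apply/negbTE.
rewrite negb_and -!leNgt -ltNge orbC ltNge; apply/orP; left.
by apply/negP => /(chi_ball pS); rewrite leNgt xc.
Qed.

Lemma vortex_grad_bound : exists2 B : R, 0 <= B &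
  forall i x, `|vortex_grad i x| <= B.
Proof.
exists (\sum_(p <- S) c p / eta).
  by apply: sumr_ge0 => p _; rewrite divr_ge0// ltW.
move=> i x; apply: le_trans (ler_norm_sum _ _ _) _.
rewrite big_seq [leRHS]big_seq; apply: ler_sum => p pS.
rewrite normrM (ger0_norm (weight_ge0 _ _ _ _)) -[leRHS]mul1r.
apply: ler_pM => //; [exact: weight_ge0|exact: weight_le1|].
rewrite normrM (ger0_norm (c_ge0 p)) ler_wpM2l//.
exact: dcapped_log_bound.
Qed.

(** The cutoff is then removed, which costs nothing: the vortex potential lives on
   discs where chi is at least c0, so the gradient of the cutoff tends to 0 there. *)
Lemma vortex_pairing : curl_pairing vortex_pot vortex_grad.
Proof.
have [B2 B20 h2] := vortex_grad_bound; have [L L0 hL] := dchi_bound.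
pose B1 := \sum_(p <- S) c p * ln (rho p / eta).
have h1 x : vortex_pot x <= B1.
  apply: le_trans (vortex_pot_le x) _; apply: ler_sum => p _.
  by rewrite ler_wpM2l// capped_log_le.
have B10 : 0 <= B1 by apply: le_trans (h1 0); exact: vortex_pot_ge0.
pose e k : R := k.+1%:R^-1; have e0 k : 0 < e k by rewrite invr_gt0.
have e1 k : e k <= 1 by rewrite invf_le1// ler1n.
have cvge : e k @[k --> \oo] --> 0 := cvg_harmonic.
have dcb k i x : c0 <= chi x -> `|dcutoff (e k) i x| <= L / c0 ^+ 2.
  move=> cx; have h := chi_eps_gt0 x (e0 k).
  rewrite /dcutoff normrM normrM (gtr0_norm (e0 k)).
  rewrite (ger0_norm (_ : 0 <= ((chi x + e k) ^+ 2)^-1)) ?invr_ge0 ?sqr_ge0//.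
  apply: ler_pM; rewrite ?mulr_ge0 ?invr_ge0 ?sqr_ge0 ?(ltW (e0 k))//.
    by rewrite -[leRHS]mul1r; apply: ler_pM => //; exact: ltW.
  rewrite lef_pV2 ?posrE ?exprn_gt0// ler_sqr ?nnegrE ?(ltW c0_gt0) ?(ltW h)//.
  by rewrite (le_trans cx)// lerDl ltW.
apply: (@curl_pairing_lim _ _ _ _ (B1 + (B1 * (L / c0 ^+ 2) + B2))
    (fun k => cut_pairing (e0 k))).
- move=> k x; have /andP[z0 z1] := cutoff01 x (e0 k).
  rewrite normrM (ger0_norm z0) (ger0_norm (vortex_pot_ge0 x)) -[leLHS]addr0.
  apply: lerD.
    by rewrite -[leRHS]mulr1; apply: ler_pM => //; exact: vortex_pot_ge0.
  by rewrite addr_ge0// mulr_ge0// divr_ge0// sqr_ge0.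
- move=> k i x; have /andP[z0 z1] := cutoff01 x (e0 k).
  apply: le_trans (ler_normD _ _) _; rewrite -[leLHS]add0r; apply: lerD => //.
  apply: lerD; last first.
    by rewrite normrM (ger0_norm z0) -[leRHS]mul1r; apply: ler_pM.
  rewrite normrM (ger0_norm (vortex_pot_ge0 x)).
  have [cx|cx] := leP c0 (chi x); last first.
    by rewrite vortex_pot_out// mul0r mulr_ge0// divr_ge0// sqr_ge0.
  by apply: ler_pM => //; [exact: vortex_pot_ge0|exact: dcb].
- by move=> k x nK; rewrite cutoff_out// mulr0.
- by move=> k i x nK; rewrite cutoff_out// dcutoff_out// mulr0 mul0r addr0.
- move=> x; have [cx|cx] := leP c0 (chi x); last first.
    rewrite vortex_pot_out// (_ : (fun k => _) = (fun=> 0)); first exact: cvg_cst.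
    by apply/funext => k; rewrite mul0r.
  rewrite -[X in _ --> X]mulr1; apply: cvgM; first exact: cvg_cst.
  have c1 : 0 < chi x := lt_le_trans c0_gt0 cx.
  rewrite -(divff (lt0r_neq0 c1)); apply: cvgM; first exact: cvg_cst.
  apply: cvgV; first by rewrite gt_eqF.
  by rewrite -[X in _ --> X]addr0; apply: cvgD => //; exact: cvg_cst.
- move=> i x; have [cx|cx] := leP c0 (chi x); last first.
    rewrite vortex_grad_out// (_ : (fun k => _) = (fun=> 0)); first exact: cvg_cst.
    by apply/funext => k; rewrite vortex_pot_out// mul0r mulr0 addr0.
  have c1 : 0 < chi x := lt_le_trans c0_gt0 cx.
  have cve : chi x + e k @[k --> \oo] --> chi x.
    by rewrite -[X in _ --> X]addr0; apply: cvgD => //; exact: cvg_cst.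
  rewrite -[X in _ --> X]add0r; apply: cvgD.
    rewrite -(mulr0 (vortex_pot x)); apply: cvgM; first exact: cvg_cst.
    rewrite -(mul0r ((chi x * chi x)^-1)) -(mul0r (partial i chi x)).
    apply: cvgM; first by apply: cvgM => //; exact: cvg_cst.
    apply: cvgV; first by rewrite mulf_neq0 ?gt_eqF.
    rewrite (_ : (fun k => _) = (fun k => (chi x + e k) * (chi x + e k))).
      exact: cvgM.
    by apply/funext => k; rewrite expr2.
  rewrite -[X in _ --> X]mul1r; apply: cvgM; last exact: cvg_cst.
  rewrite -(divff (lt0r_neq0 c1)); apply: cvgM; first exact: cvg_cst.
  by apply: cvgV => //; rewrite gt_eqF.
Qed.

End CurlPairing.

(** * Lipschitz weights and small discs *)

Section SmallDiscs.
Context {R : realType}.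
Implicit Types (x y p : plane R).

Lemma seq_pos_min (T : eqType) (s : seq T) (f : T -> R) :
  (forall q, q \in s -> 0 < f q) ->
  exists2 d : R, 0 < d & forall q, q \in s -> d <= f q.
Proof.
elim: s => [|p s IH] h; first by exists 1.
have [q qs|d d0 hd] := IH; first by apply: h; rewrite inE qs orbT.
have fp : 0 < f p by apply: h; rewrite mem_head.
exists (Num.min d (f p)); first by rewrite lt_min d0.
move=> q; rewrite inE => /predU1P[->|/hd qd]; first by rewrite ge_min lexx orbT.
by rewrite ge_min qd.
Qed.

(* A partial derivative bounded by L, integrated along a coordinate segment. *)
Lemma dir_lipschitz (f : plane R -> R) (L : R) i x (h : R) : smooth f ->
  (forall y, `|partial i f y| <= L) -> `|f (h *: dir i + x) - f x| <= L * `|h|.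
Proof.
move=> sf fL; pose F (t : R) := f (t *: dir i + x).
have dF (t : R) : is_derive t (1 : R) F (partial i f (t *: dir i + x)).
  by apply/is_derive_lineP; exact: smooth_is_derive.
have cF : continuous F.
  move=> t; apply: differentiable_continuous; apply/derivable1_diffP.
  by have [] := dF t.
have key a b : a <= b -> `|F b - F a| <= L * (b - a).
  move=> ab; have [|c _ ->] := @MVT_segment R F
      (fun t => partial i f (t *: dir i + x)) a b ab.
  - exact: continuous_subspaceT.
  - by rewrite normrM (@ger0_norm _ (b - a)) ?subr_ge0// ler_wpM2r// subr_ge0.
have F0 : F 0 = f x by rewrite /F scale0r add0r.
rewrite -F0; have [h0|h0] := leP 0 h.
  by rewrite (ger0_norm h0) -[X in L * X]subr0; exact: key.
by rewrite distrC (ltr0_norm h0) -[X in L * X]sub0r; apply: key; exact: ltW.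
Qed.

(* The factor 2 comes from moving along the two axes in turn. *)
Lemma grad_lipschitz (f : plane R -> R) (L : R) : smooth f ->
  (forall i y, `|partial i f y| <= L) ->
  forall x y, `|f x - f y| <= 2 * L * enorm (x - y).
Proof.
move=> sf fL x y.
have L0 : 0 <= L by apply: le_trans (fL true 0).
have h1 := dir_lipschitz (y) (x.1 - y.1) sf (fL false).
have h2 := dir_lipschitz ((x.1 - y.1) *: dir false + y) (x.2 - y.2) sf (fL true).
have E : (x.2 - y.2) *: dir true + ((x.1 - y.1) *: dir false + y) = x.
  case: x {h1 h2} => x1 x2; case: y => y1 y2.
  rewrite /dir; congr pair => /=; rewrite /GRing.scale/=; ring.
rewrite E in h2.
have d1 : `|x.1 - y.1| <= enorm (x - y) := normr_fst_le (x - y).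
have d2 : `|x.2 - y.2| <= enorm (x - y) := normr_snd_le (x - y).
apply: (le_trans (ler_distD (f ((x.1 - y.1) *: dir false + y)) _ _)).
rewrite (_ : 2 * L * _ = L * enorm (x - y) + L * enorm (x - y)); last by ring.
apply: lerD; first by apply: le_trans h2 _; rewrite ler_wpM2l.
by apply: le_trans h1 _; rewrite ler_wpM2l.
Qed.

Let set_seq_cons (p : plane R) s : [set` p :: s] = [set p] `|` [set` s].
Proof.
apply/seteqP; split => x /=; rewrite inE.
  by move=> /predU1P[->|]; [left|right].
by move=> [->|->]; rewrite ?eqxx ?orbT.
Qed.

Lemma measurable_seq (s : seq (plane R)) : measurable [set` s].
Proof.
elim: s => [|p s IH]; first by rewrite set_nil.
rewrite set_seq_cons; apply: measurableU => //.
have := @measurable_ecball R p 0; congr measurable.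
apply/seteqP; split => x /=; rewrite /ecball/=; last by move=> ->; rewrite subrr enorm0.
by rewrite le_eqVlt ltNge enorm_ge0 orbF enorm_eq0 subr_eq0 => /eqP.
Qed.

Lemma leb2_seq (s : seq (plane R)) : leb2 R [set` s] = 0%E.
Proof.
elim: s => [|p s IH]; first by rewrite set_nil measure0.
rewrite set_seq_cons.
have mp : measurable [set p].
  by have := measurable_seq [:: p]; rewrite set_seq_cons set_nil setU0.
apply: (@null_set_setU _ _ _ (leb2 R)) => //; first exact: measurable_seq.
exact: leb2_set1.
Qed.

Definition balls (s : seq (plane R)) (eta : R) : set (plane R) :=
  \bigcup_(p in [set` s]) ecball p eta.

Lemma measurable_balls s eta : measurable (balls s eta).
Proof.
apply: fin_bigcup_measurable; first exact: finite_seq.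
by move=> p _; exact: measurable_ecball.
Qed.

Lemma sub_balls s (a b : R) : a <= b -> balls s a `<=` balls s b.
Proof.
by move=> ab x [p ps xp]; exists p => //; exact: le_trans xp ab.
Qed.

Lemma bigcup_notin_balls s :
  \bigcup_k ~` balls s (k.+1%:R^-1) = ~` [set` s].
Proof.
apply/seteqP; split => x /=.
  move=> [k _ nx] xs; apply: nx; exists x => //.
  by rewrite /ecball/= subrr enorm0 invr_ge0.
move=> nx; have [p ps|d d0 hd] := @seq_pos_min _ s (fun p => enorm (x - p)).
  rewrite lt_neqAle enorm_ge0 andbT eq_sym enorm_eq0 subr_eq0.
  by apply/eqP => xp; apply: nx; rewrite xp.
exists (Num.bound d^-1) => // -[p /= ps]; rewrite /ecball/= => xp.
have := le_trans (hd _ ps) xp; apply/negP; rewrite -ltNge invf_plt ?posrE//.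
by rewrite (lt_le_trans (archi_boundP _))// ?invr_ge0 ?(ltW d0)// ler_nat.
Qed.

Lemma ge0_integral_notin_seq (s : seq (plane R)) (f : plane R -> R) A :
  measurable A -> measurable_fun setT f -> (forall x, 0 <= f x) ->
  (\int[leb2 R]_(x in A) (f x)%:E = \int[leb2 R]_(x in A `\` [set` s]) (f x)%:E)%E.
Proof.
move=> mA mf f0; apply: ge0_negligible_integral => //.
- exact: measurable_seq.
- by apply/measurable_EFinP; exact: measurable_funTS.
- by move=> x _; rewrite lee_fin.
- exact: leb2_seq.
Qed.

Lemma cvg_integral_notin_balls (s : seq (plane R)) (f : plane R -> R) A :
  measurable A -> measurable_fun setT f -> (forall x, 0 <= f x) ->
  (\int[leb2 R]_(x in A `\` balls s k.+1%:R^-1) (f x)%:E @[k --> \oo] -->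
   \int[leb2 R]_(x in A) (f x)%:E)%E.
Proof.
move=> mA mf f0; rewrite (ge0_integral_notin_seq s)//.
rewrite setDE -bigcup_notin_balls setI_bigcupr.
apply: ge0_nondecreasing_set_cvg_integral.
- move=> k l kl; apply/subsetPset; apply: setDS.
  by apply: sub_balls; rewrite lef_pV2 ?posrE// ler_nat.
- by move=> k; apply: measurableI => //; apply: measurableC; exact: measurable_balls.
- by move=> k; apply/measurable_EFinP; exact: measurable_funTS.
- by move=> k x _; rewrite lee_fin.
Qed.

(** Absolute continuity of the integral, for shrinking discs. *)
Lemma integral_balls_small (s : seq (plane R)) (f : plane R -> R) A (e : R) :
  measurable A -> measurable_fun setT f -> (forall x, 0 <= f x) ->
  (\int[leb2 R]_(x in A) (f x)%:E < +oo)%E -> 0 < e ->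
  exists2 d : R, 0 < d & forall eta, eta <= d ->
    (\int[leb2 R]_(x in A `&` balls s eta) (f x)%:E <= e%:E)%E.
Proof.
move=> mA mf f0 fA e0.
have F0 B : (0 <= \int[leb2 R]_(x in B) (f x)%:E)%E.
  by apply: integral_ge0 => x _; rewrite lee_fin.
have mfe B : measurable_fun B (EFin \o f).
  by apply/measurable_EFinP; exact: measurable_funTS.
have split eta : (\int[leb2 R]_(x in A) (f x)%:E =
    \int[leb2 R]_(x in A `&` balls s eta) (f x)%:E +
    \int[leb2 R]_(x in A `\` balls s eta) (f x)%:E)%E.
  rewrite -ge0_integral_setU//.
  - by rewrite setUIDK.
  - by apply: measurableI => //; exact: measurable_balls.
  - by apply: measurableD => //; exact: measurable_balls.
  - by move=> x _; rewrite lee_fin.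
  - by rewrite disj_set2E; apply/eqP; rewrite setDE setIACA setICr setI0.
have := cvg_integral_notin_balls s mA mf f0.
have fin : (\int[leb2 R]_(x in A) (f x)%:E)%E \is a fin_num.
  by rewrite ge0_fin_numE.
rewrite -(fineK fin) => /fine_cvgP[_ /cvgrPdist_le/(_ e e0)[k _ hk]].
exists k.+1%:R^-1; first by rewrite invr_gt0.
move=> eta ek; apply: (@le_trans _ _
   (\int[leb2 R]_(x in A `&` balls s k.+1%:R^-1) (f x)%:E)%E).
  apply: ge0_subset_integral => //.
  - by apply: measurableI => //; exact: measurable_balls.
  - by apply: measurableI => //; exact: measurable_balls.
  - by move=> x _; rewrite lee_fin.
  - by apply: setIS; exact: sub_balls.
have := hk k (leqnn _); have := split k.+1%:R^-1.
have := F0 (A `&` balls s k.+1%:R^-1); have := F0 (A `\` balls s k.+1%:R^-1).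
move: fin; case: (\int[leb2 R]_(x in A) _)%E => [a| |]// _.
rewrite /=; case: (\int[leb2 R]_(x in A `\` _) _)%E => [b| |]//=; last first.
  by case: (\int[leb2 R]_(x in A `&` _) _)%E => [c| |].
case: (\int[leb2 R]_(x in A `&` _) _)%E => [c| |]//=.
rewrite !lee_fin -EFinD => b0 c0 [->].
by rewrite addrK ger0_norm.
Qed.

End SmallDiscs.

(** * Logarithmic potentials of measures of linear growth *)

Lemma measurable_capped_log (R : realType) (p : plane R) (eta r : R) :
  measurable_fun setT (capped_log p eta r).
Proof.
have mr : measurable_fun setT (fun x : plane R => enorm (x - p)).
  exact: measurable_enorm_sub.
apply: measurable_fun_ifT => //; first exact: measurable_fun_ler.
apply: measurable_fun_ifT => //; first exact: measurable_fun_ler.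
apply: (measurableT_comp (@measurable_ln R)); apply: measurable_funM => //.
by apply: (measurableT_comp (@measurable_invr R)).
Qed.

Section LogarithmicPotential.
Context {R : realType} (A : set (plane R)) (mA : measurable A)
  (m : {measure set (plane R) -> \bar R}) (M : R).
Context (m_ball : forall (x : plane R) (r : R), A x -> 0 < r -> r < 1 ->
       (m (eball x r `&` A) <= (pi * M * r)%:E)%E).

Let ln_le_dyadic n (s : R) : 0 < s -> s < 2 ^+ n ->
  ln s <= \sum_(i < n) ((2 ^+ i <= s)%R)%:R.
Proof.
elim: n s => [|n IH] s s0 sn.
  by rewrite big_ord0 ln_le0// ltW// -(expr0 2).
rewrite big_ord_recr/=; have [ns|ns] := leP (2 ^+ n) s; last first.
  by rewrite addr0; exact: IH.
rewrite (_ : \sum_(i < n) _ = n%:R); last first.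
  rewrite (eq_bigr (fun=> 1)); first by rewrite sumr_const card_ord.
  move=> i _; rewrite (_ : 2 ^+ i <= s)//.
  by apply: le_trans ns; rewrite ler_weXn2l// ?ler1n// ltnW.
rewrite natr1; apply: (@le_trans _ _ (ln (2 ^+ n.+1))).
  by rewrite ler_ln ?posrE ?exprn_gt0// ltW.
rewrite lnXn// -[_ *+ _]mulr_natl ler_piMr//.
have := @le_ln1Dx R 1; rewrite -[1 + 1]/(2 : R); apply; lra.
Qed.

Let sum_half n : \sum_(i < n) (2 ^+ i)^-1 <= 2 :> R.
Proof.
suff -> : \sum_(i < n) (2 ^+ i)^-1 = 2 - 2 * (2 ^+ n)^-1 :> R.
  by rewrite lerBlDr lerDl mulr_ge0// invr_ge0 exprn_ge0.
elim: n => [|n IH]; first by rewrite big_ord0 expr0 invr1 mulr1 subrr.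
rewrite big_ord_recr/= IH exprS; field.
by rewrite expf_neq0.
Qed.

(** By dyadic summation over concentric discs, whose measures are bounded by a
   geometric sequence. *)
Lemma integral_capped_log p (eta rho : R) : A p -> 0 < M -> 0 < eta -> eta < rho ->
  2 * rho < 1 ->
  (\int[m]_(x in A) (capped_log p eta rho x)%:E <= (4 * pi * M * rho)%:E)%E.
Proof.
move=> Ap M0 e0 er r1; have r0 := lt_trans e0 er.
pose rad i : R := 2 * rho / 2 ^+ i.
have rad0 i : 0 < rad i by rewrite divr_gt0 ?mulr_gt0// exprn_gt0.
have rad1 i : rad i < 1.
  rewrite /rad ltr_pdivrMr ?exprn_gt0// mul1r (lt_le_trans r1)//.
  by rewrite exprn_ege1// ler1n.
have [n hn] : exists n, rho / eta < 2 ^+ n.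
  exists (Num.bound (rho / eta)).
  apply: (@lt_le_trans _ _ (Num.bound (rho / eta))%:R).
    by rewrite archi_boundP// divr_ge0// ltW.
  elim: (Num.bound _) => [|k IH]; first by rewrite exprn_ge0.
  rewrite -natr1 exprS; have : 1 <= 2 ^+ k :> R by rewrite exprn_ege1// ler1n.
  lra.
(* The number of radii 2 rho / 2^i above r is at least ln (rho / r). *)
have ptw x : capped_log p eta rho x <= \sum_(i < n) \1_(eball p (rad i)) x.
  have S0 : 0 <= \sum_(i < n) \1_(eball p (rad i)) x :> R.
    by apply: sumr_ge0 => i _; rewrite indicE.
  have main (r : R) : enorm (x - p) <= r -> eta <= r -> r <= rho ->
      ln (rho / r) <= \sum_(i < n) \1_(eball p (rad i)) x.
    move=> xr er' rr; have rr0 := lt_le_trans e0 er'.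
    apply: (@le_trans _ _ (\sum_(i < n) ((2 ^+ i <= rho / r)%R)%:R)).
      apply: ln_le_dyadic; first by rewrite divr_gt0.
      by apply: le_lt_trans hn; rewrite ler_pM2l// lef_pV2.
    apply: ler_sum => i _; rewrite indicE.
    have [|] := boolP (2 ^+ i <= rho / r) => // ir.
    rewrite mem_set// /eball/=; apply: (le_lt_trans xr).
    move: ir; rewrite ler_pdivlMr// /rad => ir.
    rewrite ltr_pdivlMr ?exprn_gt0// mulrC; lra.
  rewrite /capped_log; case: (leP (enorm (x - p)) eta) => d1.
    by apply: main => //; exact: ltW.
  by case: (leP (enorm (x - p)) rho) => // d2; apply: main => //; exact: ltW.
have mi i : measurable_fun A (EFin \o (\1_(eball p (rad i)) : plane R -> R)).
  apply/measurable_EFinP; apply: measurable_funTS; apply: measurable_indic.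
  exact: measurable_eball.
apply: (@le_trans _ _ (\int[m]_(x in A)
    \sum_(i < n) (EFin \o (\1_(eball p (rad i)) : plane R -> R)) x)%E).
  apply: ge0_le_integral => //.
  - by move=> x _; rewrite lee_fin capped_log_ge0.
  - by apply/measurable_EFinP; apply: measurable_funTS; exact: measurable_capped_log.
  - exact: emeasurable_sum.
  - by move=> x _; rewrite sumEFin lee_fin.
rewrite ge0_integral_sum//; last by move=> i x _; rewrite lee_fin indicE.
apply: (@le_trans _ _ (\sum_(i < n) (pi * M * rad i)%:E)%E).
  apply: lee_sum => i _; rewrite integral_indic//; last exact: measurable_eball.
  exact: m_ball.
rewrite sumEFin lee_fin -mulr_sumr /rad -mulr_sumr.
have := sum_half n; set t := \sum_(i < n) _ => t2.
have pM : 0 < pi * M * rho by rewrite !mulr_gt0// pi_gt0.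
nra.
Qed.

End LogarithmicPotential.

(** * The shielding field *)

Section CompletingTheSquare.
Context {R : realType}.
Implicit Types (x y : plane R).

Definition perp_grad (V : bool -> plane R -> R) x : plane R :=
  (V true x, - V false x).

(** The vector field whose product with chi is the rotated gradient; the inverse of
   0 being 0, it vanishes where chi does. *)
Definition field_of (chi : plane R -> R) (V : bool -> plane R -> R) x : plane R :=
  ((chi x)^-1 * V true x, - ((chi x)^-1 * V false x)).

Definition dot (u v : plane R) : R := u.1 * v.1 + u.2 * v.2.

(** Since chi times the field is the rotated gradient itself, the cross term does
   not involve chi, and can be computed from the equation for the curl. *)
Lemma completed_square (chi : plane R -> R) (V : bool -> plane R -> R)
    (j : plane R -> plane R) x : (chi x = 0 -> forall i, V i x = 0) ->
  chi x * enorm (j x - field_of chi V x) ^+ 2 =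
  chi x * enorm (j x) ^+ 2 -
  (2 * dot (j x) (perp_grad V x) - enorm (perp_grad V x) ^+ 2 / chi x).
Proof.
move=> V0; rewrite !sqr_enorm /dot /perp_grad /field_of/=.
have [x0|x0] := eqVneq (chi x) 0.
  by rewrite !V0// x0 invr0; ring.
by field.
Qed.

End CompletingTheSquare.

(* Only the positive part of f matters, so f may fail to be integrable. *)
Lemma le_integral_ge0 d (T : measurableType d) (R : realType)
    (mu : {measure set T -> \bar R}) (D : set T) (f g : T -> \bar R) :
  measurable D -> measurable_fun D f -> measurable_fun D g ->
  (forall x, D x -> (0 <= g x)%E) -> (forall x, D x -> (f x <= g x)%E) ->
  (\int[mu]_(x in D) f x <= \int[mu]_(x in D) g x)%E.
Proof.
move=> mD mf mg g0 fg; rewrite integralE.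
apply: (@le_trans _ _ (\int[mu]_(x in D) f^\+ x)%E).
  by rewrite -[leRHS]adde0 leeD2l// oppe_le0 integral_ge0.
apply: ge0_le_integral => //; first exact: measurable_funepos.
by move=> x Dx; rewrite funeposE ge_max fg//= g0.
Qed.

Lemma ge0_integral_EFinD d (T : measurableType d) (R : realType)
    (mu : {measure set T -> \bar R}) (D : set T) (f g : T -> R) :
  measurable D -> (forall x, 0 <= f x) -> (forall x, 0 <= g x) ->
  measurable_fun setT f -> measurable_fun setT g ->
  (\int[mu]_(x in D) (f x + g x)%:E =
   \int[mu]_(x in D) (f x)%:E + \int[mu]_(x in D) (g x)%:E)%E.
Proof.
move=> mD f0 g0 mf mg.
rewrite -ge0_integralD//; try by move=> x _; rewrite lee_fin.
- by apply/measurable_EFinP; exact: measurable_funTS.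
- by apply/measurable_EFinP; exact: measurable_funTS.
Qed.

Lemma ge0_integral_EFinZl d (T : measurableType d) (R : realType)
    (mu : {measure set T -> \bar R}) (D : set T) (k : R) (f : T -> R) :
  measurable D -> 0 <= k -> (forall x, 0 <= f x) -> measurable_fun setT f ->
  (\int[mu]_(x in D) (k * f x)%:E = k%:E * \int[mu]_(x in D) (f x)%:E)%E.
Proof.
move=> mD k0 f0 mf; rewrite -ge0_integralZl_EFin//.
- by move=> x _; rewrite lee_fin.
- by apply/measurable_EFinP; exact: measurable_funTS.
Qed.

Section OneCharge.
Context {R : realType} (T : eqType).

Lemma softmax1 (p : T) (u : T -> R) : softmax 1 [:: p] u = u p.
Proof.
by rewrite /softmax /expsum big_seq1 mul1r /= !divr1 expRK.
Qed.

End OneCharge.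

Section ShieldingField.
Context {R : realType}.
Implicit Types (x p q : plane R).

Lemma sqr_inj_ge0 (a b : R) : 0 <= a -> 0 <= b -> a ^+ 2 = b ^+ 2 -> a = b.
Proof. by move=> a0 b0 /eqP; rewrite eqrXn2// => /eqP. Qed.

Lemma sqr_enorm_perp_grad (V : bool -> plane R -> R) x :
  enorm (perp_grad V x) ^+ 2 = V true x ^+ 2 + V false x ^+ 2.
Proof. by rewrite sqr_enorm /perp_grad/= sqrrN. Qed.

Lemma measurable_grad_density (c : plane R -> R) (W : bool -> plane R -> R) :
  measurable_fun setT c -> (forall i, measurable_fun setT (W i)) ->
  measurable_fun setT (fun x => enorm (perp_grad W x) ^+ 2 / c x).
Proof.
move=> mc mW; apply: measurable_funM; last first.
  by apply: (measurableT_comp (@measurable_invr R)).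
rewrite (_ : (fun x => _) = (fun x => W true x ^+ 2 + W false x ^+ 2)).
  by apply: measurable_funD; apply: measurable_funX.
by apply/funext => x; rewrite sqr_enorm_perp_grad.
Qed.

Lemma enorm_field_of (chi : plane R -> R) (V : bool -> plane R -> R) x :
  0 <= chi x -> enorm (field_of chi V x) = (chi x)^-1 * enorm (perp_grad V x).
Proof.
move=> c0; apply: sqr_inj_ge0; first exact: enorm_ge0.
  by rewrite mulr_ge0 ?invr_ge0// enorm_ge0.
rewrite exprMn sqr_enorm_perp_grad sqr_enorm /field_of/=; ring.
Qed.

Lemma sqr_dcapped_log p (eta rho : R) x : 0 <= eta ->
  dcapped_log true p eta rho x ^+ 2 + dcapped_log false p eta rho x ^+ 2 =
  if eta < enorm (x - p) <= rho then (enorm (x - p) ^+ 2)^-1 else 0.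
Proof.
move=> e0; rewrite /dcapped_log; case: ifPn => [/andP[ex _]|_]; last first.
  by rewrite expr0n addr0.
have r0 : 0 < enorm (x - p) by exact: le_lt_trans ex.
have := sqr_enorm (x - p); move: (enorm (x - p)) r0 => r r0 h.
have -> : (- (coord true (x - p) / r ^+ 2)) ^+ 2 +
  (- (coord false (x - p) / r ^+ 2)) ^+ 2 =
  ((x - p).1 ^+ 2 + (x - p).2 ^+ 2) * (r ^- 2) ^+ 2.
  rewrite /coord; ring.
by rewrite -h; field; exact: lt0r_neq0.
Qed.

(** Jensen's inequality for the square. *)
Lemma sqr_weighted_sum (T : eqType) (S : seq T) (w u : T -> R) :
  (forall t, 0 <= w t) -> \sum_(p <- S) w p = 1 ->
  (\sum_(p <- S) w p * u p) ^+ 2 <= \sum_(p <- S) w p * u p ^+ 2.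
Proof.
have [a aE] : exists a, a = \sum_(p <- S) w p * u p by eexists.
move=> w0 w1; rewrite -aE.
have : 0 <= \sum_(p <- S) w p * (u p - a) ^+ 2.
  by apply: sumr_ge0 => p _; rewrite mulr_ge0// sqr_ge0.
have -> : \sum_(p <- S) w p * (u p - a) ^+ 2 =
    \sum_(p <- S) w p * u p ^+ 2 - 2 * a * (\sum_(p <- S) w p * u p) +
    a ^+ 2 * \sum_(p <- S) w p.
  rewrite !mulr_sumr -sumrB -big_split/=; apply: eq_bigr => p _; ring.
rewrite w1 -aE; lra.
Qed.

Lemma enorm_sum (T : eqType) (S : seq T) (a b : T -> R) :
  enorm ((\sum_(p <- S) a p, \sum_(p <- S) b p) : plane R) <=
  \sum_(p <- S) enorm ((a p, b p) : plane R).
Proof.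
elim: S => [|p S IH]; first by rewrite !big_nil enorm0.
rewrite !big_cons; apply: le_trans (lerD (lexx _) IH).
exact: (@ler_enormD R (a p, b p) (\sum_(p <- S) a p, \sum_(p <- S) b p)).
Qed.

Context (chi : plane R -> R) (S : seq (plane R)) (rho : plane R -> R) (kappa L : R).
Context (chi_ge0 : forall x, 0 <= chi x) (L_ge0 : 0 <= L)
  (chi_lip : forall x y, `|chi x - chi y| <= 2 * L * enorm (x - y))
  (S0 : S != [::])
  (rho_small : forall p, p \in S -> 0 < chi p /\ 4 * L * rho p <= chi p).

Local Notation V := (fun eta => vortex_grad S chi rho eta kappa).
Local Notation w eta x := (weight kappa S (fun p => chi p * capped_log p eta (rho p) x)).

(** As 4 L rho is at most chi p, the bound 2 L r on the variation of chi is at most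
   half of chi p. *)
Lemma chi_near p x : p \in S -> enorm (x - p) <= rho p ->
  [/\ 4 * L * enorm (x - p) <= chi p, chi p - 2 * L * enorm (x - p) <= chi x &
      chi p / 2 <= chi x].
Proof.
move=> pS xr; have [cp rp] := rho_small pS.
have h1 : 4 * L * enorm (x - p) <= chi p.
  by apply: le_trans rp; rewrite ler_wpM2l// mulr_ge0.
have h2 : chi p - 2 * L * enorm (x - p) <= chi x.
  by have := chi_lip x p; rewrite ler_norml => /andP[]; lra.
split => //; lra.
Qed.

Lemma vortex_grad_supp eta i x : chi x = 0 -> V eta i x = 0.
Proof.
move=> x0; rewrite /vortex_grad big_seq big1// => p pS.
rewrite /dcapped_log; case: ifPn => [/andP[_ xr]|_]; last by rewrite !mulr0.
have [_ _] := chi_near pS xr; have [cp _] := rho_small pS.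
rewrite x0; lra.
Qed.

(** The gradient is a convex combination of the gradients of the single potentials,
   so its square is at most the combination of their squares: overlapping discs
   produce no cross terms. *)
Lemma vortex_grad_sqr_le eta x : 0 <= eta ->
  enorm (perp_grad (V eta) x) ^+ 2 <=
  \sum_(p <- S) w eta x p * (chi p ^+ 2 *
    if eta < enorm (x - p) <= rho p then (enorm (x - p) ^+ 2)^-1 else 0).
Proof.
move=> e0; rewrite sqr_enorm_perp_grad.
have sw (i : bool) : V eta i x ^+ 2 <=
    \sum_(p <- S) w eta x p * (chi p * dcapped_log i p eta (rho p) x) ^+ 2.
  by apply: sqr_weighted_sum; [move=> p; exact: weight_ge0|exact: sum_weight].
apply: le_trans (lerD (sw true) (sw false)) _.
rewrite -big_split/= le_eqVlt; apply/orP; left; apply/eqP.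
apply: eq_bigr => p _; rewrite -sqr_dcapped_log//; ring.
Qed.

(** An upper bound, to first order in r, for the quotient of chi(p)^2 / r^2 by chi(x). *)
Definition vortex_density eta p x : R :=
  if eta < enorm (x - p) <= rho p then
    chi p * (enorm (x - p) ^+ 2)^-1 + 4 * L * (enorm (x - p))^-1 else 0.

Lemma vortex_density_ge0 eta p x : 0 <= vortex_density eta p x.
Proof.
rewrite /vortex_density; case: ifP => // _.
by rewrite addr_ge0// mulr_ge0 ?invr_ge0 ?sqr_ge0 ?enorm_ge0 ?mulr_ge0.
Qed.

Lemma grad_density_le eta x : 0 <= eta ->
  enorm (perp_grad (V eta) x) ^+ 2 / chi x <= \sum_(p <- S) vortex_density eta p x.
Proof.
move=> e0; have := chi_ge0 x; rewrite le_eqVlt => /predU1P[x0|x0].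
  rewrite -x0 invr0 mulr0; apply: sumr_ge0 => p _; exact: vortex_density_ge0.
rewrite ler_pdivrMr//; apply: le_trans (vortex_grad_sqr_le x e0) _.
rewrite mulr_suml big_seq [leRHS]big_seq; apply: ler_sum => p pS.
rewrite /vortex_density; case: ifPn => [/andP[ex xr]|_]; last by rewrite !mulr0 mul0r.
have [h1 h2 _] := chi_near pS xr; have [cp _] := rho_small pS.
have w0 := weight_ge0 kappa S (fun p => chi p * capped_log p eta (rho p) x) p.
have w1 := weight_le1 kappa (fun p => chi p * capped_log p eta (rho p) x) pS.
have r0 : 0 < enorm (x - p) by exact: le_lt_trans ex.
move: (enorm (x - p)) (weight _ _ _ _) r0 w0 w1 h1 h2 => r v r0 v0 v1 h1 h2.
(* The product of chi p + 4 L r and the lower bound chi p - 2 L r of chi x exceeds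
   the square of chi p by 2 L r (chi p - 4 L r). *)
have key : chi p ^+ 2 <= (chi p + 4 * L * r) * chi x.
  have Lr : 0 <= L * r by rewrite mulr_ge0// ltW.
  apply: (@le_trans _ _ ((chi p + 4 * L * r) * (chi p - 2 * L * r))).
    by rewrite -subr_ge0 (_ : _ - _ = 2 * (L * r) * (chi p - 4 * L * r));
      [rewrite mulr_ge0 ?subr_ge0// mulr_ge0|ring].
  by rewrite ler_wpM2l// addr_ge0// -mulrA mulr_ge0.
have r2 : 0 < (r ^+ 2)^-1 by rewrite invr_gt0 exprn_gt0.
apply: (@le_trans _ _ (chi p ^+ 2 * (r ^+ 2)^-1)).
  by rewrite ler_piMl// mulr_ge0 ?sqr_ge0// ltW.
rewrite (_ : (_ + _) * chi x = (chi p + 4 * L * r) * chi x * (r ^+ 2)^-1).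
  by rewrite ler_wpM2r// ltW.
by field; exact: lt0r_neq0.
Qed.

Lemma measurable_vortex_density eta p : measurable_fun setT (vortex_density eta p).
Proof.
have mr : measurable_fun setT (fun x : plane R => enorm (x - p)).
  exact: measurable_enorm_sub.
apply: measurable_fun_ifT => //.
  by apply: measurable_and; [apply: measurable_fun_ltr|apply: measurable_fun_ler].
apply: measurable_funD; apply: measurable_funM => //.
  by apply: (measurableT_comp (@measurable_invr R)); exact: measurable_funX.
by apply: (measurableT_comp (@measurable_invr R)).
Qed.

Lemma integral_vortex_density eta p : 0 < eta -> eta < rho p ->
  (\int[leb2 R]_x (vortex_density eta p x)%:E <=
   (2 * pi * chi p * ln (rho p / eta) + 8 * pi * L * rho p)%:E)%E.
Proof.
move=> e0 er; have r0 := lt_trans e0 er.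
have mA := @measurable_annulus R p eta (rho p).
have mr : measurable_fun setT (fun x : plane R => enorm (x - p)).
  exact: measurable_enorm_sub.
have m1 : measurable_fun setT (fun x : plane R => (enorm (x - p) ^+ 2)^-1).
  by apply: (measurableT_comp (@measurable_invr R)); exact: measurable_funX.
have m2 : measurable_fun setT (fun x : plane R => (enorm (x - p))^-1).
  by apply: (measurableT_comp (@measurable_invr R)).
have i1 (x : plane R) : 0 <= (enorm (x - p) ^+ 2)^-1 by rewrite invr_ge0 sqr_ge0.
have i2 (x : plane R) : 0 <= (enorm (x - p))^-1 by rewrite invr_ge0 enorm_ge0.
have -> : (\int[leb2 R]_x (vortex_density eta p x)%:E =
    \int[leb2 R]_(x in annulus p eta (rho p))
      (chi p * (enorm (x - p) ^+ 2)^-1 + 4 * L * (enorm (x - p))^-1)%:E)%E.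
  rewrite [RHS]integral_mkcond; apply: eq_integral => x _.
  rewrite patchE /vortex_density; case: ifPn => h.
    by rewrite mem_set.
  by rewrite memNset//; apply/negP.
have p1 (x : plane R) : 0 <= chi p * (enorm (x - p) ^+ 2)^-1 by rewrite mulr_ge0.
have p2 (x : plane R) : 0 <= 4 * L * (enorm (x - p))^-1 by rewrite !mulr_ge0.
have q1 := measurable_funM (@measurable_cst _ _ (plane R) R setT (chi p)) m1.
have q2 := measurable_funM (@measurable_cst _ _ (plane R) R setT (4 * L)) m2.
rewrite (@ge0_integral_EFinD _ _ R (leb2 R) _ _ _ mA p1 p2 q1 q2).
rewrite (@ge0_integral_EFinZl _ _ R (leb2 R) _ (chi p) _ mA _ i1 m1)//.
rewrite (@ge0_integral_EFinZl _ _ R (leb2 R) _ (4 * L) _ mA _ i2 m2) ?mulr_ge0//.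
rewrite integral_annulus_invsq ?(ltW er)// EFinD; apply: leeD.
  by rewrite -EFinM lee_fin mulrCA -!mulrA.
rewrite (_ : 8 * pi * L * rho p = 4 * L * (2 * pi * rho p)); last by ring.
rewrite [leRHS]EFinM; apply: lee_wpmul2l; first by rewrite lee_fin mulr_ge0.
rewrite -(integral_disc_inv p r0); apply: ge0_subset_integral => //.
- exact: measurable_annulus.
- by apply/measurable_EFinP; exact: measurable_funTS.
- by move=> x _; rewrite lee_fin.
- by move=> x /andP[ex xe]; rewrite /annulus/= xe (lt_trans e0 ex).
Qed.

Lemma integral_grad_density eta : measurable_fun setT chi ->
  (forall i, measurable_fun setT (V eta i)) ->
  0 < eta -> (forall p, eta < rho p) ->
  (\int[leb2 R]_x (enorm (perp_grad (V eta) x) ^+ 2 / chi x)%:E <=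
   (\sum_(p <- S) (2 * pi * chi p * ln (rho p / eta) + 8 * pi * L * rho p))%:E)%E.
Proof.
move=> mchi mV e0 er.
apply: (@le_trans _ _ (\int[leb2 R]_x (\sum_(p <- S) (vortex_density eta p x)%:E))%E).
  apply: ge0_le_integral => //.
  - by move=> x _; rewrite lee_fin divr_ge0// sqr_ge0.
  - by apply/measurable_EFinP; exact: measurable_grad_density.
  - apply: emeasurable_sum => p; apply/measurable_EFinP.
    exact: measurable_vortex_density.
  - by move=> x _; rewrite sumEFin lee_fin grad_density_le// ltW.
rewrite ge0_integral_sum//; last 2 first.
- by move=> p; apply/measurable_EFinP; exact: measurable_vortex_density.
- by move=> p x _; rewrite lee_fin vortex_density_ge0.
by rewrite -sumEFin; apply: lee_sum => p _; exact: integral_vortex_density.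
Qed.

(** The charge chi p of the p-th vortex is compensated by the division by chi, up to
   the factor 2 by which they differ on its disc. *)
Lemma enorm_field_le eta x : 0 <= eta ->
  enorm (field_of chi (V eta) x) <=
  \sum_(p <- S) w eta x p * (if eta < enorm (x - p) <= rho p
                             then 2 / enorm (x - p) else 0).
Proof.
move=> e0; rewrite enorm_field_of//.
have rhs0 : 0 <= \sum_(p <- S) w eta x p * (if eta < enorm (x - p) <= rho p
                             then 2 / enorm (x - p) else 0).
  apply: sumr_ge0 => p _; apply: mulr_ge0; first exact: weight_ge0.
  by case: ifP => // _; rewrite divr_ge0// enorm_ge0.
have := chi_ge0 x; rewrite le_eqVlt => /predU1P[x0|x0].
  by rewrite -x0 invr0 mul0r.
rewrite mulrC ler_pdivrMr// /perp_grad /vortex_grad -sumrN.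
apply: le_trans (enorm_sum _ _ _) _; rewrite mulr_suml.
rewrite big_seq [leRHS]big_seq; apply: ler_sum => p pS.
have wc0 : 0 <= w eta x p * chi p by rewrite mulr_ge0// weight_ge0.
rewrite !mulrA -[X in enorm (_, X)]mulrN.
have -> : enorm ((w eta x p * chi p * dcapped_log true p eta (rho p) x,
   w eta x p * chi p * - dcapped_log false p eta (rho p) x) : plane R) =
   w eta x p * chi p * (if eta < enorm (x - p) <= rho p then (enorm (x - p))^-1 else 0).
  apply: sqr_inj_ge0; first exact: enorm_ge0.
    by rewrite mulr_ge0//; case: ifP => // _; rewrite invr_ge0 enorm_ge0.
  rewrite sqr_enorm [(_, _).1]/= [(_, _).2]/= !exprMn sqrrN -mulrDr sqr_dcapped_log//.
  by congr (_ * _); case: ifP; rewrite ?exprVn// expr0n.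
case: ifPn => [/andP[ex xr]|_]; last by rewrite !mulr0 mul0r.
have [_ _ h] := chi_near pS xr.
have r0 : 0 < enorm (x - p) by exact: le_lt_trans ex.
have := weight_ge0 kappa S (fun p => chi p * capped_log p eta (rho p) x) p.
move: (weight _ _ _ _) {wc0} => v v0; rewrite -!mulrA ler_wpM2l//.
rewrite (_ : 2 * ((enorm (x - p))^-1 * chi x) = 2 * chi x * (enorm (x - p))^-1).
  by rewrite ler_wpM2r ?invr_ge0 ?enorm_ge0//; lra.
by ring.
Qed.

(** This lets a single field, truncated at radius 0, serve for all eta. *)
Lemma vortex_grad_away eta x i : 0 <= eta ->
  (forall p, p \in S -> eta < enorm (x - p)) -> V eta i x = V 0 i x.
Proof.
move=> e0 away.
have capE p : p \in S -> capped_log p eta (rho p) x = capped_log p 0 (rho p) x.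
  move=> /away ex; have ex0 := le_lt_trans e0 ex.
  by rewrite /capped_log [enorm _ <= eta]leNgt ex [enorm _ <= 0]leNgt ex0.
rewrite /vortex_grad big_seq [RHS]big_seq; apply: eq_bigr => p pS; congr (_ * _).
  by apply: eq_weight => // q qS; rewrite capE.
congr (_ * _); rewrite /dcapped_log.
by rewrite (away p pS) (le_lt_trans e0 (away p pS)).
Qed.

(** In the disc of radius eta about q the potential of q is constant, and the other
   gradients are bounded by the inverse distance to their centres: the bound does
   not blow up with eta. *)
Lemma vortex_grad_core eta d x i q : 0 < d -> enorm (x - q) <= eta ->
  (forall p, p \in S -> p != q -> d <= enorm (x - p)) ->
  `|V eta i x| <= \sum_(p <- S) chi p / d.
Proof.
move=> d0 xq away; apply: le_trans (ler_norm_sum _ _ _) _.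
rewrite big_seq [leRHS]big_seq; apply: ler_sum => p pS.
rewrite normrM (ger0_norm (weight_ge0 _ _ _ _)) normrM (ger0_norm (chi_ge0 _)).
rewrite -[leRHS]mul1r; apply: ler_pM => //; first exact: weight_ge0.
- by rewrite mulr_ge0.
- exact: weight_le1.
rewrite ler_wpM2l// /dcapped_log; case: ifPn => [/andP[ex _]|_]; last first.
  by rewrite normr0 invr_ge0 ltW.
have [pq|pq] := eqVneq p q; first by move: ex; rewrite pq ltNge xq.
have h := away p pS pq; have r0 := lt_le_trans d0 h.
rewrite normrN normrM normfV (ger0_norm (sqr_ge0 _)).
apply: (@le_trans _ _ (enorm (x - p) / enorm (x - p) ^+ 2)).
  by rewrite ler_wpM2r ?invr_ge0 ?sqr_ge0// normr_coord_le.
rewrite expr2 invfM mulrA divff ?mul1r ?gt_eqF// lef_pV2 ?posrE//.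
Qed.

Let measurable_dist p : measurable_fun setT (fun x : plane R => enorm (x - p)).
Proof. exact: measurable_enorm_sub. Qed.

Lemma measurable_dcapped_log i p eta r : measurable_fun setT (dcapped_log i p eta r).
Proof.
apply: measurable_fun_ifT => //.
  by apply: measurable_and; [apply: measurable_fun_ltr|apply: measurable_fun_ler].
apply: measurableT_comp => //; apply: measurable_funM.
  by case: i; rewrite /coord /=; apply: measurable_funB.
by apply: (measurableT_comp (@measurable_invr R)); exact: measurable_funX.
Qed.

Lemma measurable_vortex_grad eta i : measurable_fun setT (V eta i).
Proof.
apply: measurable_sum => p; apply: measurable_funM; last first.
  by apply: measurable_funM => //; exact: measurable_dcapped_log.
have mu q : measurable_fun setT
    (fun x => expR (kappa * (chi q * capped_log q eta (rho q) x))).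
  apply: (measurableT_comp (@measurable_expR R)); apply: measurable_funM => //.
  by apply: measurable_funM => //; exact: measurable_capped_log.
apply: measurable_funM => //; apply: (measurableT_comp (@measurable_invr R)).
exact: measurable_sum.
Qed.

Lemma measurable_field eta : measurable_fun setT chi ->
  measurable_fun setT (field_of chi (V eta)).
Proof.
move=> mchi; have mi : measurable_fun setT (fun x => (chi x)^-1).
  exact: (measurableT_comp (@measurable_invr R)).
apply/measurable_fun_pairP; split; rewrite /comp /field_of/=.
  by apply: measurable_funM => //; exact: measurable_vortex_grad.
by apply: measurableT_comp => //; apply: measurable_funM => //;
  exact: measurable_vortex_grad.
Qed.

End ShieldingField.

(** * The weak Lebesgue bound *)

Section LorentzBound.
Context {R : realType}.
Implicit Types (x p : plane R).

Context (S : seq (plane R)) (w : plane R -> plane R -> R) (G : plane R -> plane R).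
Context (S0 : S != [::]) (w_ge0 : forall x p, 0 <= w x p)
  (sum_w : forall x, \sum_(p <- S) w x p = 1) (mG : measurable_fun setT G)
  (G_le : forall x, enorm (G x) <= \sum_(p <- S) w x p * (2 * (enorm (x - p))^-1)).

Let near_field (t : R) p x : R :=
  if 0 < enorm (x - p) <= 2 / t then 2 * (enorm (x - p))^-1 else 0.

Let near_field_ge0 t p x : 0 <= near_field t p x.
Proof. by rewrite /near_field; case: ifP => // _; rewrite mulr_ge0 ?invr_ge0 ?enorm_ge0. Qed.

Let G_le_near t x : 0 < t -> enorm (G x) <= t + \sum_(p <- S) near_field t p x.
Proof.
move=> t0; apply: le_trans (G_le x) _.
apply: (@le_trans _ _ (\sum_(p <- S) (w x p * t + near_field t p x))); last first.
  by rewrite big_split/= -mulr_suml sum_w mul1r.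
rewrite big_seq [leRHS]big_seq; apply: ler_sum => p pS.
have w1 : w x p <= 1 by rewrite -(sum_w x); apply: (@ler_sum_mem _ _ S (w x)) => // q _.
have r0 := enorm_ge0 (x - p); rewrite /near_field.
case: ifPn => [_|].
  rewrite -[leLHS]add0r; apply: lerD; first by rewrite mulr_ge0// ltW.
  by rewrite ler_piMl// mulr_ge0// invr_ge0.
rewrite negb_and -!leNgt -ltNge addr0 => rt; rewrite ler_wpM2l//.
have {r0}[r0|r0] := eqVneq (enorm (x - p)) 0.
  by rewrite r0 invr0 mulr0 ltW.
have {}r0 : 0 < enorm (x - p) by rewrite lt_def r0 enorm_ge0.
move: rt; rewrite leNgt r0/= ltr_pdivrMr// => rt.
by rewrite ler_pdivrMr// ltW// mulrC.
Qed.

Let measurable_near t p : measurable_fun setT (near_field t p).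
Proof.
have mr : measurable_fun setT (fun x : plane R => enorm (x - p)).
  exact: measurable_enorm_sub.
apply: measurable_fun_ifT => //.
  by apply: measurable_and; [apply: measurable_fun_ltr|apply: measurable_fun_ler].
apply: measurable_funM => //.
by apply: (measurableT_comp (@measurable_invr R)).
Qed.

Let integral_near t p : 0 < t ->
  (\int[leb2 R]_x (near_field t p x)%:E <= (8 * pi / t)%:E)%E.
Proof.
move=> t0; have mr : measurable_fun setT (fun x : plane R => (enorm (x - p))^-1).
  by apply: (measurableT_comp (@measurable_invr R)); exact: measurable_enorm_sub.
have mA : measurable (annulus p 0 (2 / t)) by exact: measurable_annulus.
have -> : (\int[leb2 R]_x (near_field t p x)%:E =
    \int[leb2 R]_(x in annulus p 0 (2 / t)) (2 * (enorm (x - p))^-1)%:E)%E.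
  rewrite [RHS]integral_mkcond; apply: eq_integral => x _.
  rewrite patchE /near_field; case: ifPn => h.
    by rewrite mem_set.
  by rewrite memNset//; apply/negP.
have i0 (x : plane R) : 0 <= (enorm (x - p))^-1 by rewrite invr_ge0 enorm_ge0.
rewrite (@ge0_integral_EFinZl _ _ R (leb2 R) _ 2 _ mA _ i0 mr)//.
rewrite integral_disc_inv ?divr_gt0// -EFinM lee_fin.
by rewrite le_eqVlt; apply/orP; left; apply/eqP; ring.
Qed.

(** Weak type bound: where the average exceeds t, one of the terms 2/|x-p| does,
   and then x lies within 2/t of p; t is chosen to balance both contributions. *)
Lemma integral_vortices_le (E : set (plane R)) : measurable E ->
  (0 < leb2 R E)%E -> (leb2 R E < +oo)%E ->
  (\int[leb2 R]_(x in E) (enorm (G x))%:E <=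
   ((1 + 8 * pi) * (Num.sqrt (size S)%:R * Num.sqrt (fine (leb2 R E))))%:E)%E.
Proof.
move=> mE E0 Ey; have Efin : leb2 R E \is a fin_num by rewrite ge0_fin_numE.
have e0 : 0 < fine (leb2 R E) by rewrite fine_gt0// E0.
have n0 : 0 < (size S)%:R :> R by rewrite ltr0n; case: S S0.
set a := Num.sqrt (size S)%:R; set b := Num.sqrt (fine (leb2 R E)).
have a0 : 0 < a by rewrite sqrtr_gt0.
have b0 : 0 < b by rewrite sqrtr_gt0.
have a2 : a ^+ 2 = (size S)%:R by rewrite sqr_sqrtr// ltW.
have b2 : b ^+ 2 = fine (leb2 R E) by rewrite sqr_sqrtr// ltW.
pose t := a / b; have t0 : 0 < t by rewrite divr_gt0.
have menG : measurable_fun setT (fun x => enorm (G x)).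
  exact: (measurableT_comp (@measurable_enorm R)).
have ms : measurable_fun setT (fun x => \sum_(p <- S) near_field t p x).
  exact: measurable_sum.
have s0 x : 0 <= \sum_(p <- S) near_field t p x by exact: sumr_ge0.
have t0' (x : plane R) : 0 <= t by exact: ltW.
apply: (@le_trans _ _ (\int[leb2 R]_(x in E) (t + \sum_(p <- S) near_field t p x)%:E)%E).
  apply: ge0_le_integral => //.
  - by move=> x _; rewrite lee_fin enorm_ge0.
  - by apply/measurable_EFinP; exact: measurable_funTS.
  - by apply/measurable_EFinP; apply: measurable_funTS; exact: measurable_funD.
  - by move=> x _; rewrite lee_fin G_le_near.
rewrite (@ge0_integral_EFinD _ _ R (leb2 R) E _ _ mE t0' s0 (measurable_cst t) ms).
rewrite integral_cst//.
have hs : (\int[leb2 R]_(x in E) (\sum_(p <- S) near_field t p x)%:E <=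
    ((size S)%:R * (8 * pi / t))%:E)%E.
  apply: (@le_trans _ _ (\int[leb2 R]_x (\sum_(p <- S) (near_field t p x)%:E))%E).
    rewrite [leRHS](eq_integral (fun x => (\sum_(p <- S) near_field t p x)%:E)); last first.
      by move=> x _; rewrite sumEFin.
    apply: ge0_subset_integral => //; first exact/measurable_EFinP.
    by move=> x _; rewrite lee_fin.
  rewrite ge0_integral_sum//; last 2 first.
  - by move=> p; apply/measurable_EFinP.
  - by move=> p x _; rewrite lee_fin.
  rewrite mulrC -sum_size_const -sumEFin.
  by apply: lee_sum => p _; exact: integral_near.
apply: le_trans (leeD2l _ hs) _.
have lE : leb2 R E = (b ^+ 2)%:E by rewrite b2 fineK.
apply: (@le_trans _ _ (t%:E * (b ^+ 2)%:E + ((size S)%:R * (8 * pi / t))%:E)%E).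
  by apply: leeD2r; apply: lee_wpmul2l; [rewrite lee_fin ltW|rewrite -lE].
rewrite -EFinM -EFinD lee_fin -a2 /t.
rewrite le_eqVlt; apply/orP; left; apply/eqP.
move: (pi : R) => P; clearbody a b; field.
by rewrite !lt0r_neq0.
Qed.

Lemma lorentz_vortices_le (Omega : set (plane R)) :
  (lorentz_norm Omega G <= ((1 + 8 * pi) * Num.sqrt (size S)%:R)%:E)%E.
Proof.
have pi0 : 0 <= 1 + 8 * pi :> R by rewrite addr_ge0// mulr_ge0// pi_ge0.
apply: ub_ereal_sup => _ [->|[E [mE _ E0 Ey ->]]].
  by rewrite lee_fin mulr_ge0// sqrtr_ge0.
have e0 : 0 < fine (leb2 R E) by rewrite fine_gt0// E0.
have b0 : 0 < Num.sqrt (fine (leb2 R E)) by rewrite sqrtr_gt0.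
apply: (@le_trans _ _ ((Num.sqrt (fine (leb2 R E)))^-1%:E *
   ((1 + 8 * pi) * (Num.sqrt (size S)%:R * Num.sqrt (fine (leb2 R E))))%:E)%E).
  apply: lee_wpmul2l; first by rewrite lee_fin invr_ge0 sqrtr_ge0.
  exact: integral_vortices_le.
rewrite -EFinM lee_fin le_eqVlt; apply/orP; left; apply/eqP.
move: (Num.sqrt (fine _)) b0 (Num.sqrt _%:R) (pi : R) => b b0 a P.
by field; exact: lt0r_neq0.
Qed.

End LorentzBound.

(** * Existence of the renormalized energy *)

Section RenormalizedEnergy.
Context {R : realType} (U : set (plane R)) (chi : plane R -> R)
  (Lambda : {fset plane R}) (m : {measure set (plane R) -> \bar R})
  (j : plane R -> plane R) (M L : R).
Let Uh := enlarge U.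
Let K := supp chi.
Context (smooth_chi : smooth chi) (chi_ge0 : forall x, 0 <= chi x)
  (supp_chi : compactly_supported_in U chi)
  (M_gt0 : 0 < M) (radon_m : radon_on Uh m)
  (m_ball : forall (x : plane R) (r : R), Uh x -> 0 < r -> r < 1 ->
       (m (eball x r `&` Uh) <= (pi * M * r)%:E)%E)
  (mj : measurable_fun setT j) (int_j : loc_integrable Uh j)
  (curl_j : distr_eq Uh (curl Uh j)
      (fun phi => 2 * pi * distr_of_points Lambda phi
                  - distr_of_measure Uh m phi))
  (dchi_le : forall i x, `|partial i chi x| <= L).

Let mUh : measurable Uh := measurable_enlarge U.
Let cK : compact K := supp_chi.1.
Let KUh : K `<=` Uh.
Proof. by apply: subset_trans supp_chi.2 _; exact: sub_enlarge. Qed.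
Let mK : measurable K.
Proof. by apply: closed_measurable_plane; exact: closed_closure. Qed.
Let L_ge0 : 0 <= L.
Proof. by apply: le_trans (dchi_le true 0). Qed.
Let mchi : measurable_fun setT chi.
Proof. by apply: continuous_measurable_plane; exact: smooth_continuous. Qed.
Let chi_lip x y : `|chi x - chi y| <= 2 * L * enorm (x - y).
Proof. exact: grad_lipschitz. Qed.
Let chiK x : 0 < chi x -> K x.
Proof. by move=> c0; apply: subset_closure => /=; rewrite gt_eqF. Qed.

Lemma measurable_enormj : measurable_fun setT (fun x => enorm (j x)).
Proof. exact: (measurableT_comp (@measurable_enorm R)). Qed.

Lemma integral_j_fin : (\int[leb2 R]_(x in K) (enorm (j x))%:E < +oo)%E.
Proof. exact: int_j.2. Qed.

Lemma measurable_dot_grad (V : bool -> plane R -> R) :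
  (forall i, measurable_fun setT (V i)) ->
  measurable_fun setT (fun x => dot (j x) (perp_grad V x)).
Proof.
move=> mV; rewrite /dot /perp_grad/=; apply: measurable_funD; apply: measurable_funM => //.
- by apply: (measurableT_comp (@measurable_fst _ _ _ _)).
- by apply: (measurableT_comp (@measurable_snd _ _ _ _)).
- exact: measurableT_comp.
Qed.

Lemma integrable_j_bounded (f : plane R -> R) (B : R) : 0 <= B ->
  measurable_fun setT f ->
  (forall x, `|f x| <= B * enorm (j x)) -> (forall x, ~ K x -> f x = 0) ->
  (leb2 R).-integrable setT (EFin \o f).
Proof.
move=> B0 mf fB f0.
have -> : EFin \o f = (EFin \o f) \_ K.
  apply/funext => x; rewrite patchE; case: ifPn => // /negP; rewrite inE => nK.
  by rewrite /= f0.
apply: (integrable_mkcond (EFin \o f) mK).1; apply/integrableP; split.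
  by apply/measurable_EFinP; exact: measurable_funTS.
apply: (@le_lt_trans _ _ (\int[leb2 R]_(x in K) (B%:E * (enorm (j x))%:E))%E).
  apply: ge0_le_integral => //.
  - by apply: measurableT_comp => //; apply/measurable_EFinP; exact: measurable_funTS.
  - apply/measurable_EFinP; apply: measurable_funM => //.
    by apply: measurable_funTS; exact: measurable_enormj.
  - by move=> x _ /=; rewrite -EFinM lee_fin.
rewrite ge0_integralZl_EFin//.
- by rewrite lte_mul_pinfty// integral_j_fin.
- by move=> x _; rewrite lee_fin enorm_ge0.
- by apply/measurable_EFinP; apply: measurable_funTS; exact: measurable_enormj.
Qed.

(** The tested equation, with the two integrals gathered and extended to the
   whole plane, which is harmless as V vanishes off the support of chi. *)
Lemma curl_pairing_dot tau V (B : R) : curl_pairing U Lambda m j tau V ->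
  (forall i x, `|V i x| <= B) -> (forall i x, ~ K x -> V i x = 0) ->
  (leb2 R).-integrable setT (EFin \o (fun x => dot (j x) (perp_grad V x))) /\
  \int[leb2 R]_x dot (j x) (perp_grad V x) =
  2 * pi * \sum_(p <- Lambda) tau p - \int[m]_(x in Uh) tau x.
Proof.
move=> [mtau mV idV] VB V0.
have B0 : 0 <= B by apply: le_trans (VB true 0).
have i1 : (leb2 R).-integrable setT (EFin \o (fun x => (j x).1 * V true x)).
  apply: (@integrable_j_bounded _ B) => //.
  - apply: measurable_funM => //.
    by apply: (measurableT_comp (@measurable_fst _ _ _ _)).
  - by move=> x; rewrite normrM mulrC ler_pM// normr_fst_le.
  - by move=> x nK; rewrite V0// mulr0.
have i2 : (leb2 R).-integrable setT (EFin \o (fun x => (j x).2 * V false x)).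
  apply: (@integrable_j_bounded _ B) => //.
  - apply: measurable_funM => //.
    by apply: (measurableT_comp (@measurable_snd _ _ _ _)).
  - by move=> x; rewrite normrM mulrC ler_pM// normr_snd_le.
  - by move=> x nK; rewrite V0// mulr0.
have dE : (fun x => dot (j x) (perp_grad V x)) =
    (fun x => (j x).1 * V true x - (j x).2 * V false x).
  by apply/funext => x; rewrite /dot /perp_grad/= mulrN.
have res (f : plane R -> R) : (forall x, ~ K x -> f x = 0) ->
    \int[leb2 R]_x f x = \int[leb2 R]_(x in Uh) f x.
  move=> f0; rewrite [RHS]Rintegral_mkcond; apply: eq_Rintegral => x _.
  rewrite patchE; case: ifPn => // /negP; rewrite inE => nU.
  by apply: f0 => /KUh.
split.
  rewrite dE (_ : EFin \o _ = ((EFin \o (fun x => ((j x).1 * V true x)%R)) \-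
    (EFin \o (fun x => ((j x).2 * V false x)%R)))%E)//.
  exact: integrableB.
rewrite dE RintegralB// -idV opprK addrC.
by congr (- _ + _); apply: res => x nK; rewrite V0// mulr0.
Qed.

Definition energy (D : set (plane R)) : \bar R :=
  (\int[leb2 R]_(x in D) (chi x * enorm (j x) ^+ 2)%:E)%E.

Definition mass_j eta : R :=
  fine (\int[leb2 R]_(x in K `&` balls Lambda eta) (enorm (j x))%:E)%E.

Lemma mass_jE eta :
  (mass_j eta)%:E = (\int[leb2 R]_(x in K `&` balls Lambda eta) (enorm (j x))%:E)%E.
Proof.
rewrite /mass_j fineK// ge0_fin_numE; last first.
  by apply: integral_ge0 => x _; rewrite lee_fin enorm_ge0.
apply: le_lt_trans integral_j_fin; apply: ge0_subset_integral => //.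
- by apply: measurableI => //; exact: measurable_balls.
- by apply/measurable_EFinP; apply: measurable_funTS; exact: measurable_enormj.
- by move=> x _; rewrite lee_fin enorm_ge0.
Qed.

Lemma mass_j_ge0 eta : 0 <= mass_j eta.
Proof. by apply: fine_ge0; apply: integral_ge0 => x _; rewrite lee_fin enorm_ge0. Qed.

Lemma mass_j_small (e : R) : 0 < e ->
  exists2 d : R, 0 < d & forall eta, eta <= d -> mass_j eta <= e.
Proof.
move=> e0; have [d d0 hd] := @integral_balls_small R Lambda (fun x => enorm (j x))
  K e mK measurable_enormj (fun x => enorm_ge0 _) integral_j_fin e0.
by exists d => // eta ed; rewrite -lee_fin mass_jE hd.
Qed.

Lemma measurable_energy_density :
  measurable_fun setT (fun x => (chi x * enorm (j x) ^+ 2)%:E).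
Proof.
apply/measurable_EFinP; apply: measurable_funM => //.
by apply: measurable_funX; exact: measurable_enormj.
Qed.

Lemma energy_density_ge0 x : 0 <= chi x * enorm (j x) ^+ 2.
Proof. by rewrite mulr_ge0// sqr_ge0. Qed.

Lemma Rintegral_capped_log p (c eta rho : R) : Uh p -> 0 <= c -> 0 < eta ->
  eta < rho -> 2 * rho < 1 ->
  \int[m]_(x in Uh) (c * capped_log p eta rho x) <= c * (4 * pi * M * rho).
Proof.
move=> Up c0 e0 er r1.
have cap0 x : 0 <= capped_log p eta rho x by exact: capped_log_ge0.
have h := integral_capped_log mUh m_ball Up M_gt0 e0 er r1.
have : (\int[m]_(x in Uh) (c * capped_log p eta rho x)%:E <=
    (c * (4 * pi * M * rho))%:E)%E.
  rewrite ge0_integral_EFinZl//; last exact: measurable_capped_log.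
  by rewrite [leRHS]EFinM; apply: lee_wpmul2l; rewrite ?lee_fin.
have h0 : (0 <= \int[m]_(x in Uh) (c * capped_log p eta rho x)%:E)%E.
  by apply: integral_ge0 => x _; rewrite lee_fin mulr_ge0.
move=> le; rewrite /Rintegral -lee_fin fineK//.
by rewrite ge0_fin_numE//; apply: le_lt_trans le _; rewrite ltry.
Qed.

Let annulus_arith (c l eta H G : R) :
  2 * pi * (c * l) - c * (4 * pi * M * eta) <= H ->
  G <= 2 * pi * c * l + 8 * pi * L * eta ->
  pi * c * l - (c * (4 * pi * M * eta) + 4 * pi * L * eta) <= 2^-1 * (2 * H - G).
Proof. lra. Qed.

(** The square of the distance of j to the field of a single vortex is nonnegative
   on the annulus, and the cross term is a circulation of j, known from the tested
   equation. The defect stems from m and from the variation of chi. *)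
Lemma energy_annulus_ge p (eta eta' : R) : p \in Lambda -> 0 < chi p ->
  0 < eta' -> eta' < eta -> 2 * eta < 1 -> 4 * L * eta <= chi p ->
  ((pi * chi p * ln (eta / eta') -
    (chi p * (4 * pi * M * eta) + 4 * pi * L * eta))%:E <=
   (2^-1)%:E * energy (annulus p eta' eta))%E.
Proof.
move=> pL cp0 e'0 ee e1 eL.
have Up : Uh p by apply: KUh; exact: chiK.
have small q : q \in [:: p] -> 0 < chi q /\ 4 * L * eta <= chi q.
  by rewrite inE => /eqP ->.
pose V := vortex_grad [:: p] chi (fun=> eta) eta' 1.
pose tau x := chi p * capped_log p eta' eta x.
have pairing : curl_pairing U Lambda m j tau V.
  have -> : tau = vortex_pot [:: p] chi (fun=> eta) eta' 1.
    by apply/funext => x; rewrite /vortex_pot softmax1.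
  apply: (@vortex_pairing R U chi Lambda m j smooth_chi chi_ge0 supp_chi radon_m
    int_j curl_j _ _ _ _ _ (chi p / 2)) => //; first by rewrite divr_gt0.
  move=> q x; rewrite inE => /eqP -> xp.
  by have [] := chi_near L_ge0 chi_lip small (mem_head p [::]) xp.
have [_ mV _] := pairing.
have V0 i x : chi x = 0 -> V i x = 0.
  exact: (vortex_grad_supp 1 L_ge0 chi_lip small).
have [B _ VB] := @vortex_grad_bound R [:: p] chi (fun=> eta) eta' 1 e'0 chi_ge0.
have [ih hE] := curl_pairing_dot pairing VB (fun i x nK => V0 i x (not_supp0 nK)).
pose h x := dot (j x) (perp_grad V x); rewrite -/h in ih hE.
pose g x := enorm (perp_grad V x) ^+ 2 / chi x.
have g0 x : 0 <= g x by rewrite divr_ge0// sqr_ge0.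
have mg : measurable_fun setT g by exact: measurable_grad_density.
have gT : (\int[leb2 R]_x (g x)%:E <=
    (2 * pi * chi p * ln (eta / eta') + 8 * pi * L * eta)%:E)%E.
  have := integral_grad_density chi_ge0 L_ge0 chi_lip (isT : [:: p] != [::]) small
    mchi mV e'0 (fun=> ee).
  by rewrite big_seq1.
have ig : (leb2 R).-integrable setT (EFin \o g).
  apply/integrableP; split; first exact/measurable_EFinP.
  rewrite (_ : (fun x => _) = (fun x => (g x)%:E)).
    by apply: le_lt_trans gT _; rewrite ltry.
  by apply/funext => x /=; rewrite ger0_norm.
have hT : 2 * pi * (chi p * ln (eta / eta')) - chi p * (4 * pi * M * eta) <=
    \int[leb2 R]_x h x.
  rewrite hE; apply: lerB; last exact: Rintegral_capped_log (ltW cp0) _ _ _.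
  rewrite ler_wpM2l ?mulr_ge0 ?pi_ge0// -(@capped_log_center _ p eta' eta e'0).
  apply: (@ler_sum_mem _ _ _ tau) => // q _.
  by rewrite mulr_ge0// capped_log_ge0.
have gR : \int[leb2 R]_x g x <=
    2 * pi * chi p * ln (eta / eta') + 8 * pi * L * eta.
  by rewrite -lee_fin /Rintegral fineK//; exact: integrable_fin_num.
have i2h : (leb2 R).-integrable setT (EFin \o (fun x => 2 * h x)).
  exact: (integrableZl measurableT 2 ih).
have ihg : (leb2 R).-integrable setT (EFin \o (fun x => 2 * h x - g x)).
  exact: (integrableB measurableT i2h ig).
have mA : measurable (annulus p eta' eta) by exact: measurable_annulus.
have VA i x : ~ annulus p eta' eta x -> V i x = 0.
  move=> nA; rewrite /V /vortex_grad big_seq1 /dcapped_log ifF ?mulr0//.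
  exact/negP.
have le : (\int[leb2 R]_x (2 * h x - g x)%:E <= energy (annulus p eta' eta))%E.
  have -> : (\int[leb2 R]_x (2 * h x - g x)%:E =
      \int[leb2 R]_(x in annulus p eta' eta) (2 * h x - g x)%:E)%E.
    rewrite [RHS]integral_mkcond; apply: eq_integral => x _.
    rewrite patchE; case: ifPn => // /negP; rewrite inE => nA.
    rewrite /g /h /dot sqr_enorm_perp_grad /perp_grad !VA//=.
    by rewrite expr0n/= oppr0 !mulr0 !addr0 mulr0 mul0r subr0.
  apply: le_integral_ge0 => //.
  - by apply: measurable_funTS; exact: measurable_int ihg.
  - by apply: measurable_funTS; exact: measurable_energy_density.
  - by move=> x _; rewrite lee_fin energy_density_ge0.
  - move=> x _; rewrite lee_fin -subr_ge0 -completed_square; last first.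
      by move=> x0 i; exact: V0.
    by rewrite mulr_ge0// sqr_ge0.
apply: le_trans (lee_wpmul2l _ le); last by rewrite lee_fin.
have -> : (\int[leb2 R]_x (2 * h x - g x)%:E =
    (2 * \int[leb2 R]_x h x - \int[leb2 R]_x g x)%:E)%E.
  rewrite -RintegralZl// -RintegralB//.
  by rewrite /Rintegral fineK//; exact: integrable_fin_num.
rewrite -EFinM lee_fin; apply: annulus_arith hT gR.
Qed.

Definition energy_defect eta : R :=
  \sum_(p <- Lambda) (chi p * (4 * pi * M * eta) + 4 * pi * L * eta).

Lemma energy_ge0 A : (0 <= energy A)%E.
Proof. by apply: integral_ge0 => x _; rewrite lee_fin energy_density_ge0. Qed.

Lemma energy_bigcup (s : seq (plane R)) (F : plane R -> set (plane R)) : uniq s ->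
  (forall p, measurable (F p)) -> trivIset [set` s] F ->
  energy (\big[setU/set0]_(p <- s) F p) = (\sum_(p <- s) energy (F p))%E.
Proof.
move=> us mF tF; rewrite /energy ge0_integral_bigsetU//.
  by apply: measurable_funTS; exact: measurable_energy_density.
by move=> x _; rewrite lee_fin energy_density_ge0.
Qed.

(* The balls of radius eta are disjoint, and small compared with the scales of
   the weight at the points where it does not vanish. *)
Definition admissible_radius eta := [/\ 0 < eta, 2 * eta < 1,
  forall p q, p \in Lambda -> q \in Lambda -> p != q -> 2 * eta < enorm (p - q) &
  forall p, p \in Lambda -> 0 < chi p -> 4 * L * eta <= chi p].

Lemma admissible_radius_le eta eta' : 0 < eta' -> eta' <= eta ->
  admissible_radius eta -> admissible_radius eta'.
Proof.
move=> e0 ee [_ h1 h2 h3]; split => //.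
- by apply: le_lt_trans h1; rewrite ler_pM2l.
- by move=> p q pL qL pq; apply: le_lt_trans (h2 p q pL qL pq); rewrite ler_pM2l.
- by move=> p pL cp; apply: le_trans (h3 p pL cp); rewrite ler_wpM2l// mulr_ge0.
Qed.

Lemma exists_admissible_radius : exists eta, admissible_radius eta.
Proof.
have [d1 d10 h1] : exists2 d : R, 0 < d & forall z, z \in
    [seq (p, q) | p <- Lambda, q <- Lambda] ->
    d <= (if z.1 != z.2 then enorm (z.1 - z.2) else 1).
  apply: seq_pos_min => -[p q] _ /=; case: ifPn => // pq.
  by rewrite lt_def enorm_ge0 andbT enorm_eq0 subr_eq0.
have [d2 d20 h2] : exists2 d : R, 0 < d & forall p, p \in enum_fset Lambda ->
    d <= (if 0 < chi p then chi p / (4 * (L + 1)) else 1).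
  apply: seq_pos_min => p _; case: ifPn => // cp.
  by rewrite divr_gt0// mulr_gt0// ltr_wpDl.
pose d := Num.min 1 (Num.min d1 d2).
have d0 : 0 < d by rewrite !lt_min d10 d20 ltr01.
have [dle1 dled1 dled2] : [/\ d <= 1, d <= d1 & d <= d2].
  by split; rewrite /d !ge_min lexx ?orbT.
exists (d / 4); split => //; first by rewrite divr_gt0.
- by lra.
- move=> p q pL qL pq; have /= := h1 (p, q); rewrite pq => h.
  have {}h : d1 <= enorm (p - q).
    by apply: h; apply/allpairsP; exists (p, q).
  by lra.
- move=> p pL cp; have := h2 p pL; rewrite cp => h.
  have : d * (4 * (L + 1)) <= chi p.
    by rewrite -ler_pdivlMr ?mulr_gt0 ?ltr_wpDl// (le_trans dled2).
  have : L * d <= (L + 1) * d by rewrite ler_pM2r// lerDl.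
  by lra.
Qed.

Lemma notin_balls_sub eta eta' : eta' <= eta ->
  ~` balls Lambda eta `<=` ~` balls Lambda eta'.
Proof. by move=> ee; apply: subsetC; exact: sub_balls. Qed.

Lemma enorm_sub_le (p q x : plane R) : enorm (p - q) <= enorm (x - p) + enorm (x - q).
Proof.
rewrite (_ : p - q = (x - q) - (x - p)); last by rewrite opprB [RHS]addrC addrA subrK.
by apply: le_trans (ler_enormD _ _) _; rewrite enormN addrC.
Qed.

Lemma annulus_disjoint eta eta' : admissible_radius eta ->
  trivIset [set` Lambda] (fun p => annulus p eta' eta).
Proof.
move=> [e0 _ h _] p q pL qL [x [/andP[_ xp] /andP[_ xq]]].
apply/eqP; apply: contraT => pq.
have := enorm_sub_le p q x; have := h _ _ pL qL pq; lra.
Qed.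

Lemma annuli_sub eta eta' p : admissible_radius eta -> eta' < eta ->
  p \in Lambda -> annulus p eta' eta `<=` ~` balls Lambda eta'.
Proof.
move=> [e0 _ h _] ee pL x /andP[xp xp'] [q qL /= xq].
have [pq|pq] := eqVneq p q; first by move: xq; rewrite /ecball/= -pq leNgt xp.
have := enorm_sub_le p q x; have := h _ _ pL qL pq.
by move: xq; rewrite /ecball/=; lra.
Qed.

Lemma energy_split eta eta' : admissible_radius eta -> eta' < eta ->
  (energy (~` balls Lambda eta) + \sum_(p <- Lambda) energy (annulus p eta' eta) <=
   energy (~` balls Lambda eta'))%E.
Proof.
move=> adm ee; have mA p : measurable (annulus p eta' eta) by exact: measurable_annulus.
have mB e : measurable (~` balls Lambda e).
  by apply: measurableC; exact: measurable_balls.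
rewrite -energy_bigcup ?fset_uniq//; last exact: annulus_disjoint.
have mBA : measurable (\big[setU/set0]_(p <- Lambda) annulus p eta' eta).
  exact: bigsetU_measurable.
rewrite /energy -ge0_integral_setU//.
- apply: ge0_subset_integral => //.
  + exact: measurableU.
  + by apply: measurable_funTS; exact: measurable_energy_density.
  + by move=> x _; rewrite lee_fin energy_density_ge0.
  + move=> x [|]; first exact/notin_balls_sub/ltW.
    rewrite -bigcup_seq => -[p pL]; exact: annuli_sub.
- by apply: measurable_funTS; exact: measurable_energy_density.
- by move=> x _; rewrite lee_fin energy_density_ge0.
- rewrite disj_set2E; apply/eqP/seteqP; split => // x [nx].
  by rewrite -bigcup_seq => -[p pL /andP[_ xp]]; apply: nx; exists p.
Qed.

Lemma truncated_energyE eta : truncated_energy Lambda j chi eta =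
  ((2^-1)%:E * energy (~` balls Lambda eta) +
   (pi * ln eta * \sum_(p <- Lambda) chi p)%:E)%E.
Proof. by []. Qed.

(** Shrinking the removed discs can lower the truncated energy only by a defect
   that vanishes with the larger radius; this is why the limit exists. *)
Lemma truncated_energy_almost_mono eta eta' : admissible_radius eta ->
  0 < eta' -> eta' < eta ->
  (truncated_energy Lambda j chi eta <=
   truncated_energy Lambda j chi eta' + (energy_defect eta)%:E)%E.
Proof.
move=> adm e0' ee; have [e0 e1 _ eL] := adm.
rewrite !truncated_energyE.
have ann p : p \in Lambda -> ((pi * chi p * ln (eta / eta') -
    (chi p * (4 * pi * M * eta) + 4 * pi * L * eta))%:E <=
     (2^-1)%:E * energy (annulus p eta' eta))%E.
  move=> pL; have := chi_ge0 p; rewrite le_eqVlt => /predU1P[cp|cp].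
    rewrite -cp mulr0 !mul0r sub0r add0r.
    apply: (@le_trans _ _ 0%E); last by rewrite mule_ge0// energy_ge0.
    by rewrite lee_fin oppr_le0 ?(mulr_ge0, pi_ge0, ltW e0).
  by apply: energy_annulus_ge => //; exact: eL.
have ann_sum : ((pi * (ln eta - ln eta') * (\sum_(p <- Lambda) chi p) -
    energy_defect eta)%:E <=
    (2^-1)%:E * \sum_(p <- Lambda) energy (annulus p eta' eta))%E.
  rewrite ge0_sume_distrr; last by move=> p _; exact: energy_ge0.
  rewrite /energy_defect mulr_sumr -sumrB -sumEFin big_seq [leRHS]big_seq.
  apply: lee_sum => p pL; apply: le_trans (ann p pL).
  rewrite lee_fin ln_div ?posrE//.
  by rewrite (_ : pi * (ln eta - ln eta') * chi p = pi * chi p * (ln eta - ln eta'))//; ring.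
have := energy_split adm ee.
move=> /(lee_wpmul2l (_ : 0 <= (2^-1)%:E)%E); rewrite lee_fin invr_ge0 ler0n => /(_ isT) h.
rewrite muleDr// in h; last by rewrite ge0_adde_def// inE ?energy_ge0// sume_ge0// => *; exact: energy_ge0.
have {}h := le_trans (leeD2l _ ann_sum) h.
apply: le_trans (leeD2r _ (leeD2r _ h)).
rewrite -!addeA -!EFinD leeD2l// lee_fin; lra.
Qed.

Lemma energy_defect_small (e : R) : 0 < e ->
  exists2 d : R, 0 < d & forall eta, 0 < eta -> eta <= d -> energy_defect eta <= e.
Proof.
move=> e0; pose N : R := (size Lambda)%:R.
pose A := 4 * pi * M * (\sum_(p <- Lambda) chi p) + N * (4 * pi * L).
have A0 : 0 <= A.
  by rewrite addr_ge0 ?mulr_ge0 ?pi_ge0 ?(ltW M_gt0)// sumr_ge0.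
exists (e / (A + 1)); first by rewrite divr_gt0// ltr_wpDl.
move=> eta eta0; rewrite ler_pdivlMr ?ltr_wpDl// => ee.
have -> : energy_defect eta = A * eta.
  have cst (k : R) : \sum_(p <- Lambda) k = N * k.
    by rewrite big_const_seq count_predT iter_addr_0 mulr_natl.
  by rewrite /energy_defect big_split/= -mulr_suml cst /A; ring.
lra.
Qed.

Lemma truncated_energy_gtNy eta : (-oo < truncated_energy Lambda j chi eta)%E.
Proof.
rewrite truncated_energyE; apply: lt_le_trans (ltNyr _) (leeDr _ _).
by rewrite mule_ge0// energy_ge0.
Qed.

(** Almost monotonicity makes the truncated energies converge to this supremum,
   finite or not; it cannot be -oo because no truncated energy is. *)
Lemma renormalized_energyE eta0 : admissible_radius eta0 ->
  renormalized_energy Lambda j chi =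
  ereal_sup [set (truncated_energy Lambda j chi eta - (energy_defect eta)%:E)%E |
             eta in [set eta | 0 < eta <= eta0]].
Proof.
move=> adm; have [eta0_gt0 _ _ _] := adm.
set W := ereal_sup _.
have Wge eta : 0 < eta -> eta <= eta0 ->
    (truncated_energy Lambda j chi eta <= W + (energy_defect eta)%:E)%E.
  move=> e0 ee; rewrite -leeBlDr//.
  by apply: ereal_sup_ubound; exists eta => //=; rewrite e0.
have later (A : R) : (A%:E < W)%E -> \forall eta \near 0^'+,
    (A%:E <= truncated_energy Lambda j chi eta)%E.
  move=> /ereal_sup_gt[_ [e1 /= /andP[e10 e1e] <-] h].
  near=> eta; apply: le_trans (ltW h) _; rewrite EFinN leeBlDr//.
  apply: truncated_energy_almost_mono.
  - exact: admissible_radius_le e1e adm.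
  - by near: eta; exact: nbhs_right_gt.
  - by near: eta; exact: nbhs_right_lt.
apply: cvg_lim => //.
case WE : W => [w| |].
- have up (e : R) : 0 < e -> \forall eta \near 0^'+,
      (truncated_energy Lambda j chi eta <= (w + e)%:E)%E.
    move=> /energy_defect_small[d d0 hd]; near=> eta.
    have eta_gt0 : 0 < eta by near: eta; exact: nbhs_right_gt.
    have ee : eta <= eta0 by near: eta; exact: nbhs_right_le.
    apply: le_trans (Wge _ eta_gt0 ee) _; rewrite WE -EFinD lee_fin lerD2l.
    by apply: hd => //; near: eta; exact: nbhs_right_le.
  apply/fine_cvgP; split.
    near=> eta; rewrite fin_numElt truncated_energy_gtNy/=.
    apply: (@le_lt_trans _ _ (w + 1)%:E); last exact: ltry.
    by near: eta; exact: up.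
  apply/cvgrPdist_le => e e0; near=> eta.
  have h1 : (truncated_energy Lambda j chi eta <= (w + e)%:E)%E.
    by near: eta; exact: up.
  have h2 : ((w - e)%:E <= truncated_energy Lambda j chi eta)%E.
    by near: eta; apply: later; rewrite WE lte_fin ltrBlDr ltrDl.
  have fT : truncated_energy Lambda j chi eta \is a fin_num.
    by rewrite fin_numElt truncated_energy_gtNy (le_lt_trans h1)// ltry.
  move: h1 h2; rewrite /comp -(fineK fT) !lee_fin => h1 h2.
  by rewrite distrC ler_distlC; apply/andP; split; lra.
- by apply/cvgeyPge => A; apply: later; rewrite WE ltry.
- exfalso; have := Wge eta0 eta0_gt0 (lexx _); rewrite WE /= => h.
  by have := lt_le_trans (truncated_energy_gtNy eta0) h; rewrite ltxx.
Unshelve. all: end_near.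
Qed.

(** The renormalized energy enters the estimates through this bound only. *)
Lemma truncated_energy_le eta : admissible_radius eta ->
  (truncated_energy Lambda j chi eta <=
   renormalized_energy Lambda j chi + (energy_defect eta)%:E)%E.
Proof.
move=> adm; rewrite (renormalized_energyE adm) -leeBlDr//.
by apply: ereal_sup_ubound; exists eta => //=; have [->] := adm; rewrite lexx.
Qed.

Lemma renormalized_energy_gtNy : (-oo < renormalized_energy Lambda j chi)%E.
Proof.
have [eta adm] := exists_admissible_radius.
have := lt_le_trans (truncated_energy_gtNy eta) (truncated_energy_le adm).
by move: (renormalized_energy Lambda j chi) => [r| |] //= _; rewrite ltNyr.
Qed.

(** * The energy left after subtracting the field *)

Context (X : R) (chi_le : forall x, chi x <= X).

Definition charges : seq (plane R) := [seq p <- Lambda | 0 < chi p].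

(** The scale on which chi varies little about p. The value 1 off the charges keeps
   all the radii above eta, whatever the point. *)
Definition core_radius p : R :=
  if p \in charges then chi p / (8 * (X + L)) else 1.

(** The loss ln (size S) / kappa of the soft maximum is then at most X + L; the
   added 1 keeps the stiffness positive for a single charge. *)
Definition stiffness : R := (ln (size charges)%:R + 1) / (X + L).

Definition shield : plane R -> plane R :=
  field_of chi (vortex_grad charges chi core_radius 0 stiffness).

Lemma measurable_shield : measurable_fun setT shield.
Proof. exact: measurable_field. Qed.

Let mem_charges p : (p \in charges) = (0 < chi p) && (p \in Lambda).
Proof. by rewrite mem_filter. Qed.

Section Charged.
Context (charged : charges != [::]).

Let lam_gt0 : 0 < X + L.
Proof.
have [p pS] : exists p, p \in charges.
  by case: charges charged => // p s _; exists p; rewrite mem_head.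
have := pS; rewrite mem_charges => /andP[cp _].
by rewrite ltr_pwDl// (lt_le_trans cp).
Qed.

Let X_ge0 : 0 <= X.
Proof. exact: le_trans (chi_ge0 0) (chi_le 0). Qed.

Let radiusE p : p \in charges -> core_radius p * (8 * (X + L)) = chi p.
Proof. by move=> pS; rewrite /core_radius pS divfK// mulf_neq0// gt_eqF. Qed.

Let radius_gt0 p : 0 < core_radius p.
Proof.
rewrite /core_radius; case: ifPn => //; rewrite mem_charges => /andP[cp _].
by rewrite divr_gt0// mulr_gt0.
Qed.

Let radius_le p : p \in charges -> 8 * core_radius p <= 1.
Proof.
move=> pS; have := radiusE pS; have := chi_le p; have := radius_gt0 p.
move: (core_radius p) => r r0 cX rE.
rewrite -(ler_pM2r lam_gt0) mul1r (_ : 8 * r * (X + L) = chi p); last by rewrite -rE; ring.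
by have := L_ge0; lra.
Qed.

Let radius_small p : p \in charges -> 0 < chi p /\ 4 * L * core_radius p <= chi p.
Proof.
move=> pS; have := pS; rewrite mem_charges => /andP[cp _]; split => //.
have := radiusE pS; have := radius_gt0 p.
move: (core_radius p) => r r0 <-.
have : 0 <= r * L by rewrite mulr_ge0// ltW.
have : 0 <= r * X by rewrite mulr_ge0// ltW.
lra.
Qed.

Let stiffness_gt0 : 0 < stiffness.
Proof.
rewrite divr_gt0// ltr_wpDl// ln_ge0// ler1n.
by case: charges charged.
Qed.

Let softness : ln (size charges)%:R / stiffness <= X + L.
Proof.
have h : 0 <= ln (size charges)%:R :> R.
  by rewrite ln_ge0// ler1n; case: charges charged.
rewrite ler_pdivrMr// /stiffness mulrCA divff ?gt_eqF// mulr1; lra.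
Qed.

Section Truncated.
Context (eta0 eta : R) (adm : admissible_radius eta0) (eta_gt0 : 0 < eta)
  (eta_le : eta <= eta0) (eta_lt : forall p, eta < core_radius p).

Local Notation tau := (vortex_pot charges chi core_radius eta stiffness).
Local Notation V := (vortex_grad charges chi core_radius eta stiffness).
Let D := ~` balls Lambda eta.

Let mB : measurable (balls Lambda eta).
Proof. exact: measurable_balls. Qed.
Let mD : measurable D.
Proof. exact: measurableC. Qed.

Let pairing : curl_pairing U Lambda m j tau V.
Proof.
have [c0 c00 hc0] : exists2 c0 : R, 0 < c0 & forall p, p \in charges -> c0 <= chi p / 2.
  by apply: seq_pos_min => p; rewrite mem_charges => /andP[cp _]; rewrite divr_gt0.
apply: (@vortex_pairing R U chi Lambda m j smooth_chi chi_ge0 supp_chi radon_m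
    int_j curl_j charges chi core_radius eta stiffness c0) => //.
move=> p x pS xp; apply: le_trans (hc0 p pS) _.
by have [] := chi_near L_ge0 chi_lip radius_small pS xp.
Qed.

Let mV i : measurable_fun setT (V i).
Proof. by case: pairing => _ + _; exact. Qed.

Let V_out i x : ~ K x -> V i x = 0.
Proof.
move=> nK; apply: (vortex_grad_supp stiffness L_ge0 chi_lip radius_small).
exact: not_supp0 nK.
Qed.

Let h x : R := dot (j x) (perp_grad V x).

Let h_pairing : (leb2 R).-integrable setT (EFin \o h) /\
  \int[leb2 R]_x h x = 2 * pi * \sum_(p <- Lambda) tau p - \int[m]_(x in Uh) tau x.
Proof.
have [B B0 VB] := @vortex_grad_bound R charges chi core_radius eta stiffness
  eta_gt0 chi_ge0.
exact: (curl_pairing_dot pairing VB V_out).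
Qed.

Let tau_charges :
  \sum_(p <- charges) (chi p * ln (core_radius p / eta) - (X + L)) <=
  \sum_(p <- Lambda) tau p.
Proof.
have tau0 x : 0 <= tau x by exact: vortex_pot_ge0.
apply: (@le_trans _ _ (\sum_(p <- charges) tau p)); last first.
  rewrite big_filter big_mkcond/=; apply: ler_sum => p _.
  by case: ifP.
rewrite big_seq [leRHS]big_seq; apply: ler_sum => p pS.
apply: le_trans (softmax_ge _ stiffness_gt0 pS).
by rewrite capped_log_center// lerB.
Qed.

Let tau_measure :
  \int[m]_(x in Uh) tau x <= \sum_(p <- charges) chi p * (4 * pi * M * core_radius p).
Proof.
have mtau : measurable_fun setT tau by case: pairing.
have cap0 p x : 0 <= capped_log p eta (core_radius p) x by exact: capped_log_ge0.
have mcap p : measurable_fun setT (capped_log p eta (core_radius p)).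
  exact: measurable_capped_log.
have : (\int[m]_(x in Uh) (tau x)%:E <=
    (\sum_(p <- charges) chi p * (4 * pi * M * core_radius p))%:E)%E.
  apply: (@le_trans _ _ (\int[m]_(x in Uh)
      (\sum_(p <- charges) (chi p * capped_log p eta (core_radius p) x)%:E))%E).
    apply: ge0_le_integral => //.
    - by move=> x _; rewrite lee_fin; exact: vortex_pot_ge0.
    - by apply/measurable_EFinP; exact: measurable_funTS.
    - apply: emeasurable_sum => p; apply/measurable_EFinP; apply: measurable_funTS.
      exact: measurable_funM.
    - by move=> x _; rewrite sumEFin lee_fin; exact: vortex_pot_le.
  rewrite ge0_integral_sum//; last 2 first.
  - move=> p; apply/measurable_EFinP; apply: measurable_funTS.
    exact: measurable_funM.
  - by move=> p x _; rewrite lee_fin mulr_ge0.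
  rewrite -sumEFin big_seq [leRHS]big_seq; apply: lee_sum => p pS.
  rewrite ge0_integral_EFinZl// [leRHS]EFinM; apply: lee_wpmul2l; first by rewrite lee_fin.
  apply: (integral_capped_log mUh m_ball) => //.
    by apply: KUh; apply: chiK; move: pS; rewrite mem_charges => /andP[].
  by have := radius_le pS; have := radius_gt0 p; lra.
have t0 : (0 <= \int[m]_(x in Uh) (tau x)%:E)%E.
  by apply: integral_ge0 => x _; rewrite lee_fin; exact: vortex_pot_ge0.
move=> le; rewrite /Rintegral -lee_fin fineK//.
by rewrite ge0_fin_numE//; apply: le_lt_trans le _; rewrite ltry.
Qed.

Let B0 : R := \sum_(p <- charges) chi p / eta0.

Let h_core x : balls Lambda eta x -> `|h x| <= 2 * B0 * enorm (j x).
Proof.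
have [eta0_gt0 _ sep _] := adm.
move=> [q qL xq]; have Vb i : `|V i x| <= B0.
  apply: (vortex_grad_core core_radius stiffness chi_ge0 i eta0_gt0 xq) => p.
  rewrite mem_charges => /andP[_ pL] pq.
  have := sep p q pL qL pq; have := enorm_sub_le p q x.
  by move: xq eta_le; rewrite /ecball/=; lra.
rewrite /h /dot /perp_grad/=; apply: le_trans (ler_normD _ _) _.
rewrite !normrM normrN.
have h1 : `|(j x).1| * `|V true x| <= enorm (j x) * B0.
  by apply: ler_pM => //; exact: normr_fst_le.
have h2 : `|(j x).2| * `|V false x| <= enorm (j x) * B0.
  by apply: ler_pM => //; exact: normr_snd_le.
lra.
Qed.

Let B0_ge0 : 0 <= B0.
Proof.
have [eta0_gt0 _ _ _] := adm.
by apply: sumr_ge0 => p _; rewrite divr_ge0// ltW.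
Qed.

Let mh : measurable_fun setT h.
Proof. exact: measurable_dot_grad. Qed.

Let integrable_h A : measurable A -> (leb2 R).-integrable A (EFin \o h).
Proof. by move=> mA; apply: integrableS h_pairing.1. Qed.

(* The only loss in passing from the whole plane to the complement of the discs. *)
Let h_balls : `|\int[leb2 R]_(x in balls Lambda eta) h x| <= 2 * B0 * mass_j eta.
Proof.
apply: le_trans (le_normr_Rintegral mB (integrable_h mB)) _.
have : (\int[leb2 R]_(x in balls Lambda eta) (`|h x|)%:E <= (2 * B0 * mass_j eta)%:E)%E.
  have -> : (\int[leb2 R]_(x in balls Lambda eta) (`|h x|)%:E =
     \int[leb2 R]_(x in K `&` balls Lambda eta) (`|h x|)%:E)%E.
    rewrite setIC integral_mkcondr; apply: eq_integral => x _.
    rewrite patchE; case: ifPn => // /negP; rewrite inE => nK.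
    by rewrite /h /dot /perp_grad/= !V_out// oppr0 !mulr0 addr0 normr0.
  have mKB : measurable (K `&` balls Lambda eta) by exact: measurableI.
  have BB : 0 <= 2 * B0 by rewrite mulr_ge0.
  rewrite [leRHS]EFinM mass_jE.
  rewrite -(@ge0_integral_EFinZl _ _ R (leb2 R) _ _ _ mKB BB
    (fun x => enorm_ge0 (j x)) measurable_enormj).
  apply: ge0_le_integral => //.
  - by apply/measurable_EFinP; apply: measurable_funTS; exact: measurableT_comp.
  - apply/measurable_EFinP; apply: measurable_funTS; apply: measurable_funM => //.
    exact: measurable_enormj.
  - by move=> x [_ Bx]; rewrite lee_fin h_core.
have t0 : (0 <= \int[leb2 R]_(x in balls Lambda eta) (`|h x|)%:E)%E.
  by apply: integral_ge0 => x _; rewrite lee_fin.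
move=> le; rewrite /Rintegral -lee_fin fineK//.
by rewrite ge0_fin_numE//; apply: le_lt_trans le _; rewrite ltry.
Qed.

Let h_split : \int[leb2 R]_x h x =
  \int[leb2 R]_(x in balls Lambda eta) h x + \int[leb2 R]_(x in D) h x.
Proof.
have UT : balls Lambda eta `|` D = setT by exact: setUv.
rewrite -Rintegral_setU ?UT//; first exact: integrable_h.
by rewrite disj_set2E /D setICr.
Qed.

Let g x : R := enorm (perp_grad V x) ^+ 2 / chi x.

Let g_ge0 x : 0 <= g x.
Proof. by rewrite divr_ge0// sqr_ge0. Qed.

Let mg : measurable_fun setT g.
Proof. exact: measurable_grad_density. Qed.

Let g_bound : (\int[leb2 R]_(x in D) (g x)%:E <=
  (\sum_(p <- charges) (2 * pi * chi p * ln (core_radius p / eta) +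
     8 * pi * L * core_radius p))%:E)%E.
Proof.
apply: le_trans (integral_grad_density chi_ge0 L_ge0 chi_lip charged radius_small
  mchi mV eta_gt0 eta_lt).
apply: ge0_subset_integral => //.
- by apply/measurable_EFinP.
- by move=> x _; rewrite lee_fin.
Qed.

(* The balance at one charge: 2 pi from the soft maximum, pi M from the measure,
   pi from the variation of chi, and 8 pi from - chi p ln rho = 8 (X + L) rho ln (1 / rho),
   as t ln (1 / t) is at most 1. *)
Let radius_log p : p \in charges ->
  2 * pi * (X + L) + chi p * (4 * pi * M * core_radius p) -
  pi * chi p * ln (core_radius p / eta) + 4 * pi * L * core_radius p <=
  (11 * pi + pi * M) * (X + L) + pi * ln eta * chi p.
Proof.
move=> pS; have := pS; rewrite mem_charges => /andP[cp _].
have r0 := radius_gt0 p; have rE := radiusE pS; have r1 := radius_le pS.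
have lnr : - (core_radius p * ln (core_radius p)) <= 1.
  have := @le_ln1Dx R ((core_radius p)^-1 - 1).
  rewrite [1 + _]addrC subrK lnV ?posrE// ltrBrDr addNr => le.
  have {}le : - ln (core_radius p) <= (core_radius p)^-1 - 1.
    by apply: le; rewrite invr_gt0.
  rewrite -mulrN; apply: (@le_trans _ _ (core_radius p * ((core_radius p)^-1 - 1))).
    by rewrite ler_pM2l.
  by rewrite mulrBr divff ?gt_eqF//; lra.
rewrite ln_div ?posrE//.
have pi0 : 0 <= pi :> R by exact: pi_ge0.
move: (core_radius p) (ln (core_radius p)) (chi p) (ln eta) (pi : R) r0 rE r1 lnr pi0 cp
  (chi_le p) => r l c t P r0 rE r1 lnr P0 c0 cX.
have a1 : P * (- (r * l)) * (8 * (X + L)) <= P * 8 * (X + L).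
  rewrite (_ : _ * _ * _ = P * (8 * (X + L)) * - (r * l)); last by ring.
  rewrite -[leRHS]mulrA -[leRHS]mulr1; apply: ler_wpM2l => //.
  by rewrite !mulr_ge0// ltW.
have a2 : P * M * (4 * (c * r)) <= P * M * (X + L).
  have PM : 0 <= P * M by rewrite mulr_ge0// ltW.
  by apply: ler_wpM2l => //; have := L_ge0; nra.
have a3 : P * (L * (4 * r)) <= P * (X + L).
  by apply: ler_wpM2l => //; have := L_ge0; nra.
have a4 : P * c * l = P * (r * l) * (8 * (X + L)) by rewrite -rE; ring.
lra.
Qed.

Let shield_arith (e a T Im Hb Hd Gd Gb Sl Sm N A : R) :
  2 * pi * T - Im = Hb + Hd -> Hb <= A -> Gd <= Gb -> 2 * pi * Sl <= 2 * pi * T ->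
  Im <= Sm -> Sm - 2 * pi * Sl + 2^-1 * Gb <= N + a ->
  2^-1 * (e - (2 * Hd - Gd)) <= 2^-1 * e + a + (N + A).
Proof. move: (pi : R) => P; lra. Qed.

(** The completed square, integrated off the discs: the circulation term yields
   2 pi chi p ln (1 / eta) for each charge, the self-energy of the potential takes
   half of it back, and the other half is the counterterm in the truncated energy. *)
Lemma shield_truncated_energy :
  ((2^-1)%:E * \int[leb2 R]_(x in D) (chi x * enorm (j x - shield x) ^+ 2)%:E <=
   truncated_energy Lambda j chi eta +
   ((size charges)%:R * ((11 * pi + pi * M) * (X + L)) + 2 * B0 * mass_j eta)%:E)%E.
Proof.
have density x : D x -> chi x * enorm (j x - shield x) ^+ 2 =
    chi x * enorm (j x) ^+ 2 - (2 * h x - g x).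
  move=> Dx; rewrite /h /g -completed_square; last first.
    move=> x0 i; exact: (vortex_grad_supp stiffness L_ge0 chi_lip radius_small).
  have away p : p \in charges -> eta < enorm (x - p).
    rewrite mem_charges => /andP[_ pL]; rewrite ltNge; apply/negP => xp.
    by apply: Dx; exists p.
  by rewrite /shield /field_of -!(vortex_grad_away chi core_radius stiffness _
    (ltW eta_gt0) away).
have [Einf|Efin] := eqVneq (energy D) +oo%E.
  rewrite truncated_energyE -/D Einf gt0_muley ?lte_fin//.
  by rewrite !addye// leey.
have g0 : (0 <= \int[leb2 R]_(x in D) (g x)%:E)%E.
  by apply: integral_ge0 => x _; rewrite lee_fin.
have gfin : (\int[leb2 R]_(x in D) (g x)%:E < +oo)%E.
  by apply: le_lt_trans g_bound _; rewrite ltry.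
have ig : (leb2 R).-integrable D (EFin \o g).
  apply/integrableP; split; first by apply/measurable_EFinP; exact: measurable_funTS.
  rewrite (_ : (fun x => _) = (fun x => (g x)%:E))//.
  by apply/funext => x /=; rewrite ger0_norm.
have ih := integrable_h mD.
have i2h : (leb2 R).-integrable D (EFin \o (fun x => 2 * h x)).
  by apply: (integrableZl mD 2 ih).
have ihg : (leb2 R).-integrable D (EFin \o (fun x => 2 * h x - g x)).
  by apply: (integrableB mD i2h ig).
pose P x := chi x * enorm (j x) ^+ 2.
have iP : (leb2 R).-integrable D (EFin \o P).
  apply/integrableP; split; first by apply: measurable_funTS; exact: measurable_energy_density.
  rewrite (_ : (fun x => _) = (fun x => (P x)%:E)).
    by rewrite ltey.
  by apply/funext => x /=; rewrite ger0_norm// energy_density_ge0.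
have QE : (\int[leb2 R]_(x in D) (chi x * enorm (j x - shield x) ^+ 2)%:E =
    energy D - \int[leb2 R]_(x in D) (2 * h x - g x)%:E)%E.
  transitivity (\int[leb2 R]_(x in D) ((P x)%:E - (2 * h x - g x)%:E))%E.
    by apply: eq_integral => x /set_mem Dx; rewrite density.
  by rewrite integralB_EFin.
have HE : (\int[leb2 R]_(x in D) (2 * h x - g x)%:E =
    (2 * \int[leb2 R]_(x in D) h x - \int[leb2 R]_(x in D) g x)%:E)%E.
  rewrite -RintegralZl// -RintegralB//.
  by rewrite /Rintegral fineK//; exact: integrable_fin_num.
have efin : energy D \is a fin_num by rewrite ge0_fin_numE ?energy_ge0// ltey.
rewrite QE HE truncated_energyE -/D -(fineK efin) -EFinB -!EFinM -!EFinD lee_fin.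
have gR : \int[leb2 R]_(x in D) g x <=
    \sum_(p <- charges) (2 * pi * chi p * ln (core_radius p / eta) +
     8 * pi * L * core_radius p).
  by rewrite -lee_fin /Rintegral fineK// ge0_fin_numE.
have sumchi : \sum_(p <- Lambda) chi p = \sum_(p <- charges) chi p.
  rewrite big_filter [RHS]big_mkcond/=; apply: eq_bigr => p _.
  case: ifPn => //; rewrite -leNgt => c0; apply/eqP.
  by rewrite eq_le c0 chi_ge0.
have sumlog : \sum_(p <- charges) (2 * pi * (X + L) +
     chi p * (4 * pi * M * core_radius p) - pi * chi p * ln (core_radius p / eta) +
     4 * pi * L * core_radius p) <=
   (size charges)%:R * ((11 * pi + pi * M) * (X + L)) +
   pi * ln eta * \sum_(p <- charges) chi p.
  apply: (@le_trans _ _ (\sum_(p <- charges)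
      ((11 * pi + pi * M) * (X + L) + pi * ln eta * chi p))).
    by rewrite big_seq [leRHS]big_seq; apply: ler_sum => p; exact: radius_log.
  by rewrite big_split/= sum_size_const mulrC mulr_sumr.
have decomp : \sum_(p <- charges) (2 * pi * (X + L) +
     chi p * (4 * pi * M * core_radius p) - pi * chi p * ln (core_radius p / eta) +
     4 * pi * L * core_radius p) =
   \sum_(p <- charges) chi p * (4 * pi * M * core_radius p) -
   2 * pi * (\sum_(p <- charges) (chi p * ln (core_radius p / eta) - (X + L))) +
   2^-1 * \sum_(p <- charges) (2 * pi * chi p * ln (core_radius p / eta) +
     8 * pi * L * core_radius p).
  rewrite [2 * pi * (\sum_(_ <- _) _)]mulr_sumr [2^-1 * _]mulr_sumr -sumrB -big_split/=.
  by apply: eq_bigr => p _; field.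
have tauR := ler_wpM2l (_ : 0 <= 2 * pi) tau_charges.
have {}tauR := tauR (mulr_ge0 (ler0n _ 2) (pi_ge0 R)).
have [_ hT] := h_pairing.
have hb := le_trans (ler_norm _) h_balls.
move: h_split; rewrite hT sumchi => split.
rewrite decomp in sumlog.
exact: shield_arith split hb gR tauR tau_measure sumlog.
Qed.

End Truncated.

Lemma shield_lorentz_charged Omega :
  (lorentz_norm Omega shield <=
   ((1 + 8 * pi) * Num.sqrt (size charges)%:R)%:E)%E.
Proof.
pose w x := weight stiffness charges
  (fun p => chi p * capped_log p 0 (core_radius p) x).
apply: (@lorentz_vortices_le R charges w) => //.
- by move=> x p; exact: weight_ge0.
- by move=> x; exact: sum_weight.
- exact: measurable_shield.
move=> x; apply: le_trans (enorm_field_le stiffness chi_ge0 L_ge0 chi_lip radius_small x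
  (lexx 0)) _.
apply: ler_sum => p _; apply: ler_wpM2l; first exact: weight_ge0.
by case: ifP => // _; rewrite mulr_ge0// invr_ge0 enorm_ge0.
Qed.

End Charged.

Let C_M := 11 * pi + pi * M.

Let density x := 2^-1 * (chi x * enorm (j x - shield x) ^+ 2).

Lemma measurable_shield_density :
  measurable_fun setT (fun x => chi x * enorm (j x - shield x) ^+ 2).
Proof.
have m1 : measurable_fun setT (fun x => (j x).1).
  by apply: (measurableT_comp (@measurable_fst _ _ _ _)).
have m2 : measurable_fun setT (fun x => (j x).2).
  by apply: (measurableT_comp (@measurable_snd _ _ _ _)).
have s1 : measurable_fun setT (fun x => (shield x).1).
  by apply: (measurableT_comp (@measurable_fst _ _ _ _)); exact: measurable_shield.
have s2 : measurable_fun setT (fun x => (shield x).2).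
  by apply: (measurableT_comp (@measurable_snd _ _ _ _)); exact: measurable_shield.
apply: measurable_funM => //.
rewrite (_ : (fun x => _) = (fun x => ((j x).1 - (shield x).1) ^+ 2 +
   ((j x).2 - (shield x).2) ^+ 2)); last by apply/funext => x; rewrite sqr_enorm.
by apply: measurable_funD; apply: measurable_funX; exact: measurable_funB.
Qed.

Let measurable_density : measurable_fun setT density.
Proof. by apply: measurable_funM => //; exact: measurable_shield_density. Qed.

Let density_ge0 x : 0 <= density x.
Proof. by rewrite /density mulr_ge0// mulr_ge0// sqr_ge0. Qed.

Let lam_ge0 : 0 <= X + L.
Proof. by rewrite addr_ge0//; exact: le_trans (chi_ge0 0) (chi_le 0). Qed.

Let C_M_ge0 : 0 <= C_M.
Proof. by rewrite addr_ge0// mulr_ge0 ?pi_ge0// ltW. Qed.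

Let shield_near_energy (e : R) : 0 < e -> exists2 d : R, 0 < d & forall eta,
  0 < eta -> eta <= d ->
  ((2^-1)%:E * \int[leb2 R]_(x in ~` balls Lambda eta)
     (chi x * enorm (j x - shield x) ^+ 2)%:E <=
   renormalized_energy Lambda j chi + ((size Lambda)%:R * (C_M * (X + L)) + e)%:E)%E.
Proof.
move=> e0; have [eta0 adm] := exists_admissible_radius.
have [eta0_gt0 _ _ _] := adm.
have e20 : 0 < e / 2 by rewrite divr_gt0.
have [d1 d10 hd1] := energy_defect_small e20.
have [Szero|charged] := eqVneq charges [::].
  exists (Num.min eta0 d1); first by rewrite lt_min eta0_gt0.
  move=> eta eta_gt0; rewrite le_min => /andP[ee ed].
  have shield0 x : shield x = 0.
    by rewrite /shield /field_of /vortex_grad Szero !big_nil mulr0 oppr0.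
  have sum0 : \sum_(p <- Lambda) chi p = 0.
    apply: big1_seq => p /= pL; apply/eqP; rewrite eq_le chi_ge0 andbT leNgt.
    by apply/negP => cp; have := mem_charges p; rewrite Szero cp pL.
  have := truncated_energy_le (admissible_radius_le eta_gt0 ee adm).
  rewrite truncated_energyE sum0 mulr0 adde0 => h.
  under eq_integral do rewrite shield0 subr0.
  apply: le_trans h _; apply: leeD2l; rewrite lee_fin.
  have := hd1 eta eta_gt0 ed.
  have : 0 <= (size Lambda)%:R * (C_M * (X + L)) by rewrite !mulr_ge0.
  by lra.
pose B0 := \sum_(p <- charges) chi p / eta0.
have B00 : 0 <= B0 by apply: sumr_ge0 => p _; rewrite divr_ge0// ltW.
have [d2 d20 hd2] := @mass_j_small (e / 2 / (2 * B0 + 1))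
  ltac:(by rewrite divr_gt0// ltr_wpDl// mulr_ge0).
have [d3 d30 hd3] : exists2 d : R, 0 < d & forall p, d <= core_radius p.
  have [d d0 hd] : exists2 d : R, 0 < d & forall p, p \in charges -> d <= core_radius p.
    apply: seq_pos_min => p pS; rewrite /core_radius pS.
    have := pS; rewrite mem_charges => /andP[cp _]; rewrite divr_gt0// mulr_gt0//.
    by rewrite ltr_pwDl// (lt_le_trans cp).
  exists (Num.min d 1); first by rewrite lt_min d0 ltr01.
  move=> p; rewrite ge_min; have [pS|pS] := boolP (p \in charges).
    by rewrite hd.
  by rewrite /core_radius (negbTE pS) lexx orbT.
exists (Num.min (Num.min eta0 (d3 / 2)) (Num.min d1 d2)).
  by rewrite !lt_min eta0_gt0 d10 d20 divr_gt0.
move=> eta eta_gt0; rewrite !le_min => /andP[/andP[ee ed3] /andP[ed1 ed2]].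
have er p : eta < core_radius p by have := hd3 p; lra.
apply: le_trans (shield_truncated_energy charged adm eta_gt0 ee er) _.
apply: le_trans (leeD2r _ (truncated_energy_le (admissible_radius_le eta_gt0 ee adm))) _.
rewrite -addeA -EFinD; apply: leeD2l; rewrite lee_fin -/C_M -/B0.
have h1 := hd1 eta eta_gt0 ed1.
have h2 : 2 * B0 * mass_j eta <= e / 2.
  have := hd2 eta ed2; rewrite ler_pdivlMr ?ltr_wpDl ?mulr_ge0//.
  by have := mass_j_ge0 eta; lra.
have h3 : (size charges)%:R * (C_M * (X + L)) <= (size Lambda)%:R * (C_M * (X + L)).
  rewrite ler_wpM2r ?mulr_ge0// ler_nat size_filter; exact: count_size.
by lra.
Qed.

(** Monotone convergence, as the removed discs shrink to points. *)
Lemma shield_energy :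
  ((2^-1)%:E * \int[leb2 R]_x (chi x * enorm (j x - shield x) ^+ 2)%:E <=
   renormalized_energy Lambda j chi +
   ((size Lambda)%:R * ((11 * pi + pi * M) * (X + L)))%:E)%E.
Proof.
have f0 x : 0 <= chi x * enorm (j x - shield x) ^+ 2 by rewrite mulr_ge0// sqr_ge0.
have mf := measurable_shield_density.
have half0 : 0 <= 2^-1 :> R by rewrite invr_ge0.
rewrite -(@ge0_integral_EFinZl _ _ R (leb2 R) setT _ _ measurableT half0 f0 mf).
apply/lee_addgt0Pr => e e0; have [d d0 hd] := shield_near_energy e0.
have cv := @cvg_integral_notin_balls R Lambda density setT measurableT
  measurable_density density_ge0.
rewrite -(cvg_lim _ cv)//; apply: lime_le; first by apply/cvg_ex; eexists; exact: cv.
near=> k; have k0 : 0 < k.+1%:R^-1 :> R by rewrite invr_gt0.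
have kd : k.+1%:R^-1 <= d.
  by apply: ltW; near: k; exact: (near_infty_natSinv_lt (PosNum d0)).
rewrite setTD -addeA -EFinD.
have mC : measurable (~` balls Lambda k.+1%:R^-1).
  by apply: measurableC; exact: measurable_balls.
have := hd _ k0 kd.
by rewrite -(@ge0_integral_EFinZl _ _ R (leb2 R) _ _ _ mC half0 f0 mf).
Unshelve. all: end_near.
Qed.

Lemma shield_lorentz Omega :
  (lorentz_norm Omega shield ^+ 2 <= ((1 + 8 * pi) ^+ 2 * (size Lambda)%:R)%:E)%E.
Proof.
have pi0 : 0 <= 1 + 8 * pi :> R by rewrite addr_ge0// mulr_ge0// pi_ge0.
pose c : R := (1 + 8 * pi) * Num.sqrt (size Lambda)%:R.
have c0 : 0 <= c by rewrite mulr_ge0// sqrtr_ge0.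
have n0 : (0 <= lorentz_norm Omega shield)%E by apply: ereal_sup_ubound; left.
have nc : (lorentz_norm Omega shield <= c%:E)%E.
  have [Szero|charged] := eqVneq charges [::]; last first.
    apply: le_trans (shield_lorentz_charged charged Omega) _.
    rewrite lee_fin ler_wpM2l// ler_wsqrtr// ler_nat size_filter; exact: count_size.
  apply: ub_ereal_sup => _ [->|[E [_ _ _ _ ->]]]; first by rewrite lee_fin.
  rewrite integral0_eq ?mule0 ?lee_fin// => x _.
  by rewrite /shield /field_of /vortex_grad Szero !big_nil mulr0 oppr0 enorm0.
rewrite expe2; apply: (@le_trans _ _ (c%:E * c%:E)%E); first exact: lee_pmul.
rewrite -EFinM lee_fin -expr2 exprMn sqr_sqrtr//.
Qed.

End RenormalizedEnergy.

(** * The main estimate *)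

Section Reduction.
Context {R : realType} (U : set (plane R)) (chi : plane R -> R)
  (Lambda : {fset plane R}) (j : plane R -> plane R).
Let Uh := enlarge U.
Context (smooth_chi : smooth chi) (supp_chi : compactly_supported_in U chi).

(* The extension of j by a constant is measurable on the whole plane, and chi, which
   vanishes off Uh, does not see it. *)
Let jp := j \_ Uh.

Let jpE x : Uh x -> jp x = j x.
Proof. by move=> Ux; rewrite /jp patchE mem_set. Qed.

Lemma measurable_patch : loc_integrable Uh j -> measurable_fun setT jp.
Proof.
by move=> [mj _]; apply/(measurable_restrictT _ (measurable_enlarge U)).
Qed.

Lemma loc_integrable_patch : loc_integrable Uh j -> loc_integrable Uh jp.
Proof.
move=> int_j; have mjp := measurable_patch int_j; have [mj ij] := int_j.
split; first exact: measurable_funTS.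
move=> K cK KU; rewrite (_ : (\int[_]_(x in K) _)%E =
    (\int[leb2 R]_(x in K) (enorm (j x))%:E)%E); first exact: ij.
by apply: eq_integral => x /set_mem Kx; rewrite jpE//; exact: KU.
Qed.

Lemma curl_patch : curl Uh jp = curl Uh j.
Proof.
apply/funext => phi; rewrite /curl /distr_partial /distr_of_fun.
by congr (- _ - - _); apply: eq_Rintegral => x /set_mem Ux; rewrite jpE.
Qed.

Lemma chi_out x : ~ Uh x -> chi x = 0.
Proof.
by move=> nU; apply: not_supp0 => /(supp_chi.2 x) /(@sub_enlarge _ _ _).
Qed.

Lemma weighted_patch (G : plane R -> plane R) x :
  chi x * enorm (jp x - G x) ^+ 2 = chi x * enorm (j x - G x) ^+ 2.
Proof.
have [Ux|nU] := pselect (Uh x); first by rewrite jpE.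
by rewrite chi_out// !mul0r.
Qed.

Lemma renormalized_energy_patch :
  renormalized_energy Lambda jp chi = renormalized_energy Lambda j chi.
Proof.
rewrite /renormalized_energy (_ : truncated_energy _ jp _ = truncated_energy Lambda j chi)//.
apply/funext => eta; rewrite /truncated_energy; congr (_ * _ + _)%E.
apply: eq_integral => x _; have := weighted_patch (fun=> 0) x.
by rewrite !subr0 => ->.
Qed.

Lemma sup_norm_chiE : sup_norm chi = (fine (sup_norm chi))%:E.
Proof.
have cchi : continuous chi by exact: smooth_continuous.
have [c c0 hc] := compact_supp_bounded cchi supp_chi.1 (fun x => @not_supp0 _ chi x).
rewrite fineK// ge0_fin_numE ?sup_norm_ge0//.
by apply: le_lt_trans (sup_norm_le hc) _; rewrite ltry.
Qed.

Let dchi := fun x => enorm (grad chi x).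

Lemma continuous_enorm_grad : continuous dchi.
Proof.
move=> x; apply: (@continuous_comp _ _ _
  (fun x => partial false chi x ^+ 2 + partial true chi x ^+ 2) (@Num.sqrt R));
  last exact: sqrt_continuous.
by apply: cvgD; apply: cvgM; exact: smooth_continuous_partial.
Qed.

Lemma sup_norm_gradE : sup_norm dchi = (fine (sup_norm dchi))%:E.
Proof.
have dchi0 x : ~ supp chi x -> dchi x = 0.
  by move=> nK; rewrite /dchi /grad !not_supp_partial// enorm0.
have [c c0 hc] := compact_supp_bounded continuous_enorm_grad supp_chi.1 dchi0.
rewrite fineK// ge0_fin_numE ?sup_norm_ge0//; last exact: continuous_enorm_grad.
by apply: le_lt_trans (sup_norm_le hc) _; rewrite ltry.
Qed.

Lemma chi_le_sup_norm x : chi x <= fine (sup_norm chi).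
Proof.
apply: le_trans (ler_norm _) _; rewrite -lee_fin -sup_norm_chiE.
by apply: normr_le_sup_norm; exact: smooth_continuous.
Qed.

Lemma partial_le_sup_norm i x : `|partial i chi x| <= fine (sup_norm dchi).
Proof.
apply: (@le_trans _ _ `|dchi x|); last first.
  rewrite -lee_fin -sup_norm_gradE.
  by apply: normr_le_sup_norm; exact: continuous_enorm_grad.
rewrite (ger0_norm (enorm_ge0 _)).
by case: i; [exact: (normr_snd_le (grad chi x))|exact: (normr_fst_le (grad chi x))].
Qed.

End Reduction.

Lemma natr_ln_ge0 (R : realType) (k : nat) : 0 <= k%:R * ln (k%:R : R).
Proof.
by case: k => [|k]; [rewrite mul0r|rewrite mulr_ge0// ln_ge0// ler1n].
Qed.

Theorem theorem1 (R : realType) :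
  exists (C : R) (Cb : R -> R -> R),
    0 < C /\
    (forall beta M : R, 0 < beta -> 0 < M -> 0 < Cb beta M) /\
    forall (M : R) (U : set (plane R)) (chi : plane R -> R)
      (Lambda : {fset plane R}) (m : {measure set (plane R) -> \bar R})
      (j : plane R -> plane R),
    let Uh := enlarge U in
    let n : R := #|` Lambda|%:R in
    let n' : R := (low_count Lambda chi)%:R in
    0 < M ->
    open U ->
    smooth chi -> (forall x, 0 <= chi x) -> compactly_supported_in U chi ->
    [set` Lambda] `<=` Uh ->
    radon_on Uh m ->
    (forall (x : plane R) (r : R), Uh x -> 0 < r -> r < 1 ->
       (m (eball x r `&` Uh) <= (pi * M * r)%:E)%E) ->
    loc_integrable Uh j ->
    distr_eq Uh (curl Uh j)
      (fun phi => 2 * pi * distr_of_points Lambda phi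
                  - distr_of_measure Uh m phi) ->
    distr_eq Uh (div Uh j) (fun=> 0) ->
    exists G : plane R -> plane R,
      [/\ measurable_fun Uh G,
          (lorentz_norm Uh G ^+ 2 <= (C * n)%:E)%E &
          forall beta : R, 0 < beta ->
            ((2^-1)%:E *
               \int[leb2 R]_(x in U) (chi x * enorm (j x - G x) ^+ 2)%:E
             <= (1 + beta)%:E * renormalized_energy Lambda j chi
                + (Cb beta M * n)%:E * (sup_norm chi
                    + sup_norm (fun x => enorm (grad chi x)))
                + (Cb beta M * (n' * ln n'))%:E)%E].
Proof.
pose CM (M : R) := 11 * pi + pi * M.
exists ((1 + 8 * pi) ^+ 2), (fun beta M => (1 + beta) * CM M).
have pi0 : 0 < pi :> R by exact: pi_gt0.
have CM_gt0 M : 0 < M -> 0 < CM M by move=> M0; rewrite addr_gt0// mulr_gt0.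
split; first by rewrite exprn_gt0// addr_gt0// mulr_gt0.
split; first by move=> beta M beta0 M0; rewrite mulr_gt0 ?CM_gt0// addr_gt0.
move=> M U chi Lambda m j Uh n n' M0 openU smooth_chi chi_ge0 supp_chi LU radon_m
  m_ball int_j curl_j _.
pose X := fine (sup_norm chi); pose L := fine (sup_norm (fun x => enorm (grad chi x))).
have chi_le x : chi x <= X by exact: (chi_le_sup_norm smooth_chi supp_chi).
have dchi_le i x : `|partial i chi x| <= L by exact: (partial_le_sup_norm smooth_chi supp_chi).
exists (shield chi Lambda L X).
have mG := measurable_shield Lambda L smooth_chi X.
split.
- exact: measurable_funTS.
- exact: (shield_lorentz Lambda smooth_chi chi_ge0 dchi_le chi_le Uh).
move=> beta beta0.
have mjp := measurable_patch int_j.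
have int_jp := loc_integrable_patch int_j.
have curl_jp := curl_j; rewrite -curl_patch in curl_jp.
have := shield_energy smooth_chi chi_ge0 supp_chi M0 radon_m m_ball mjp int_jp
  curl_jp dchi_le chi_le.
have W_gtNy := renormalized_energy_gtNy smooth_chi chi_ge0 supp_chi M0 radon_m m_ball
  mjp int_jp curl_jp dchi_le.
rewrite renormalized_energy_patch// in W_gtNy *.
under eq_integral do rewrite weighted_patch//.
rewrite (sup_norm_chiE smooth_chi supp_chi) (sup_norm_gradE smooth_chi supp_chi).
rewrite -/X -/L -EFinD -EFinM.
set G := shield _ _ _ _; move=> main.
have f0 x : 0 <= chi x * enorm (j x - G x) ^+ 2 by rewrite mulr_ge0// sqr_ge0.
set A := (_ * \int[_]_x _)%E in main.
have A0 : (0 <= A)%E.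
  by rewrite mule_ge0// ?lee_fin//; apply: integral_ge0 => x _; rewrite lee_fin.
have UA : ((2^-1)%:E * \int[leb2 R]_(x in U) (chi x * enorm (j x - G x) ^+ 2)%:E <= A)%E.
  apply: lee_wpmul2l; first by rewrite lee_fin.
  apply: ge0_subset_integral => //; first exact: open_measurable_plane.
  + apply/measurable_EFinP; rewrite (_ : (fun x => _) =
      (fun x => chi x * enorm ((j \_ Uh) x - G x) ^+ 2)).
      exact: measurable_shield_density.
    by apply/funext => x; rewrite weighted_patch.
  + by move=> x _; rewrite lee_fin.
apply: (le_trans UA).
move: W_gtNy main; case: (renormalized_energy _ _ _) => [w| |]// _ main; last first.
  by rewrite gt0_muley ?lte_fin ?addr_gt0// !addye// leey.
apply: (le_trans main); rewrite -EFinM -!EFinD lee_fin.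
have s0 : 0 <= w + n * (CM M * (X + L)).
  by rewrite -lee_fin; apply: le_trans A0 main.
have n'0 : 0 <= (1 + beta) * CM M * (n' * ln n').
  by rewrite mulr_ge0 ?natr_ln_ge0// mulr_ge0 ?ltW ?CM_gt0// addr_gt0.
(* The bound s0 being nonnegative, multiplying it by 1 + beta only increases it. *)
move: s0 n'0; rewrite -/(CM M) -[(size _)%:R]/n.
move: (CM M) (n' * ln n') => c t; nra.
Qed.
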